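(* Let $0<\alpha<\pi$ and $\gamma_\alpha=\{\zeta\in\mathbb T:-\alpha<\arg\zeta<\alpha\}$. Let $\mu\in\mathcal M_*$ be such that $\mu(\{1\})>0$, $\mu(\gamma_\alpha\setminus\{1\})=0$, $\mu(\mathbb T\setminus\gamma_\alpha)>0$, and $$\lim_{\theta\uparrow\alpha}\operatorname{Im}\psi_\mu(e^{i\theta})=-\infty,\qquad \lim_{\theta\downarrow-\alpha}\operatorname{Im}\psi_\mu(e^{i\theta})=\infty.$$ Then $\mu$ is an indecomposable probability measure in $(\mathcal M_*,\boxtimes)$.
   Context: $\mathbb D$ is the open unit disk, $\mathbb T$ the unit circle. $\mathcal M_*$ is the set of Borel probability measures $\mu$ on $\mathbb T$ with $\int_{\mathbb T}\xi\,\mu(d\xi)\ne0$. $\psi_\mu(z)=\int_{\mathbb T}\frac{z\xi}{1-z\xi}\mu(d\xi)$ for $z\in\mathbb D$ (and, for $\mu$ as in the claim, by the same integral at $z=e^{i\theta}$, $\theta\in(-\alpha,\alpha)\setminus\{0\}$), and $Q_\mu=\psi_\mu/(1+\psi_\mu)$ on $\mathbb D$. $\mathcal S_*$ is the class of analytic $Q:\mathbb D\to\overline{\mathbb D}$ with $Q(0)=0$, $Q'(0)\ne0$. Given $\mu_1,\mu_2\in\mathcal M_*$ there are unique $Z_1,Z_2\in\mathcal S_*$ with $Z_1(z)Z_2(z)=zQ_{\mu_1}(Z_1(z))$ and $Q_{\mu_1}(Z_1(z))=Q_{\mu_2}(Z_2(z))$ on $\mathbb D$; the free multiplicative convolution $\mu_1\boxtimes\mu_2$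 is the measure in $\mathcal M_*$ with $Q_{\mu_1\boxtimes\mu_2}(z)=Q_{\mu_1}(Z_1(z))$. $\mu_1\in\mathcal M_*$ is a factor of $\mu$ if $\mu=\mu_1\boxtimes\mu_2$ for some $\mu_2\in\mathcal M_*$; the improper factors of $\mu$ are $\delta_c$ and $\mu\boxtimes\delta_c$, $c\in\mathbb T$ ($\delta_c$ the Dirac measure at $c$). $\mu$ is indecomposable if it is not a Dirac measure and has improper factors only. *)

(* Defs.v *)
From HB Require Import structures.
From mathcomp Require Import all_boot all_order all_algebra.
From mathcomp Require Import complex.
From mathcomp Require Import all_classical all_reals all_analysis.

Set Implicit Arguments.
Unset Strict Implicit.
Unset Printing Implicit Defensive.

Import Order.TTheory GRing.Theory Num.Theory.
Import numFieldNormedType.Exports.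

Local Open Scope classical_set_scope.
Local Open Scope ring_scope.
Local Open Scope complex_scope.

(* The complex plane. The regular module [R[i]^o] is what carries the library's
   norm topology of a [numFieldType], hence its complex differentiability. *)
Notation Cplx R := (R[i]^o).

Definition disk (R : realType) : set (Cplx R) := [set z | `|z| < 1].

Definition circle (R : realType) : Type :=
  set_type [set z : Cplx R | `|z| = 1].

HB.instance Definition _ (R : realType) := Topological.on (circle R).

Definition circle1 (R : realType) : circle R :=
  @exist _ _ (1 : Cplx R) (mem_set (normr1 _)).

HB.instance Definition _ (R : realType) :=
  isPointed.Build (circle R) (circle1 R).

Notation borel_circle R := (g_sigma_algebraType (@open (circle R))).

Definition cval (R : realType) (xi : borel_circle R) : Cplx R := set_val xi.

Definition expi (R : realType) (t : R) : Cplx R := cos t +i* sin t.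

Definition cintegral (R : realType) (mu : probability (borel_circle R) R)
    (f : borel_circle R -> Cplx R) : Cplx R :=
  (\int[mu]_xi complex.Re (f xi))%R +i* (\int[mu]_xi complex.Im (f xi))%R.

Definition Mstar (R : realType) (mu : probability (borel_circle R) R) : Prop :=
  cintegral mu (@cval R) <> 0.

(* Also used at points [z] of the circle: where [z * xi = 1] the integrand is
   [0] since [0^-1 = 0], and a non-integrable integrand yields a junk value. *)
Definition psi (R : realType) (mu : probability (borel_circle R) R)
    (z : Cplx R) : Cplx R :=
  cintegral mu (fun xi => z * cval xi / (1 - z * cval xi)).

Definition Qtrans (R : realType) (mu : probability (borel_circle R) R)
    (z : Cplx R) : Cplx R :=
  psi mu z / (1 + psi mu z).

(* Functions on the disk are total functions whose values off the disk are
   irrelevant. *)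
Definition Sstar (R : realType) (Q : Cplx R -> Cplx R) : Prop :=
  [/\ forall z, disk z -> derivable Q z 1,
      forall z, disk z -> `|Q z| <= 1,
      Q 0 = 0
    & derive1 Q 0 <> 0].

(* [is_fmconv mu1 mu2 mu] reads "mu is the free multiplicative convolution of
   mu1 and mu2". The graph of the operation is used since the subordination
   functions Z1, Z2 exist and are unique in [Sstar], and the restriction of
   [Qtrans mu] to the disk determines mu on Borel sets. *)
Definition is_fmconv (R : realType)
    (mu1 mu2 mu : probability (borel_circle R) R) : Prop :=
  Mstar mu /\
  exists Z1 Z2 : Cplx R -> Cplx R,
    [/\ Sstar Z1, Sstar Z2,
        forall z, disk z -> Z1 z * Z2 z = z * Qtrans mu1 (Z1 z),
        forall z, disk z -> Qtrans mu1 (Z1 z) = Qtrans mu2 (Z2 z)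
      & forall z, disk z -> Qtrans mu z = Qtrans mu1 (Z1 z)].

Definition is_factor (R : realType)
    (mu1 mu : probability (borel_circle R) R) : Prop :=
  Mstar mu1 /\
  exists mu2 : probability (borel_circle R) R,
    Mstar mu2 /\ is_fmconv mu1 mu2 mu.

(* Measures are functions on all sets, whose values on non-measurable sets are
   irrelevant; equality of measures is therefore equality on Borel sets. *)
Definition is_dirac_at (R : realType) (c : borel_circle R)
    (mu : probability (borel_circle R) R) : Prop :=
  forall A : set (borel_circle R), measurable A -> mu A = \d_c A.

Definition is_improper_factor (R : realType)
    (mu1 mu : probability (borel_circle R) R) : Prop :=
  exists c : borel_circle R, is_dirac_at c mu1 \/ is_fmconv mu \d_c mu1.

Definition indecomposable (R : realType)
    (mu : probability (borel_circle R) R) : Prop :=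
  (~ exists c : borel_circle R, is_dirac_at c mu) /\
  forall mu1 : probability (borel_circle R) R,
    is_factor mu1 mu -> is_improper_factor mu1 mu.

Definition open_arc (R : realType) (alpha : R) : set (borel_circle R) :=
  [set xi | exists2 t : R, - alpha < t < alpha & cval xi = expi t].

(* Main.v *)
From HB Require Import structures.
From mathcomp Require Import all_boot all_order all_algebra.
From mathcomp Require Import complex.
From mathcomp Require Import all_classical all_reals all_analysis.
From mathcomp Require Import measurable_realfun ring lra.
Require Import Defs.

(** Let [mu] be the free convolution of [mu1] and [mu2], with subordination
    functions [Z1] and [Z2]; write [Q] for [Qtrans mu], so that
    [Z1 z * Z2 z = z * Q z].

    As [mu] has no mass on the arc [-alpha < arg < alpha] except at 1, [Q] extends
    to the arc, with values on the circle. On the arc [Q = psi / (1 + psi)] with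
    [psi] on the line [Re = - 1 / 2], and [Im psi] decreases from [+oo] to [-oo] on
    either side of 1; so [Q] turns twice around the circle along the arc. Since
    [|Z1| |Z2| = |z| |Q|] and [|Zi| <= |z|], the functions [Z1] and [Z2] have boundary
    values [u1] and [u2] on the circle, whose arguments increase along the arc by
    [4 pi + 2 alpha] in total. One of them, say [u1], turns by more than [2 pi] and
    thus returns to a value after turning by exactly [2 pi]. As
    [Q = Qtrans mu1 o Z1], [Q] returns to the same value as well; it has turned by
    [2 pi] too, because it turns by less than [4 pi] in all. But
    [Q = Z1 * (Z2 / z)], and the argument of [Z2 / z] increases strictly on the
    boundary unless [Z2] is a rotation ([no_full_turn], [two_curves_false]). The
    rotation cases are exactly those where the barycentre of [mu1] or of [mu2] is
    on the circle. A measure with such a barycentre is a Dirac measure ([unimodular_mean_dirac]); if it is [mu1]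
    this is an improper factor, and if it is [mu2] then [mu1] is a rotation of [mu]
    ([fmconv_unimodular_mean]).

    All the function theory comes from Cauchy-Schwarz. The Pick kernel of
    [m z = Qtrans mu z / z] is a covariance of Cauchy kernels, which gives the
    Schwarz-Pick inequality for two points ([mtrans_pick2]). Cancelling in the
    functional equations, [Z2 = z (m1 o Z1)] and [Z1 = z (m2 o Z2)]
    ([subordination]), and these equations transmit the inequality to [Z1] and [Z2]
    ([subordination_pick2]). The cancellation has to avoid the zeros of [Q], which
    are nowhere dense on radii ([cauchy1_zeros_nowhere_dense]). At the boundary the
    Schwarz-Pick inequality compares angular speeds: if the barycentre of [mu1] is
    inside the disk, the speed of [u1] is less than that of [Q] by a positive
    constant ([bvalue_chord], [Qarg_faster]). The speed of [Q] is the diagonal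
    [Qspeed] of its Pick kernel, which has an explicit continuous extension to the
    arc. *)

Set Implicit Arguments.
Unset Strict Implicit.
Unset Printing Implicit Defensive.

Import Order.TTheory GRing.Theory Num.Theory.
Import numFieldNormedType.Exports.

Local Open Scope classical_set_scope.
Local Open Scope ring_scope.
Local Open Scope complex_scope.

Local Notation Re := complex.Re.
Local Notation Im := complex.Im.
Local Notation cj := complex.conjc.

(** * Complex numbers in real coordinates *)

(** The squared modulus as a real number: the norm of [R[i]] takes its values
    in [R[i]]. *)
Definition nsq (R : realType) (z : R[i]) : R := Re z ^+ 2 + Im z ^+ 2.

Section ComplexAlgebra.
Variable R : realType.
Implicit Types (x y : R) (z w f g : R[i]).

Lemma eq_ge0 x y : x = y -> 0 <= x -> 0 <= y.
Proof. by move=> ->. Qed.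

Lemma cReD z w : Re (z + w) = Re z + Re w. Proof. by case: z; case: w. Qed.
Lemma cImD z w : Im (z + w) = Im z + Im w. Proof. by case: z; case: w. Qed.
Lemma cReN z : Re (- z) = - Re z. Proof. by case: z. Qed.
Lemma cImN z : Im (- z) = - Im z. Proof. by case: z. Qed.
Lemma cReM z w : Re (z * w) = Re z * Re w - Im z * Im w.
Proof. by case: z; case: w. Qed.
Lemma cImM z w : Im (z * w) = Re z * Im w + Im z * Re w.
Proof. by case: z; case: w. Qed.
Lemma cReJ z : Re (cj z) = Re z. Proof. by case: z. Qed.
Lemma cImJ z : Im (cj z) = - Im z. Proof. by case: z. Qed.
Lemma cReV z : Re z^-1 = Re z / nsq z. Proof. by case: z. Qed.
Lemma cImV z : Im z^-1 = - Im z / nsq z.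
Proof. by case: z => a b; rewrite mulNr. Qed.

Lemma complex_eq z w : Re z = Re w -> Im z = Im w -> z = w.
Proof. by case: z => a b; case: w => c d /= -> ->. Qed.

Definition cReImE := (cReD, cImD, cReN, cImN, cReM, cImM, cReJ, cImJ, @cReV, @cImV).

Lemma realCM x y : (x * y)%:C = x%:C * y%:C.
Proof. by apply: complex_eq; rewrite !cReImE /=; ring. Qed.

Lemma realCD x y : (x + y)%:C = x%:C + y%:C.
Proof. by apply: complex_eq; rewrite !cReImE /=; ring. Qed.

Lemma realCN x : (- x)%:C = - x%:C.
Proof. by apply: complex_eq; rewrite !cReImE /= ?oppr0. Qed.

Lemma conjcR x : cj x%:C = x%:C.
Proof. by rewrite /= oppr0. Qed.

Lemma nsq_ge0 z : 0 <= nsq z.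
Proof. by rewrite addr_ge0 ?sqr_ge0. Qed.

Lemma nsq0 : nsq (0 : R[i]) = 0. Proof. by rewrite /nsq /= expr0n addr0. Qed.

Lemma nsq1 : nsq (1 : R[i]) = 1.
Proof. by rewrite /nsq /= expr0n expr1n addr0. Qed.

Lemma nsq_real x : nsq x%:C = x ^+ 2.
Proof. by rewrite /nsq /= expr0n addr0. Qed.

Lemma nsq_eq0 z : (nsq z == 0) = (z == 0).
Proof. by rewrite paddr_eq0 ?sqr_ge0 // !sqrf_eq0 eq_complex. Qed.

Lemma nsq_gt0 z : (0 < nsq z) = (z != 0).
Proof. by rewrite lt_def nsq_ge0 andbT nsq_eq0. Qed.

Lemma nsqM z w : nsq (z * w) = nsq z * nsq w.
Proof. rewrite /nsq !cReImE; ring. Qed.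

Lemma nsqN z : nsq (- z) = nsq z.
Proof. by rewrite /nsq !cReImE !sqrrN. Qed.

Lemma nsqBC z w : nsq (z - w) = nsq (w - z).
Proof. by rewrite -nsqN opprB. Qed.

Lemma nsqJ z : nsq (cj z) = nsq z.
Proof. by rewrite /nsq !cReImE sqrrN. Qed.

Lemma nsqV z : nsq z^-1 = (nsq z)^-1.
Proof.
have [->|z0] := eqVneq z 0; first by rewrite invr0 nsq0 invr0.
have n0 : nsq z != 0 by rewrite nsq_eq0.
by apply: (mulIf n0); rewrite -nsqM !mulVf // nsq1.
Qed.

Lemma mulJ z : z * cj z = (nsq z)%:C.
Proof. apply: complex_eq; rewrite !cReImE /nsq /=; ring. Qed.

Lemma conjcM z w : cj (z * w) = cj z * cj w.
Proof. by apply: complex_eq; rewrite !cReImE; ring. Qed.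

Lemma conjcD z w : cj (z + w) = cj z + cj w.
Proof. by apply: complex_eq; rewrite !cReImE; ring. Qed.

Lemma conjcN z : cj (- z) = - cj z.
Proof. by apply: complex_eq; rewrite !cReImE; ring. Qed.

Lemma conjc1 : cj (1 : R[i]) = 1.
Proof. by apply: complex_eq; rewrite !cReImE /= ?oppr0. Qed.

Lemma conjcK z : cj (cj z) = z.
Proof. by apply: complex_eq; rewrite !cReImE ?opprK. Qed.

Lemma conjcV z : cj z^-1 = (cj z)^-1.
Proof. by apply: complex_eq; rewrite !cReImE nsqJ ?mulNr ?opprK. Qed.

Definition conjcE := (conjcM, conjcD, conjcN, conjc1, conjcV, conjcK).

Lemma unimodJ z : nsq z = 1 -> cj z = z^-1.
Proof.
move=> z1; have z0 : z != 0 by rewrite -nsq_gt0 z1.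
by apply: (mulfI z0); rewrite mulJ z1 mulfV.
Qed.

Lemma nsqR z : Re z ^+ 2 <= nsq z. Proof. by rewrite lerDl sqr_ge0. Qed.
Lemma nsqI z : Im z ^+ 2 <= nsq z. Proof. by rewrite lerDr sqr_ge0. Qed.

Lemma nsqD_le z w : nsq (z + w) <= 2 * nsq z + 2 * nsq w.
Proof.
rewrite -subr_ge0; suff -> : 2 * nsq z + 2 * nsq w - nsq (z + w) = nsq (z - w).
  exact: nsq_ge0.
by rewrite /nsq !cReImE; ring.
Qed.

(** The squared modulus of a sum, in the form of the triangle inequality
    without square roots. *)
Lemma nsqD_le_sqr z w (p q : R) : 0 <= p -> 0 <= q ->
  nsq z <= p ^+ 2 -> nsq w <= q ^+ 2 -> nsq (z + w) <= (p + q) ^+ 2.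
Proof.
move=> p0 q0 zp wq.
have cs : Re z * Re w + Im z * Im w <= p * q.
  have [s0|s0] := lerP 0 (Re z * Re w + Im z * Im w); last first.
    by apply: (le_trans (ltW s0)); rewrite mulr_ge0.
  rewrite -(@ler_sqr _ _ (p * q)) ?nnegrE ?mulr_ge0 //.
  apply: (@le_trans _ _ (nsq z * nsq w)).
    rewrite /nsq -subr_ge0.
    have -> : (Re z ^+ 2 + Im z ^+ 2) * (Re w ^+ 2 + Im w ^+ 2) -
       (Re z * Re w + Im z * Im w) ^+ 2 = (Re z * Im w - Im z * Re w) ^+ 2.
      by ring.
    exact: sqr_ge0.
  by rewrite exprMn ler_pM ?nsq_ge0.
have -> : nsq (z + w) = nsq z + nsq w + 2 * (Re z * Re w + Im z * Im w).
  by rewrite /nsq !cReImE; ring.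
have -> : (p + q) ^+ 2 = p ^+ 2 + q ^+ 2 + 2 * (p * q) by ring.
by rewrite !lerD // ler_pM2l.
Qed.

(** The identity behind pseudo-hyperbolic distances. *)
Lemma nsq_pick f g :
  nsq (1 - f * cj g) - (1 - nsq f) * (1 - nsq g) = nsq (f - g).
Proof. rewrite /nsq !cReImE /=; ring. Qed.

Lemma nsq_pick_gt0 f g : nsq f < 1 -> nsq g < 1 -> 0 < nsq (1 - f * cj g).
Proof.
move=> f1 g1; have := nsq_pick f g => /eqP; rewrite subr_eq => /eqP ->.
by rewrite ltr_wpDl ?nsq_ge0 // mulr_gt0 // subr_gt0.
Qed.

Lemma disk_nsq (z : Cplx R) : disk z <-> nsq z < 1.
Proof.
rewrite /disk /=.
have -> : `|z| = (Num.sqrt (nsq z))%:C :> R[i] by case: z.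
rewrite -[1]/(1%:C) ltcR; split => h.
  by rewrite -(sqr_sqrtr (nsq_ge0 z)) expr_lt1 // sqrtr_ge0.
by rewrite -[1]sqrtr1 ltr_sqrt.
Qed.

Lemma le1_nsq (z : Cplx R) : `|z| <= 1 <-> nsq z <= 1.
Proof.
have -> : `|z| = (Num.sqrt (nsq z))%:C :> R[i] by case: z.
rewrite -[1]/(1%:C) lecR; split => h.
  by rewrite -(sqr_sqrtr (nsq_ge0 z)) expr_le1 // sqrtr_ge0.
by rewrite -[1]sqrtr1 ler_sqrt.
Qed.

Lemma eq1_nsq (z : Cplx R) : `|z| = 1 <-> nsq z = 1.
Proof.
have -> : `|z| = (Num.sqrt (nsq z))%:C :> R[i] by case: z.
split => [|->]; last by rewrite sqrtr1.
by rewrite -[1]/(1%:C) => -[h]; rewrite -(sqr_sqrtr (nsq_ge0 z)) h expr1n.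
Qed.

Lemma nsq_expi (t : R) : nsq (expi t) = 1.
Proof. by rewrite /nsq /= cos2Dsin2. Qed.

End ComplexAlgebra.

(** * Angles *)

Section Trig.
Variable R : realType.
Implicit Types (x y t : R).

Lemma expiD x y : expi (x + y) = (expi x : R[i]) * expi y.
Proof. by apply: complex_eq; rewrite ?cReM ?cImM /= ?cosD ?sinD; ring. Qed.

Lemma expiN x : expi (- x) = cj (expi x : R[i]).
Proof. by apply: complex_eq; rewrite ?cReJ ?cImJ /= ?cosN ?sinN. Qed.

Lemma expiB x y : expi (x - y) = (expi x : R[i]) * cj (expi y : R[i]).
Proof. by rewrite expiD expiN. Qed.

Lemma expi0 : expi 0 = 1 :> R[i].
Proof. by apply: complex_eq; rewrite /= ?cos0 ?sin0. Qed.

Lemma expi2pi : expi (pi *+ 2) = 1 :> R[i].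
Proof. by apply: complex_eq; rewrite /= ?cos2pi ?sin2pi. Qed.

Lemma expi_acos (z : R[i]) : nsq z = 1 ->
  exists2 t, expi t = z & `|t| = acos (Re z).
Proof.
rewrite /nsq; set x := Re z; set y := Im z => xy.
have x1 : -1 <= x <= 1 by apply/andP; split; nra.
have cx : cos (acos x) = x by apply: acosK; rewrite in_itv.
have sx : sin (acos x) = `|y|.
  by rewrite sin_acos // -sqrtr_sqr; congr Num.sqrt; lra.
have ax0 := acos_ge0 x1.
have [y0|y0] := lerP 0 y.
  exists (acos x); last exact: ger0_norm.
  by apply: complex_eq; rewrite /= ?cx ?sx // ger0_norm.
exists (- acos x); last by rewrite normrN ger0_norm.
apply: complex_eq; rewrite /= ?cosN ?sinN ?cx ?sx // ltr0_norm //.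
by rewrite opprK.
Qed.

Lemma cos_half x : cos x = 1 - 2 * sin (x / 2) ^+ 2.
Proof.
have {1}-> : x = (x / 2) *+ 2 by rewrite -mulr_natr divfK.
by rewrite cos_mulr2n cos2sin2; ring.
Qed.

Lemma sin_half x : sin x = 2 * (sin (x / 2) * cos (x / 2)).
Proof.
have {1}-> : x = (x / 2) *+ 2 by rewrite -mulr_natr divfK.
by rewrite sin_mulr2n; ring.
Qed.

Lemma nsq_expiB x y :
  nsq (1 - (expi x : R[i]) * cj (expi y : R[i])) = 4 * sin ((x - y) / 2) ^+ 2.
Proof.
rewrite -expiB /nsq !(cReD, cImD, cReN, cImN) /=.
set s := x - y; have := cos2Dsin2 s.
rewrite [cos s]cos_half; set k := sin (s / 2) ^+ 2; nra.
Qed.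

Lemma sin_half_gt0 x : 0 < x -> x < pi -> 0 < sin (x / 2).
Proof. by move=> x0 xpi; apply: sin_gt0_pi; apply/andP; split; lra. Qed.

Lemma cos_eq1_small x : cos x = 1 -> `|x| < pi *+ 2 -> x = 0.
Proof.
rewrite cos_half => h xpi; have /eqP : sin (x / 2) ^+ 2 = 0 by lra.
rewrite sqrf_eq0 => /eqP s0.
have p0 := pi_gt0 R; move: xpi; rewrite ltr_norml mulr2n => /andP[x1 x2].
have [x0|x0|//] := ltgtP x 0.
- have := @sin_gt0_pi _ (- (x / 2)); rewrite sinN s0 oppr0 ltxx => /(_ _) h1.
  by have : false by apply: h1; apply/andP; split; lra.
- have := @sin_gt0_pi _ (x / 2); rewrite s0 ltxx => /(_ _) h1.
  by have : false by apply: h1; apply/andP; split; lra.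
Qed.

Lemma cos_eq1_between x : cos x = 1 -> 0 < x -> x < pi *+ 4 -> x = pi *+ 2.
Proof.
move=> c1 x0 x4; apply/eqP; rewrite -subr_eq0; apply/eqP.
apply: cos_eq1_small.
  by rewrite cosB cos2pi sin2pi mulr1 mulr0 addr0.
move: x4; rewrite ltr_norml !mulrS mulr0n => x4; apply/andP; split; lra.
Qed.

(** On [(0, 2 pi)], an angle with negative sine and cosine larger than [cos e]
    is at distance less than [e] from [2 pi]. *)
Lemma angle_near_2pi x e : 0 < e < pi -> 0 < x < pi *+ 2 ->
  sin x < 0 -> cos e < cos x -> pi *+ 2 - e < x.
Proof.
move=> /andP[e0 epi] /andP[x0 x2] sx cx.
have xpi : pi < x.
  rewrite ltNge; apply/negP => xpi; move: sx; apply/negP; rewrite -leNgt.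
  by apply: sin_ge0_pi; rewrite (ltW x0).
have : cos e < cos (pi *+ 2 - x) by rewrite cosB cos2pi sin2pi mul1r mul0r addr0.
move: x2; rewrite mulr2n => x2.
rewrite ltr_cos ?in_itv /=; last 2 first.
- by apply/andP; split; lra.
- by apply/andP; split; lra.
by lra.
Qed.

Lemma sin_sqr_lt x y : `|x| <= pi / 2 -> `|y| <= pi / 2 ->
  sin x ^+ 2 < sin y ^+ 2 -> `|x| < `|y|.
Proof.
move=> xp yp.
have E (z : R) : sin z ^+ 2 = sin `|z| ^+ 2.
  by have [z0|z0] := lerP 0 z; rewrite ?(ger0_norm z0) // (ltr0_norm z0) sinN sqrrN.
have s0 (z : R) : `|z| <= pi / 2 -> 0 <= sin `|z|.
  move=> zp; apply: sin_ge0_pi; rewrite normr_ge0 /=.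
  by have := pi_gt0 R; lra.
rewrite (E x) (E y) ltr_sqr ?nnegrE ?s0 // ltr_sin //.
- by rewrite in_itv /= xp andbT; have := pi_gt0 R; have := normr_ge0 x; lra.
- by rewrite in_itv /= yp andbT; have := pi_gt0 R; have := normr_ge0 y; lra.
Qed.

End Trig.

(** * Bounded measurable functions on the circle *)

Section Integration.
Variable R : realType.
Implicit Types (h g : borel_circle R -> R[i]).

Lemma nsq_dist (z : Cplx R) (e : R) : 0 < e ->
  \forall w \near z, nsq (w - z) < e.
Proof.
move=> e0; have e0' : (0 : R[i]) < (Num.sqrt e)%:C by rewrite ltcR sqrtr_gt0.
near=> w.
have : `|z - w| < (Num.sqrt e)%:C by near: w; exact: cvgr_dist_lt.
have -> : `|z - w| = (Num.sqrt (nsq (z - w)))%:C :> R[i] by case: (z - w).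
by rewrite ltcR ltr_sqrt // nsqBC.
Unshelve. all: by end_near. Qed.

Lemma Re_continuous : continuous (@complex.Re R : Cplx R -> R).
Proof.
move=> z; have FF : Filter (nbhs z) by exact: nbhs_filter.
apply/(cvgrPdist_lt (FF := FF)) => e e0; near=> w.
rewrite -ltr_sqr ?nnegrE ?normr_ge0 ?(ltW e0) // real_normK ?num_real //.
rewrite -cReN -cReD; apply: le_lt_trans (nsqR _) _; rewrite nsqBC.
near: w; apply: nsq_dist; exact: exprn_gt0.
Unshelve. all: by end_near. Qed.

Lemma Im_continuous : continuous (@complex.Im R : Cplx R -> R).
Proof.
move=> z; have FF : Filter (nbhs z) by exact: nbhs_filter.
apply/(cvgrPdist_lt (FF := FF)) => e e0; near=> w.
rewrite -ltr_sqr ?nnegrE ?normr_ge0 ?(ltW e0) // real_normK ?num_real //.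
rewrite -cImN -cImD; apply: le_lt_trans (nsqI _) _; rewrite nsqBC.
near: w; apply: nsq_dist; exact: exprn_gt0.
Unshelve. all: by end_near. Qed.

Lemma open_measurable_circle (A : set (circle R)) :
  open A -> measurable (A : set (borel_circle R)).
Proof. by move=> oA; apply: sub_sigma_algebra. Qed.

Lemma continuous_measurable_circle (f : Cplx R -> R) : continuous f ->
  measurable_fun setT (fun xi : borel_circle R => f (cval xi)).
Proof.
move=> cf; apply: (measurability _ (RGenOpens.measurableE R)).
move=> _ [_ [a [b ->] <-]]; rewrite setTI.
apply: open_measurable_circle.
apply: (@open_comp _ _ (f \o set_val)); last exact: interval_open.
move=> x _; apply: continuous_comp; last exact: cf.
exact: initial_continuous.
Qed.

Definition cv (xi : borel_circle R) : R[i] := cval xi.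

(** Measurable and bounded functions, coordinate by coordinate: a class that is
    closed under the algebra used below and on which all integrals exist. *)
Definition bmf h := [/\ measurable_fun setT (fun xi => Re (h xi)),
  measurable_fun setT (fun xi => Im (h xi))
  & exists M, forall xi, nsq (h xi) <= M].

Lemma bmf_cst (c : R[i]) : bmf (fun=> c).
Proof. by split; [exact: measurable_cst..|exists (nsq c)]. Qed.

Lemma bmf_cv : bmf cv.
Proof.
split; first exact: (continuous_measurable_circle Re_continuous).
  exact: (continuous_measurable_circle Im_continuous).
exists 1 => -[z zP]; rewrite /cv /cval /=.
by have := set_mem zP => /eq1_nsq ->.
Qed.

Lemma nsq_cv (xi : borel_circle R) : nsq (cv xi) = 1.
Proof. by case: xi => z zP; apply/eq1_nsq; exact: (set_mem zP). Qed.

Lemma bmfD h g : bmf h -> bmf g -> bmf (fun xi => h xi + g xi).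
Proof.
move=> [mh1 mh2 [M hM]] [mg1 mg2 [N gN]]; split.
- by under eq_fun do rewrite cReD; exact: measurable_funD.
- by under eq_fun do rewrite cImD; exact: measurable_funD.
exists (2 * M + 2 * N) => xi; apply: (le_trans (nsqD_le _ _)).
by rewrite lerD // ler_pM2l.
Qed.

Lemma bmfM h g : bmf h -> bmf g -> bmf (fun xi => h xi * g xi).
Proof.
move=> [mh1 mh2 [M hM]] [mg1 mg2 [N gN]]; split.
- by under eq_fun do rewrite cReM; apply: measurable_funB; exact: measurable_funM.
- by under eq_fun do rewrite cImM; apply: measurable_funD; exact: measurable_funM.
by exists (M * N) => xi; rewrite nsqM ler_pM ?nsq_ge0.
Qed.

Lemma bmfJ h : bmf h -> bmf (fun xi => cj (h xi)).
Proof.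
move=> [mh1 mh2 [M hM]]; split.
- by under eq_fun do rewrite cReJ.
- by under eq_fun do rewrite cImJ; exact: measurable_funN.
by exists M => xi; rewrite nsqJ.
Qed.

Lemma bmfN h : bmf h -> bmf (fun xi => - h xi).
Proof.
move=> [mh1 mh2 [M hM]]; split.
- by under eq_fun do rewrite cReN; exact: measurable_funN.
- by under eq_fun do rewrite cImN; exact: measurable_funN.
by exists M => xi; rewrite nsqN.
Qed.

Lemma measurable_cinv h : measurable_fun setT (fun xi => Re (h xi)) ->
  measurable_fun setT (fun xi => Im (h xi)) ->
  measurable_fun setT (fun xi => Re (h xi)^-1) /\
  measurable_fun setT (fun xi => Im (h xi)^-1).
Proof.
move=> mh1 mh2.
have mV : measurable_fun setT (fun xi => (nsq (h xi))^-1).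
  under eq_fun => xi do rewrite -(powR_inv1 (nsq_ge0 _)).
  apply: (measurableT_comp (measurable_powR _)).
  by apply: measurable_funD; exact: measurable_funX.
split.
- by under eq_fun do rewrite cReV; exact: measurable_funM.
- by under eq_fun do rewrite cImV; apply: measurable_funM => //; exact: measurable_funN.
Qed.

Lemma bmfV h (d : R) : 0 < d -> (forall xi, d <= nsq (h xi)) -> bmf h ->
  bmf (fun xi => (h xi)^-1).
Proof.
move=> d0 hd [mh1 mh2 _]; have [mi1 mi2] := measurable_cinv mh1 mh2; split => //.
by exists d^-1 => xi; rewrite nsqV lef_pV2 ?posrE // (lt_le_trans d0).
Qed.

Lemma bmf_indic (A : set (borel_circle R)) : measurable A ->
  bmf (fun xi => (\1_A xi : R)%:C).
Proof.
move=> mA; split; [exact: measurable_indic|exact: measurable_cst|exists 1] => xi.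
by rewrite nsq_real indicE; case: (_ \in _); rewrite ?expr1n ?expr0n ?ler01.
Qed.

Variable mu : probability (borel_circle R) R.

Definition cint h : R[i] := cintegral mu h.

Lemma integrable_bounded (f : borel_circle R -> R) (M : R) :
  measurable_fun setT f -> (forall xi, `|f xi| <= M) ->
  mu.-integrable setT (EFin \o f).
Proof.
move=> mf fM; apply: measurable_bounded_integrable => //.
  by apply: le_lt_trans (probability_le1 _ _) _; rewrite ?ltry.
exists M; split; first exact: num_real.
by move=> x Mx xi _; apply: (le_trans (fM xi)); exact: ltW.
Qed.

Lemma bmf_integrable h : bmf h ->
  mu.-integrable setT (EFin \o (fun xi => Re (h xi))) /\
  mu.-integrable setT (EFin \o (fun xi => Im (h xi))).
Proof.
move=> [mh1 mh2 [M hM]].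
have sq (x : R) : x ^+ 2 <= M -> `|x| <= 1 + M.
  by move=> xM; rewrite ler_norml; apply/andP; split; nra.
split; apply: (integrable_bounded (M := 1 + M)) => // xi; apply: sq.
- exact: le_trans (nsqR _) (hM _).
- exact: le_trans (nsqI _) (hM _).
Qed.

Lemma eq_cint h g : h =1 g -> cint h = cint g.
Proof. by move=> /funext ->. Qed.

Lemma ae_eq_cint (N : set (borel_circle R)) h g : measurable N ->
  mu N = 0%E -> bmf h -> (measurable_fun setT (fun xi => Re (g xi))) ->
  (measurable_fun setT (fun xi => Im (g xi))) ->
  (forall xi, ~ N xi -> h xi = g xi) ->
  cint h = cint g.
Proof.
move=> mN N0 [mh1 mh2 _] mg1 mg2 hg; apply: complex_eq => /=.
  congr fine; apply: ae_eq_integral => //; try exact/measurable_EFinP.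
  exists N; split=> // xi /= /not_implyP[_ hgxi]; apply: contrapT => /hg E.
  by apply: hgxi; rewrite E.
congr fine; apply: ae_eq_integral => //; try exact/measurable_EFinP.
exists N; split=> // xi /= /not_implyP[_ hgxi]; apply: contrapT => /hg E.
by apply: hgxi; rewrite E.
Qed.

Lemma cintD h g : bmf h -> bmf g ->
  cint (fun xi => h xi + g xi) = cint h + cint g.
Proof.
move=> /bmf_integrable[ih1 ih2] /bmf_integrable[ig1 ig2].
apply: complex_eq; rewrite /= -RintegralD //; apply: eq_Rintegral => xi _.
- exact: cReD.
- exact: cImD.
Qed.

Lemma cintZ (c : R[i]) h : bmf h ->
  cint (fun xi => c * h xi) = c * cint h.
Proof.
move=> bh; have [ih1 ih2] := bmf_integrable bh.
have i1 (r : R) : mu.-integrable setT (EFin \o (fun xi => r * Re (h xi))).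
  exact: (integrableZl measurableT _ ih1).
have i2 (r : R) : mu.-integrable setT (EFin \o (fun xi => r * Im (h xi))).
  exact: (integrableZl measurableT _ ih2).
apply: complex_eq; rewrite ?cReM ?cImM /= -!RintegralZl //.
  rewrite -RintegralB; [|exact: measurableT|exact: i1|exact: i2].
  by apply: eq_Rintegral => xi _; rewrite cReM.
rewrite -RintegralD; [|exact: measurableT|exact: i2|exact: i1].
by apply: eq_Rintegral => xi _; rewrite cImM.
Qed.

Lemma cint_cst (c : R[i]) : cint (fun=> c) = c.
Proof.
have P1 : fine (mu setT) = 1 by rewrite probability_setT.
by apply: complex_eq => /=; rewrite Rintegral_cst // P1 mulr1.
Qed.

Lemma cintN h : bmf h ->
  cint (fun xi => - h xi) = - cint h.
Proof.
move=> bh; rewrite -mulN1r -cintZ //.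
by apply: eq_cint => xi; rewrite mulN1r.
Qed.

Lemma cintJ h : bmf h ->
  cint (fun xi => cj (h xi)) = cj (cint h).
Proof.
move=> bh; apply: complex_eq.
  by rewrite cReJ /=; apply: eq_Rintegral => xi _; rewrite cReJ.
have -> : Im (cj (cint h)) = Im (- cint h) by rewrite cImJ cImN.
rewrite -cintN //=.
by apply: eq_Rintegral => xi _; rewrite cImJ cImN.
Qed.

Lemma cint_ge0 h : (forall xi, 0 <= Re (h xi)) -> 0 <= Re (cint h).
Proof. by move=> h0 /=; apply: Rintegral_ge0. Qed.

Lemma cint_le h g : bmf h -> bmf g ->
  (forall xi, Re (h xi) <= Re (g xi)) ->
  Re (cint h) <= Re (cint g).
Proof.
move=> bh bg hg; rewrite -subr_ge0 -cReN -cReD -cintN // -cintD //.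
  by apply: cint_ge0 => xi; rewrite cReD cReN subr_ge0.
exact: bmfN.
Qed.

(** Cauchy-Schwarz against the constant 1: the variance
    [\int |h|^2 - |\int h|^2] is nonnegative. *)
Lemma nsq_cint h : bmf h ->
  nsq (cint h) <= Re (cint (fun xi => h xi * cj (h xi))).
Proof.
move=> bh; set c := cintegral mu h.
have bJ := bmfJ bh.
have : 0 <= Re (cint (fun xi => (h xi - c) * cj (h xi - c))).
  by apply: cint_ge0 => xi; rewrite mulJ /= nsq_ge0.
have -> : cint (fun xi => (h xi - c) * cj (h xi - c)) =
   cint (fun xi => h xi * cj (h xi)) - c * cj c.
  transitivity (cint (fun xi => (h xi * cj (h xi) + (- cj c) * h xi) +
      ((- c) * cj (h xi) + c * cj c))).
    by apply: eq_cint => xi; rewrite !conjcE; ring.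
  have b1 : bmf (fun xi => h xi * cj (h xi)) by exact: bmfM.
  have b2 (a : R[i]) g : bmf g -> bmf (fun xi => a * g xi).
    by move=> bg; exact: (bmfM (bmf_cst a)).
  rewrite !cintD ?cintZ ?cintJ ?cint_cst //;
    try (do ?[exact: b1|exact: bmf_cst|exact: b2|apply: bmfD]).
  by rewrite (_ : cint (fun xi => h xi) = c) //; ring.
by rewrite cReD cReN mulJ /= subr_ge0.
Qed.

Lemma nsq_cint_le h (M : R) : bmf h -> (forall xi, nsq (h xi) <= M) ->
  nsq (cint h) <= M.
Proof.
move=> bh hM; apply: le_trans (nsq_cint bh) _.
have -> : M = Re (cint (fun=> M%:C)) by rewrite cint_cst.
apply: cint_le; [exact: (bmfM bh (bmfJ bh))|exact: bmf_cst|].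
by move=> xi; rewrite mulJ /=.
Qed.

End Integration.

(** * The two-point Pick inequality *)

Section Pick.
Variable R : realType.
Implicit Types (s : R) (f g u v z w : R[i]).

(** For [f], [g] in the open disk this says that their pseudo-hyperbolic
    distance is at most [sqrt (1 - s)]. In this form it also makes sense when
    [f] or [g] is on the circle, and forces [f = g] there when [0 < s]. *)
Definition pick2 s f g := s * nsq (1 - f * cj g) <= (1 - nsq f) * (1 - nsq g).

(** Cauchy-Schwarz for the vectors [(sqrt A, sqrt C)] and [(sqrt A', sqrt C')],
    squared. *)
Lemma sqrtD_le (A A' C C' : R) : 0 <= A -> 0 <= A' -> 0 <= C -> 0 <= C' ->
  (Num.sqrt (A * A') + Num.sqrt (C * C')) ^+ 2 <= (A + C) * (A' + C').
Proof.
move=> A0 A'0 C0 C'0; rewrite sqrrD !sqr_sqrtr ?mulr_ge0 //.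
rewrite !sqrtrM //.
have := sqr_ge0 (Num.sqrt A * Num.sqrt C' - Num.sqrt A' * Num.sqrt C).
rewrite sqrrB !exprMn !sqr_sqrtr // => h.
by rewrite -subr_ge0; apply: eq_ge0 h; ring.
Qed.

(** The pseudo-hyperbolic distance of two products is at most the larger of
    those of the factors. Split [1 - u v cj (u' v')] into [1 - u cj u'] and
    [u cj u' (1 - v cj v')] and apply Cauchy-Schwarz. With [strict], the
    inequality is strict as soon as it is so for the factors [u], [u']. *)
Lemma nsq_pickM u u' v v' s (strict : bool) : 0 < s ->
  nsq u < 1 -> nsq u' < 1 -> nsq v <= 1 -> nsq v' <= 1 ->
  (s * nsq (1 - u * cj u') < (1 - nsq u) * (1 - nsq u') ?<= if ~~ strict)%R ->
  pick2 s v v' ->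
  (s * nsq (1 - u * v * cj (u' * v')) <
    (1 - nsq (u * v)) * (1 - nsq (u' * v')) ?<= if ~~ strict)%R.
Proof.
move=> s0 u1 u'1 v1 v'1 hu hv.
set A := 1 - nsq u; set A' := 1 - nsq u'.
set C := nsq u * (1 - nsq v); set C' := nsq u' * (1 - nsq v').
have A0 : 0 <= A by rewrite subr_ge0 ltW.
have A'0 : 0 <= A' by rewrite subr_ge0 ltW.
have C0 : 0 <= C by rewrite mulr_ge0 ?nsq_ge0 // subr_ge0.
have C'0 : 0 <= C' by rewrite mulr_ge0 ?nsq_ge0 // subr_ge0.
have -> : 1 - nsq (u * v) = A + C by rewrite nsqM /A /C; ring.
have -> : 1 - nsq (u' * v') = A' + C' by rewrite nsqM /A' /C'; ring.
have -> : 1 - u * v * cj (u' * v') =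
    (1 - u * cj u') + u * cj u' * (1 - v * cj v') by rewrite conjcM; ring.
set x := 1 - _; set y := _ * (1 - v * cj v').
have hy : s * nsq y <= C * C'.
  rewrite /y !nsqM nsqJ /C /C'.
  have -> : s * (nsq u * nsq u' * nsq (1 - v * cj v')) =
    (nsq u * nsq u') * (s * nsq (1 - v * cj v')) by ring.
  have -> : nsq u * (1 - nsq v) * (nsq u' * (1 - nsq v')) =
    (nsq u * nsq u') * ((1 - nsq v) * (1 - nsq v')) by ring.
  by rewrite ler_wpM2l // mulr_ge0 ?nsq_ge0.
have le1 : s * nsq (x + y) <= (Num.sqrt (s * nsq x) + Num.sqrt (s * nsq y)) ^+ 2.
  rewrite !sqrtrM ?(ltW s0) // -mulrDr exprMn sqr_sqrtr ?(ltW s0) //.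
  rewrite ler_pM2l // nsqD_le_sqr ?sqrtr_ge0 ?sqr_sqrtr ?nsq_ge0 //.
have le2 : Num.sqrt (s * nsq y) <= Num.sqrt (C * C') by rewrite ler_wsqrtr.
have le3 := sqrtD_le A0 A'0 C0 C'0.
case: strict hu => /= hu; last first.
  apply: le_trans le1 (le_trans _ le3).
  rewrite ler_sqr ?nnegrE ?addr_ge0 ?sqrtr_ge0 // lerD // ler_wsqrtr //.
apply: le_lt_trans le1 (lt_le_trans _ le3).
rewrite ltr_sqr ?nnegrE ?addr_ge0 ?sqrtr_ge0 // ltr_leD // ltr_sqrt //.
by apply: le_lt_trans hu; rewrite mulr_ge0 ?nsq_ge0 // ltW.
Qed.

End Pick.

(** * Covariances of complex functions *)

Section Covariance.
Variables (R : realType) (mu : probability (borel_circle R) R).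
Implicit Types (f g : borel_circle R -> R[i]).
Local Notation cint := (cint mu).

Definition cov f g :=
  cint (fun xi => f xi * cj (g xi)) - cint f * cj (cint g).

(** Positivity of the variance of [s f + t g] for all complex [s], [t]. *)
Lemma cov_form f g (s t : R[i]) : bmf f -> bmf g ->
  0 <= nsq s * Re (cov f f) + nsq t * Re (cov g g) + 2 * Re (s * cj t * cov f g).
Proof.
move=> bf bg; pose h xi := s * f xi + t * g xi.
have bZ (a : R[i]) k : bmf k -> bmf (fun xi => a * k xi).
  by move=> bk; exact: (bmfM (bmf_cst a)).
have bh : bmf h by apply: bmfD; exact: bZ.
have := nsq_cint mu bh; rewrite -subr_ge0; apply: eq_ge0.
have bff := bmfM bf (bmfJ bf); have bgg := bmfM bg (bmfJ bg).
have bfg := bmfM bf (bmfJ bg); have bgf := bmfM bg (bmfJ bf).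
have -> : cint h = s * cint f + t * cint g.
  by rewrite /h cintD ?cintZ //; exact: bZ.
have -> : cint (fun xi => h xi * cj (h xi)) =
   s * cj s * cint (fun xi => f xi * cj (f xi)) +
   s * cj t * cint (fun xi => f xi * cj (g xi)) +
   (cj (s * cj t) * cint (fun xi => g xi * cj (f xi)) +
   t * cj t * cint (fun xi => g xi * cj (g xi))).
  rewrite -!cintZ // -!cintD; try (by do ?[exact: bZ|apply: bmfD]).
  by apply: eq_cint => xi; rewrite /h !conjcE; ring.
have -> : cint (fun xi => g xi * cj (f xi)) = cj (cint (fun xi => f xi * cj (g xi))).
  rewrite -cintJ //; apply: eq_cint => xi; rewrite !conjcE; ring.
rewrite /cov.
move: (cint (fun xi => f xi * cj (f xi))) (cint (fun xi => f xi * cj (g xi))).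
move: (cint (fun xi => g xi * cj (g xi))) (cint f) (cint g) => C a b A B.
by rewrite /nsq !cReImE; ring.
Qed.

Lemma cov_ge0 f : bmf f -> 0 <= Re (cov f f).
Proof.
move=> bf; have := cov_form 1 0 bf bf.
have -> : 1 * cj 0 * cov f f = 0 by rewrite [cj 0](_ : _ = 0) ?mulr0 ?mul0r //= oppr0.
by rewrite nsq0 nsq1 mul1r mul0r /= mulr0 !addr0.
Qed.

(** Cauchy-Schwarz: the form is tested at the vector orthogonal to [g], and at
    suitable multiples of [f] and [g] in the degenerate cases. *)
Lemma nsq_cov f g : bmf f -> bmf g ->
  nsq (cov f g) <= Re (cov f f) * Re (cov g g).
Proof.
move=> bf bg; set F := Re (cov f f); set G := Re (cov g g); set X := cov f g.
have F0 : 0 <= F by exact: cov_ge0.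
have G0 : 0 <= G by exact: cov_ge0.
have [G1|G1] := ltrP 0 G.
  have := cov_form G%:C (- X) bf bg.
  rewrite -/F -/G -/X conjcN nsqN nsq_real.
  have -> : G%:C * - cj X * X = (- (G * nsq X))%:C.
    by rewrite realCN realCM -mulJ; ring.
  rewrite /= => h; rewrite -(ler_pM2l G1) -subr_ge0.
  by apply: eq_ge0 h; ring.
have {G0}{}G1 : G = 0 by apply/eqP; rewrite eq_le G1 G0.
have [F1|F1] := ltrP 0 F.
  have := cov_form (- cj X) F%:C bf bg.
  rewrite -/F -/G -/X nsqN nsqJ nsq_real.
  have -> : - cj X * cj F%:C * X = (- (F * nsq X))%:C.
    rewrite conjcR.
    by rewrite realCN realCM -mulJ; ring.
  rewrite /= => h; rewrite -(ler_pM2l F1) -subr_ge0.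
  by apply: eq_ge0 h; ring.
have {F0}{}F1 : F = 0 by apply/eqP; rewrite eq_le F1 F0.
have := cov_form 1 (- X) bf bg; rewrite -/F -/G -/X F1 G1 !mulr0 addr0.
have -> : 1 * cj (- X) * X = (- nsq X)%:C.
  by rewrite realCN -mulJ conjcN; ring.
by rewrite /= add0r mulrN oppr_ge0 pmulr_rle0.
Qed.

End Covariance.

(** * The Q-transform and its Pick kernel *)

Section Transform.
Variables (R : realType) (mu : probability (borel_circle R) R).
Implicit Types (z w : R[i]) (xi : borel_circle R).
Local Notation cint := (cint mu).

(** Since [1 - |z| >= (1 - |z| ^ 2) / 2], this is a form of the inequality
    [1 - |z| <= |1 - z|] that avoids square roots. *)
Lemma nsq_1sub_ge z : nsq z < 1 -> (1 - nsq z) ^+ 2 / 4 <= nsq (1 - z).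
Proof.
move=> z1; set s := nsq z in z1 *; set x := Re z.
have xs : x ^+ 2 <= s by exact: nsqR.
have s0 : 0 <= s by exact: nsq_ge0.
have -> : nsq (1 - z) = 1 - 2 * x + s.
  by rewrite /s /x /nsq !cReImE /=; ring.
rewrite -subr_ge0; set T := 1 + s - (1 - s) ^+ 2 / 4.
rewrite (_ : _ - _ = T - 2 * x); last by rewrite /T; ring.
rewrite leNgt; apply/negP => xT.
have T0 : 0 <= T by rewrite /T; nra.
have : T ^+ 2 < 4 * s.
  apply: (@lt_le_trans _ _ ((2 * x) ^+ 2)); last by nra.
  by rewrite ltr_sqr ?nnegrE //; nra.
apply/negP; rewrite -leNgt -subr_ge0.
have -> : T ^+ 2 - 4 * s = (1 - s) ^+ 2 * ((1 - s) / 2 + (1 - s) ^+ 2 / 16).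
  by rewrite /T; field.
by rewrite mulr_ge0 ?sqr_ge0 // addr_ge0 ?divr_ge0 ?sqr_ge0 // subr_ge0 ltW.
Qed.

Definition ckernel z xi : R[i] := (1 - z * cv xi)^-1.

Definition cauchy0 z := cint (ckernel z).
Definition cauchy1 z := cint (fun xi => cv xi * ckernel z xi).
Definition gram z w := cint (fun xi => ckernel z xi * cj (ckernel w xi)).

(** The quotient [Qtrans mu z / z] without its singularity at 0. *)
Definition mtrans z := cauchy1 z / cauchy0 z.

Lemma ckernel_den z xi : nsq z < 1 ->
  (1 - nsq z) ^+ 2 / 4 <= nsq (1 - z * cv xi).
Proof.
move=> z1; have : nsq (z * cv xi) = nsq z by rewrite nsqM nsq_cv mulr1.
by move=> E; rewrite -E; apply: nsq_1sub_ge; rewrite E.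
Qed.

Lemma ckernel_den_neq0 z xi : nsq z < 1 -> 1 - z * cv xi != 0.
Proof.
move=> z1; rewrite -nsq_gt0; apply: lt_le_trans (ckernel_den xi z1).
by rewrite divr_gt0 // exprn_gt0 // subr_gt0.
Qed.

Lemma bmf_ckernel z : nsq z < 1 -> bmf (ckernel z).
Proof.
move=> z1; apply: (@bmfV _ _ ((1 - nsq z) ^+ 2 / 4)).
- by rewrite divr_gt0 // exprn_gt0 // subr_gt0.
- by move=> xi; exact: ckernel_den.
- apply: bmfD; first exact: bmf_cst.
  by apply: bmfN; apply: bmfM; [exact: bmf_cst|exact: bmf_cv].
Qed.

Lemma bmf_cvkernel z : nsq z < 1 -> bmf (fun xi => cv xi * ckernel z xi).
Proof. by move=> z1; apply: bmfM; [exact: bmf_cv|exact: bmf_ckernel]. Qed.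

Lemma psiE z : nsq z < 1 -> psi mu z = z * cauchy1 z.
Proof.
move=> z1; rewrite -cintZ; last exact: bmf_cvkernel.
by apply: eq_cint => xi; rewrite mulrA.
Qed.

Lemma cauchy0E z : nsq z < 1 -> cauchy0 z = 1 + z * cauchy1 z.
Proof.
move=> z1; rewrite -cintZ; last exact: bmf_cvkernel.
rewrite -{1}(cint_cst mu 1) -cintD; last 2 first.
- exact: bmf_cst.
- by apply: bmfM; [exact: bmf_cst|exact: bmf_cvkernel].
apply: eq_cint => xi; rewrite /ckernel.
have := ckernel_den_neq0 xi z1; move: (cv xi) => x hx; by field.
Qed.

Lemma Re_ckernel z xi : nsq z < 1 -> 1 / 2 <= Re (ckernel z xi).
Proof.
move=> z1; rewrite cReV ler_pdivlMr; last first.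
  by rewrite nsq_gt0 ckernel_den_neq0.
have : nsq (z * cv xi) = nsq z by rewrite nsqM nsq_cv mulr1.
rewrite /(nsq (1 - _)) /(nsq (_ * _)) !(cReD, cReN, cImD, cImN).
move: (Re (z * _)) (Im (z * _)) => x y /= E; nra.
Qed.

Lemma Re_cauchy0 z : nsq z < 1 -> 1 / 2 <= Re (cauchy0 z).
Proof.
move=> z1; have -> : 1 / 2 = Re (cint (fun=> (1 / 2)%:C)) by rewrite cint_cst.
apply: cint_le; [exact: bmf_cst|exact: bmf_ckernel|].
by move=> xi; exact: Re_ckernel.
Qed.

Lemma cauchy0_neq0 z : nsq z < 1 -> cauchy0 z != 0.
Proof.
move=> /Re_cauchy0 h; apply/eqP => E; rewrite E /= in h.
by move: h; rewrite leNgt divr_gt0.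
Qed.

Lemma QtransE z : nsq z < 1 -> Qtrans mu z = z * mtrans z.
Proof.
by move=> z1; rewrite /Qtrans psiE // -cauchy0E // /mtrans mulrA.
Qed.

Lemma gramE z w : nsq z < 1 -> nsq w < 1 ->
  (1 - z * cj w) * gram z w = cauchy0 z + cj (cauchy0 w) - 1.
Proof.
move=> z1 w1; have bz := bmf_ckernel z1; have bw := bmf_ckernel w1.
have bwJ := bmfJ bw.
rewrite /gram /cauchy0 -cintJ // -cintZ; last exact: bmfM.
rewrite -(cint_cst mu (- 1)) -!cintD; try exact: bmf_cst;
  try (by do ?[exact: bz|exact: bwJ|apply: bmfD]).
apply: eq_cint => xi; rewrite /ckernel.
have h := ckernel_den_neq0 xi z1; have := ckernel_den_neq0 xi w1.
rewrite conjcV !conjcE (unimodJ (nsq_cv xi)) => h'.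
have x0 : cv xi != 0 by rewrite -nsq_gt0 nsq_cv.
have h2 : 1 - cj w / cv xi != 0.
  have := h'; rewrite -nsq_gt0 -nsqJ !conjcE (unimodJ (nsq_cv xi)).
  by rewrite nsq_gt0.
have h3 : cv xi - cj w != 0.
  by apply: contra_neq h2 => /eqP; rewrite subr_eq0 => /eqP <-; rewrite divff ?subrr.
move: (cv xi) (cj w) x0 h h2 h3 => x v x0 h h2 h3.
by field; rewrite x0 h h3.
Qed.

Lemma cov_cvkernel z w : nsq z < 1 -> nsq w < 1 ->
  cov mu (fun xi => cv xi * ckernel z xi) (fun xi => cv xi * ckernel w xi) =
  gram z w - cauchy1 z * cj (cauchy1 w).
Proof.
move=> z1 w1; congr (_ - _); apply: eq_cint => xi.
rewrite conjcM; transitivity (cv xi * cj (cv xi) * (ckernel z xi * cj (ckernel w xi))).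
  by ring.
by rewrite mulJ nsq_cv mul1r.
Qed.

Let V z := Re (gram z z - cauchy1 z * cj (cauchy1 z)).

Lemma schur_var_ge0 z : nsq z < 1 -> 0 <= V z.
Proof.
by move=> z1; rewrite /V -cov_cvkernel //; apply: cov_ge0; exact: bmf_cvkernel.
Qed.

(** The numerator of the Pick kernel of [mtrans]. As [xi] has modulus 1, the
    last factor is the covariance of the functions [xi / (1 - z xi)] and
    [xi / (1 - w xi)]. *)
Lemma gram_schur z w : nsq z < 1 -> nsq w < 1 ->
  cauchy0 z * cj (cauchy0 w) - cauchy1 z * cj (cauchy1 w) =
  (1 - z * cj w) * (gram z w - cauchy1 z * cj (cauchy1 w)).
Proof.
move=> z1 w1; rewrite mulrBr gramE // !cauchy0E // !conjcE; ring.
Qed.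

Lemma nsq_cauchyB z : nsq z < 1 ->
  nsq (cauchy0 z) - nsq (cauchy1 z) = (1 - nsq z) * V z.
Proof.
move=> z1; have := congr1 (@complex.Re R) (gram_schur z1 z1).
rewrite /V !mulJ => h; transitivity (Re ((nsq (cauchy0 z))%:C - (nsq (cauchy1 z))%:C)).
  by rewrite cReD cReN.
rewrite h cReM !cReD !cReN !cImD !cImN /=; ring.
Qed.

Lemma nsq_mtrans z : nsq z < 1 -> nsq (mtrans z) <= 1.
Proof.
move=> z1; rewrite nsqM nsqV ler_pdivrMr ?nsq_gt0 ?cauchy0_neq0 // mul1r.
rewrite -subr_ge0 nsq_cauchyB // mulr_ge0 ?schur_var_ge0 //.
by rewrite subr_ge0 ltW.
Qed.

(** The Schur function [Q(z) / z] contracts the pseudo-hyperbolic distance: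
    its Pick kernel is a covariance, to which Cauchy-Schwarz applies. *)
Lemma mtrans_pick2 s z w : nsq z < 1 -> nsq w < 1 -> 0 <= s ->
  pick2 s z w -> pick2 s (mtrans z) (mtrans w).
Proof.
move=> z1 w1 s0 szw.
have az := cauchy0_neq0 z1; have aw := cauchy0_neq0 w1.
have nz : 0 < nsq (cauchy0 z) by rewrite nsq_gt0.
have nw : 0 < nsq (cauchy0 w) by rewrite nsq_gt0.
have ajw : cj (cauchy0 w) != 0 by rewrite -nsq_gt0 nsqJ.
set X := gram z w - cauchy1 z * cj (cauchy1 w).
have e1 : 1 - mtrans z * cj (mtrans w) =
    (1 - z * cj w) * X / (cauchy0 z * cj (cauchy0 w)).
  rewrite -gram_schur // /mtrans conjcM conjcV.
  by move: (cj (cauchy0 w)) ajw => v v0; field; rewrite az v0.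
have e2 x : nsq x < 1 ->
    1 - nsq (mtrans x) = (1 - nsq x) * V x / nsq (cauchy0 x).
  move=> x1; rewrite -nsq_cauchyB // nsqM nsqV mulrBl divff //.
  by rewrite nsq_eq0 cauchy0_neq0.
rewrite /pick2 e1 !e2 // !nsqM nsqV nsqM nsqJ.
have hX : nsq X <= V z * V w.
  rewrite /X /V -!cov_cvkernel //; apply: nsq_cov; exact: bmf_cvkernel.
rewrite mulrA [leRHS](_ : _ = (1 - nsq z) * (1 - nsq w) * (V z * V w) /
   (nsq (cauchy0 z) * nsq (cauchy0 w))); last first.
  by field; rewrite !gt_eqF.
rewrite ler_pM2r ?invr_gt0 ?mulr_gt0 //.
by rewrite mulrA ler_pM ?mulr_ge0 ?nsq_ge0.
Qed.

(** The Pick kernel of [Qtrans mu] is a Gram matrix. *)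
Lemma Qtrans_kernel z w : nsq z < 1 -> nsq w < 1 ->
  1 - Qtrans mu z * cj (Qtrans mu w) =
  (1 - z * cj w) * (gram z w / (cauchy0 z * cj (cauchy0 w))).
Proof.
move=> z1 w1; rewrite mulrA gramE //.
have az := cauchy0_neq0 z1; have aw := cauchy0_neq0 w1.
have ajw : cj (cauchy0 w) != 0 by rewrite -nsq_gt0 nsqJ nsq_gt0.
have e x : nsq x < 1 -> Qtrans mu x = 1 - (cauchy0 x)^-1.
  move=> x1; have a0 := cauchy0_neq0 x1.
  rewrite QtransE // /mtrans mulrA.
  have -> : x * cauchy1 x = cauchy0 x - 1 by rewrite cauchy0E //; ring.
  by field.
rewrite !e // !conjcE; move: (cj (cauchy0 w)) ajw => v v0.
by field; rewrite az v0.
Qed.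

Lemma Qtrans_pick2 s z w : nsq z < 1 -> nsq w < 1 -> 0 < s ->
  pick2 s z w -> pick2 s (Qtrans mu z) (Qtrans mu w).
Proof.
move=> z1 w1 s0 szw; rewrite !QtransE //.
apply: (nsq_pickM (strict := false)) => //; try exact: nsq_mtrans.
by apply: mtrans_pick2 => //; exact: ltW.
Qed.

Lemma mtrans0 : mtrans 0 = cint (@cv R).
Proof.
rewrite /mtrans cauchy0E ?nsq0 // mul0r addr0 divr1; apply: eq_cint => xi.
by rewrite /ckernel mul0r subr0 invr1 mulr1.
Qed.

End Transform.

(** * Limits of complex functions *)

Section ComplexLimits.
Variable R : realType.
Implicit Types (l m : R[i]).

(** Convergence along an arbitrary filter, by coordinates, so that the limit laws
    for real functions apply. *)
Definition ccvg (T : Type) (F : set_system T) (f : T -> R[i]) l :=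
  ((fun x => Re (f x)) @ F --> Re l) /\ ((fun x => Im (f x)) @ F --> Im l).

Variables (T : Type) (F : set_system T).
Context {FF : Filter F}.
Implicit Types f g : T -> R[i].

Lemma ccvg_cst l : ccvg F (fun=> l) l.
Proof. by split; exact: cvg_cst. Qed.

Lemma ccvgD f g l m : ccvg F f l -> ccvg F g m ->
  ccvg F (fun x => f x + g x) (l + m).
Proof.
move=> [f1 f2] [g1 g2]; split.
- by rewrite cReD; under eq_fun do rewrite cReD; exact: cvgD.
- by rewrite cImD; under eq_fun do rewrite cImD; exact: cvgD.
Qed.

Lemma ccvgM f g l m : ccvg F f l -> ccvg F g m ->
  ccvg F (fun x => f x * g x) (l * m).
Proof.
move=> [f1 f2] [g1 g2]; split.
- by rewrite cReM; under eq_fun do rewrite cReM; apply: cvgB; exact: cvgM.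
- by rewrite cImM; under eq_fun do rewrite cImM; apply: cvgD; exact: cvgM.
Qed.

Lemma ccvgN f l : ccvg F f l -> ccvg F (fun x => - f x) (- l).
Proof.
move=> [f1 f2]; split.
- by rewrite cReN; under eq_fun do rewrite cReN; exact: cvgN.
- by rewrite cImN; under eq_fun do rewrite cImN; exact: cvgN.
Qed.

Lemma ccvgJ f l : ccvg F f l -> ccvg F (fun x => cj (f x)) (cj l).
Proof.
move=> [f1 f2]; split.
- by rewrite cReJ; under eq_fun do rewrite cReJ.
- by rewrite cImJ; under eq_fun do rewrite cImJ; exact: cvgN.
Qed.

Lemma ccvg_nsq f l : ccvg F f l -> (fun x => nsq (f x)) @ F --> nsq l.
Proof.
by move=> [f1 f2]; apply: cvgD; rewrite expr2; under eq_fun do rewrite expr2;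
  exact: cvgM.
Qed.

Lemma ccvgV f l : l != 0 -> ccvg F f l -> ccvg F (fun x => (f x)^-1) l^-1.
Proof.
move=> l0 fl; have nl := ccvg_nsq fl; have [f1 f2] := fl.
have nV : (fun x => (nsq (f x))^-1) @ F --> (nsq l)^-1.
  by apply: cvgV; rewrite ?nsq_eq0.
split.
- by rewrite cReV; under eq_fun do rewrite cReV; exact: cvgM.
- by rewrite cImV; under eq_fun do rewrite cImV; apply: cvgM => //; exact: cvgN.
Qed.

Lemma ccvg_real (f : T -> R) (l : R) : f @ F --> l ->
  ccvg F (fun x => (f x)%:C) l%:C.
Proof. by move=> fl; split => //=; exact: cvg_cst. Qed.

Lemma ccvg_dist f l : (fun x => nsq (f x - l)) @ F --> (0 : R) -> ccvg F f l.
Proof.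
move=> /cvgrPdist_lt h.
have sm (e : R) : 0 < e -> \forall x \near F, nsq (f x - l) < e ^+ 2.
  move=> e0; apply: filterS (h _ (exprn_gt0 2 e0)) => x.
  by rewrite sub0r normrN ger0_norm ?nsq_ge0.
split; apply/cvgrPdist_lt => e e0; apply: filterS (sm _ e0) => x xe.
- rewrite distrC -ltr_sqr ?nnegrE ?normr_ge0 ?(ltW e0) // real_normK ?num_real //.
  by rewrite -cReN -cReD; apply: le_lt_trans (nsqR _) xe.
- rewrite distrC -ltr_sqr ?nnegrE ?normr_ge0 ?(ltW e0) // real_normK ?num_real //.
  by rewrite -cImN -cImD; apply: le_lt_trans (nsqI _) xe.
Qed.

Lemma ccvg_cvg f l : ccvg F f l -> (f : T -> Cplx R) @ F --> (l : Cplx R).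
Proof.
move=> fl; apply/cvgrPdist_lt => e e0.
have reE : e = (Re e)%:C by apply: complex_eq => //; move: e0; rewrite ltcE => /andP[/eqP].
have r0 : 0 < Re e by move: e0; rewrite ltcE => /andP[].
have h : (fun x => nsq (f x - l)) @ F --> nsq (l - l).
  by apply: ccvg_nsq; apply: ccvgD => //; exact: ccvg_cst.
move: h; rewrite subrr nsq0 => /cvgrPdist_lt /(_ _ (exprn_gt0 2 r0)).
apply: filterS => x; rewrite sub0r normrN ger0_norm ?nsq_ge0 // nsqBC => xe.
have -> : `|l - f x : Cplx R| = (Num.sqrt (nsq (l - f x)))%:C by case: (l - f x).
rewrite reE ltcR -(ger0_norm (ltW r0)) -sqrtr_sqr ltr_sqrt // exprn_gt0 //.
Qed.

Lemma ccvg_near_unique (PF : ProperFilter F) f g l m :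
  ccvg F f l -> ccvg F g m -> (\forall x \near F, f x = g x) -> l = m.
Proof.
move=> fl gm fg; apply/eqP; rewrite -subr_eq0 -nsq_eq0 eq_le nsq_ge0 andbT.
have h : (fun x => nsq (f x - g x)) @ F --> nsq (l - m).
  by apply: ccvg_nsq; apply: ccvgD => //; exact: ccvgN.
apply: (cvgr_to_le h); apply: filterS fg => x ->.
by rewrite subrr nsq0.
Qed.

End ComplexLimits.

(** * Zeros of the transform on a radius *)

Section Zeros.
Variables (R : realType) (mu : probability (borel_circle R) R).
Variable z : R[i].
Hypothesis z1 : nsq z < 1.
Implicit Types (s t : R) (xi : borel_circle R).
Local Notation cint := (cint mu).
Local Notation F t := (cauchy1 mu (t%:C * z)).

Let d := (1 - nsq z) ^+ 2 / 4.

Let d_gt0 : 0 < d.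
Proof. by rewrite divr_gt0 // exprn_gt0 // subr_gt0. Qed.

Lemma nsq_segment t : 0 <= t <= 1 -> nsq (t%:C * z) <= nsq z.
Proof.
by move=> /andP[t0 t1]; rewrite nsqM nsq_real ler_piMl ?nsq_ge0 // expr_le1.
Qed.

Let nsq_segment_lt1 t : 0 <= t <= 1 -> nsq (t%:C * z) < 1.
Proof. by move=> /nsq_segment h; exact: le_lt_trans h z1. Qed.

Let nsq_ckernel t xi : 0 <= t <= 1 -> nsq (ckernel (t%:C * z) xi) <= d^-1.
Proof.
move=> t01; rewrite nsqV lef_pV2 ?posrE //; last first.
  by rewrite nsq_gt0 ckernel_den_neq0 // nsq_segment_lt1.
apply: le_trans (ckernel_den xi (nsq_segment_lt1 t01)).
rewrite ler_pM2r ?invr_gt0 // ler_sqr ?nnegrE ?subr_ge0.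
- by rewrite lerD2l lerN2 nsq_segment.
- exact: ltW.
- exact: ltW (nsq_segment_lt1 t01).
Qed.

Section Newton.
Variable x : nat -> R.
Hypothesis x01 : forall i, 0 <= x i <= 1.
Hypothesis x_inj : injective x.
Hypothesis Fx0 : forall i, F (x i) = 0.

Fixpoint newton n xi : R[i] :=
  if n is k.+1 then newton k xi * (z * cv xi * ckernel ((x k)%:C * z) xi)
  else cv xi.

Lemma bmf_newton n : bmf (newton n).
Proof.
elim: n => [|n IH]; first exact: bmf_cv.
apply: bmfM IH _; apply: bmfM; last exact/bmf_ckernel/nsq_segment_lt1.
by apply: bmfM; [exact: bmf_cst|exact: bmf_cv].
Qed.

Lemma nsq_newton n xi : nsq (newton n xi) <= (d^-1) ^+ n.
Proof.
elim: n => [|n IH] /=; first by rewrite nsq_cv.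
rewrite exprSr nsqM ler_pM ?nsq_ge0 // !nsqM nsq_cv mulr1.
by rewrite -[leRHS]mul1r ler_pM ?nsq_ge0 ?(ltW z1) // nsq_ckernel.
Qed.

(** Newton interpolation of [t |-> cauchy1 mu (t z)] at the nodes [x 0, x 1, ...]:
    all the divided differences are zero, so only the remainder is left. *)
Lemma cauchy1_newton n t : 0 <= t <= 1 ->
  F t = (\prod_(i < n) (t - x i))%:C *
        cint (fun xi => newton n xi * ckernel (t%:C * z) xi).
Proof.
elim: n t => [|n IH] t t01; first by rewrite big_ord0 mul1r.
have bN (s : R) k : 0 <= s <= 1 -> bmf (fun xi => newton k xi * ckernel (s%:C * z) xi).
  by move=> s01; apply: bmfM; [exact: bmf_newton|exact/bmf_ckernel/nsq_segment_lt1].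
rewrite big_ord_recr /= realCM -mulrA [(t - x n)%:C * _]mulrC.
have -> : cint (fun xi => newton n.+1 xi * ckernel (t%:C * z) xi) * (t - x n)%:C =
   cint (fun xi => newton n xi * ckernel (t%:C * z) xi) -
   cint (fun xi => newton n xi * ckernel ((x n)%:C * z) xi).
  rewrite mulrC -cintZ; last exact: bN.
  rewrite -cintN; last exact: bN.
  rewrite -cintD; [|exact: bN|by apply: bmfN; exact: bN].
  apply: eq_cint => xi /=; rewrite /ckernel.
  have h1 := ckernel_den_neq0 xi (nsq_segment_lt1 t01).
  have h2 := ckernel_den_neq0 xi (nsq_segment_lt1 (x01 n)).
  rewrite realCD realCN.
  move: h1 h2; move: (t%:C) ((x n)%:C) (cv xi) => t' x' v h1 h2.
  by field; rewrite h1 h2.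
suff -> : cint (fun xi => newton n xi * ckernel ((x n)%:C * z) xi) = 0.
  by rewrite subr0; exact: IH.
have := IH _ (x01 n); rewrite Fx0 => /esym/eqP.
rewrite mulf_eq0 => /orP[|/eqP //]; rewrite -nsq_eq0 nsq_real sqrf_eq0.
move=> /prodf_eq0 [i _]; rewrite subr_eq0 => /eqP /x_inj ni.
by have := ltn_ord i; rewrite -ni ltnn.
Qed.

(** After [n] nodes the remainder is of order [2 ^ (- n)]. *)
Lemma cauchy1_near_zeros t : 0 <= t <= 1 ->
  (forall i, (t - x i) ^+ 2 <= d / 4) -> F t = 0.
Proof.
move=> t01 tx.
have bound n : nsq (F t) <= d^-1 * (1 / 4) ^+ n.
  rewrite (cauchy1_newton n t01) nsqM nsq_real.
  have h1 : (\prod_(i < n) (t - x i)) ^+ 2 <= (d / 4) ^+ n.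
    rewrite -prodrXl -[n in leRHS]card_ord -prodr_const.
    by apply: ler_prod => i _; rewrite sqr_ge0 tx.
  have h2 : nsq (cint (fun xi => newton n xi * ckernel (t%:C * z) xi))
      <= (d^-1) ^+ n * d^-1.
    apply: nsq_cint_le.
      by apply: bmfM; [exact: bmf_newton|exact/bmf_ckernel/nsq_segment_lt1].
    by move=> xi; rewrite nsqM ler_pM ?nsq_ge0 ?nsq_newton ?nsq_ckernel.
  have -> : d^-1 * (1 / 4) ^+ n = (d / 4) ^+ n * (d^-1 ^+ n * d^-1).
    rewrite mulrA -exprMn mulrC (_ : d / 4 * d^-1 = 1 / 4) //.
    by field; rewrite gt_eqF.
  by rewrite ler_pM ?sqr_ge0 ?nsq_ge0.
have lim0 : (fun n => d^-1 * (1 / 4 : R) ^+ n) @ \oo --> (0 : R).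
  rewrite -(mulr0 d^-1); apply: cvgM; first exact: cvg_cst.
  by apply: cvg_expr; rewrite ger0_norm; lra.
apply/eqP; rewrite -nsq_eq0 eq_le nsq_ge0 andbT.
by apply: (cvgr_to_ge lim0); apply: nearW.
Qed.

End Newton.

Let eta := Num.sqrt d / 2.

Let eta_gt0 : 0 < eta. Proof. by rewrite divr_gt0 // sqrtr_gt0. Qed.

Lemma cauchy1_zeros_left (p q : R) : 0 <= p -> p < q -> q <= 1 ->
  (forall t, p < t < q -> F t = 0) ->
  forall t, 0 <= t <= q -> q - eta <= t -> F t = 0.
Proof.
move=> p0 pq q1 Fpq t /andP[t0 tq] qt.
pose p' := Num.max p (q - eta).
have p'q : p' < q by rewrite gt_max pq ltrBlDr ltrDl eta_gt0.
have p'0 : 0 <= p' by rewrite le_max p0.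
pose x (i : nat) : R := q - (q - p') / i.+2%:R.
have xpq i : p' < x i < q.
  rewrite /x ltrBrDr -ltrBrDl ltrBlDr ltrDl divr_gt0 ?ltr0n ?subr_gt0 // andbT.
  by rewrite ltr_pdivrMr ?ltr0n // ltr_pMr ?subr_gt0 // ltr1n.
apply: (@cauchy1_near_zeros x).
- move=> i; have /andP[h1 h2] := xpq i.
  by rewrite (le_trans p'0 (ltW h1)) (le_trans (ltW h2) q1).
- move=> i j /(congr1 (fun y => q - y)); rewrite /x !subKr.
  have qp : q - p' != 0 by rewrite gt_eqF ?subr_gt0.
  move=> /(mulfI qp) /invr_inj /eqP; rewrite eqr_nat => /eqP [] //.
- move=> i; apply: Fpq; have /andP[h1 h2] := xpq i; rewrite h2 andbT.
  by apply: le_lt_trans h1; rewrite le_max lexx.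
- by rewrite t0 (le_trans tq).
- move=> i; have /andP[h1 h2] := xpq i.
  have h3 : q - eta < x i by apply: le_lt_trans h1; rewrite le_max lexx orbT.
  have -> : d / 4 = eta ^+ 2.
    by rewrite /eta expr_div_n sqr_sqrtr ?(ltW d_gt0) // -natrX.
  rewrite -ler_sqrt ?sqr_ge0 // !sqrtr_sqr (ger0_norm (ltW eta_gt0)).
  by rewrite ler_norml; apply/andP; split; lra.
Qed.

(** The zeros of [cauchy1] on a radius are nowhere dense: Newton interpolation at
    zeros in a small interval shows that [cauchy1] vanishes on a longer one,
    whose length does not depend on the first, and so all the way to 0. *)
Lemma cauchy1_zeros_nowhere_dense (p q : R) : cint (@cv R) != 0 ->
  0 <= p -> p < q -> q <= 1 -> ~ (forall t, p < t < q -> F t = 0).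
Proof.
move=> m0.
have F0 : F 0 != 0.
  rewrite mul0r /cauchy1 (@eq_cint _ mu _ (@cv R)) // => xi.
  by rewrite /ckernel mul0r subr0 invr1 mulr1.
have [n] : exists n : nat, q <= n%:R * (eta / 2).
  exists (Num.bound `|q / (eta / 2)|).
  rewrite -ler_pdivrMr; last by rewrite divr_gt0 ?eta_gt0.
  apply: le_trans (ler_norm _) _.
  exact: ltW (archi_boundP (normr_ge0 _)).
elim: n p q => [|n IH] p q qn p0 pq q1 Fpq.
  by move: qn; rewrite mul0r => qn; lra.
have Fq := cauchy1_zeros_left p0 pq q1 Fpq.
have [qe|qe] := lerP (q - eta) 0.
  by move/negP: F0; apply; apply/eqP/Fq => //; rewrite lexx ltW // (le_lt_trans p0).
apply: (IH (q - eta) (q - eta / 2)).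
- by move: qn; rewrite -natr1 mulrDl mul1r; lra.
- exact: ltW.
- by have := eta_gt0; lra.
- by have := eta_gt0; lra.
- move=> t /andP[t1 t2]; apply: Fq; last exact: ltW.
  by apply/andP; split; have := eta_gt0; lra.
Qed.

End Zeros.

(** * Subordination functions *)

Section Continuity.
Variable R : realType.
Implicit Types (z w l : R[i]).

(** A contraction of the pseudo-hyperbolic distance is locally Lipschitz. *)
Lemma pick_dist_le (f g z w : R[i]) : nsq f <= 1 -> nsq g <= 1 ->
  nsq z < 1 -> nsq w < 1 ->
  pick2 ((1 - nsq z) * (1 - nsq w) / nsq (1 - z * cj w)) f g ->
  nsq (f - g) * ((1 - nsq z) * (1 - nsq w)) <= 4 * nsq (z - w).
Proof.
move=> f1 g1 z1 w1; rewrite /pick2.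
set T := (1 - nsq z) * (1 - nsq w); set S := nsq (1 - z * cj w).
have T0 : 0 < T by rewrite mulr_gt0 ?subr_gt0.
have S0 : 0 < S by exact: nsq_pick_gt0.
have ST : nsq (z - w) = S - T by rewrite /S /T nsq_pick.
have := nsq_pick f g; set A := (1 - nsq f) * (1 - nsq g); set B := nsq (1 - _).
move=> <- h.
have B0 : 0 <= B by exact: nsq_ge0.
have B4 : B <= 4.
  apply: le_trans (nsqD_le_sqr (p := 1) (q := 1) _ _ _ _) _ => //.
  - by rewrite nsq1 expr1n.
  - by rewrite nsqN nsqM nsqJ expr1n -[leRHS]mulr1 ler_pM ?nsq_ge0.
  - by rewrite -[1 + 1]/(2%:R) -natrX.
have TS : T <= S by rewrite -subr_ge0 -ST nsq_ge0.
rewrite ST; apply: (@le_trans _ _ (B * (S - T))); last first.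
  by rewrite ler_wpM2r // subr_ge0.
have : T * B <= S * A by move: h; rewrite mulrAC ler_pdivrMr // [A * S]mulrC.
have BA : 0 <= B - A by rewrite /B /A nsq_pick nsq_ge0.
move=> h1; apply: (@le_trans _ _ ((B - A) * S)); first by rewrite ler_wpM2l.
by rewrite mulrBl mulrBr lerD2l lerN2 [A * S]mulrC [B * T]mulrC.
Qed.

Variables (T : Type) (F : set_system T).
Context {FF : Filter F}.

Lemma ccvg_mtrans (mu : probability (borel_circle R) R) (f : T -> R[i]) l :
  nsq l < 1 -> ccvg F f l -> ccvg F (fun x => mtrans mu (f x)) (mtrans mu l).
Proof.
move=> l1 fl; have nl : (fun x => nsq (f x)) @ F --> nsq l by exact: ccvg_nsq.
apply: ccvg_dist.
have f1 : \forall x \near F, nsq (f x) < 1 by exact: (cvgr_lt _ nl).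
have nd : (fun x => nsq (f x - l)) @ F --> (0 : R).
  rewrite -nsq0 -[0](subrr l); apply: ccvg_nsq.
  by apply: ccvgD => //; exact: ccvg_cst.
have lim0 : (fun x => 4 * nsq (f x - l) / ((1 - nsq (f x)) * (1 - nsq l))) @ F
   --> (0 : R).
  rewrite -(mul0r ((1 - nsq l) * (1 - nsq l))^-1) -{1}(mulr0 4).
  apply: cvgM; first by apply: cvgM => //; exact: cvg_cst.
  have n0 : 1 - nsq l != 0 by rewrite gt_eqF // subr_gt0.
  apply: cvgV; first by rewrite mulf_neq0.
  apply: cvgM; last exact: cvg_cst.
  by apply: cvgB => //; exact: cvg_cst.
apply: (squeeze_cvgr _ (cvg_cst 0) lim0).
apply: filterS f1 => x f1; rewrite nsq_ge0 /= ler_pdivlMr; last first.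
  by rewrite mulr_gt0 ?subr_gt0.
apply: pick_dist_le => //; try exact: nsq_mtrans.
have S0 := nsq_pick_gt0 f1 l1.
apply: mtrans_pick2 => //.
  by rewrite divr_ge0 ?(ltW S0) // mulr_ge0 ?subr_ge0 ?ltW.
by rewrite /pick2 divfK // gt_eqF.
Qed.

End Continuity.

Section Subordination.
Variable R : realType.
Implicit Types (mu : probability (borel_circle R) R) (Z : R[i] -> R[i]).

Definition continuous_on_disk Z := forall (T : Type) (F : set_system T),
  Filter F -> forall (f : T -> R[i]) (l : R[i]),
  nsq l < 1 -> ccvg F f l -> ccvg F (fun x => Z (f x)) (Z l).

Lemma derivable_continuous_on_disk (Z : Cplx R -> Cplx R) :
  (forall z, disk z -> derivable Z z 1) -> continuous_on_disk Z.
Proof.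
move=> dZ T F FF f l l1 fl.
have /derivable1_diffP/differentiable_continuous cZ : derivable Z l 1.
  by apply: dZ; exact/disk_nsq.
have h : (fun x => Z (f x)) @ F --> Z l.
  exact: (cvg_comp _ _ (ccvg_cvg fl) cZ).
split.
- exact: (cvg_comp _ _ h (@Re_continuous R (Z l))).
- exact: (cvg_comp _ _ h (@Im_continuous R (Z l))).
Qed.

Lemma ccvg_ray z (t0 : R) (F : set_system R) (FF : Filter F) :
  F --> t0 -> ccvg F (fun t => t%:C * z) (t0%:C * z).
Proof.
by move=> Ft0; apply: ccvgM; [exact: ccvg_real|exact: ccvg_cst].
Qed.

Section Equations.
Variables (mu1 mu2 mu : probability (borel_circle R) R) (Z1 Z2 : R[i] -> R[i]).
Hypothesis mu_mean : cint mu (@cv R) != 0.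
Hypothesis cZ1 : continuous_on_disk Z1.
Hypothesis cZ2 : continuous_on_disk Z2.
Hypothesis Z20 : Z2 0 = 0.
Hypothesis ZZ : forall z, nsq z < 1 -> Z1 z * Z2 z = z * Qtrans mu1 (Z1 z).
Hypothesis QQ : forall z, nsq z < 1 -> Qtrans mu z = Qtrans mu1 (Z1 z).

(** Cancelling [Z1 z] in the functional equation; its zeros are zeros of
    [Qtrans mu], hence nowhere dense on radii, and there the formula holds by
    continuity. *)
Lemma subordination_cancel z : nsq z < 1 -> nsq (Z1 z) < 1 ->
  Z2 z = z * mtrans mu1 (Z1 z).
Proof.
move=> z1 Zz1; apply/eqP; rewrite -subr_eq0; apply/negPn/negP => g0.
pose w t := t%:C * z.
pose g t := Z2 (w t) - w t * mtrans mu1 (Z1 (w t)).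
have w1 : w 1 = z by rewrite /w mul1r.
have w1lt : nsq (w 1) < 1 by rewrite w1.
have wl : ccvg 1^'- w (w 1).
  by apply: ccvg_ray; apply: cvg_at_left_filter; exact: cvg_id.
have Z1l : ccvg 1^'- (fun t => Z1 (w t)) (Z1 (w 1)) by exact: cZ1.
have gl : ccvg 1^'- g (g 1).
  apply: ccvgD; first exact: cZ2.
  by apply: ccvgN; apply: ccvgM => //; apply: ccvg_mtrans => //; rewrite w1.
have near_ne : \forall t \near 1^'-, nsq (Z1 (w t)) < 1 /\ 0 < nsq (g t).
  near=> t; split; near: t.
  - by apply: (cvgr_lt _ (ccvg_nsq Z1l)); rewrite w1.
  - by apply: (cvgr_gt _ (ccvg_nsq gl)); rewrite /g w1 nsq_gt0.
have z0 : z != 0.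
  by apply: contra_neq g0 => ->; rewrite Z20 mul0r subr0.
have [p [p0 p1 hp]] : exists p : R, [/\ 0 <= p, p < 1 &
    forall t, p < t < 1 -> nsq (Z1 (w t)) < 1 /\ 0 < nsq (g t)].
  have /nbhs_ballP[e /= e0 he] := near_ne.
  exists (Num.max 0 (1 - e)); split.
  - by rewrite le_max lexx.
  - by rewrite gt_max ltr01 ltrBlDr ltrDl.
  - move=> t /andP[]; rewrite gt_max => /andP[t0 te] t1; apply: he => //=.
    have -> : ball (1 : R) e t = (`|1 - t| < e) by [].
    by rewrite gtr0_norm ?subr_gt0 //; lra.
apply: (@cauchy1_zeros_nowhere_dense _ mu z z1 p 1 mu_mean p0 p1 (lexx 1)).
move=> t /andP[pt t1]; apply: contrapT => /eqP c0.
have t01 : 0 <= t <= 1 by rewrite (le_trans p0 (ltW pt)) ltW.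
have wt1 : nsq (w t) < 1 by exact: le_lt_trans (nsq_segment z t01) z1.
have [|Zt gt0] := hp t; first by rewrite pt t1.
have wt0 : w t != 0.
  by rewrite mulf_neq0 // -nsq_gt0 nsq_real exprn_gt0 // (le_lt_trans p0 pt).
have Q0 : Qtrans mu (w t) != 0.
  rewrite QtransE // mulf_neq0 // /mtrans mulf_neq0 //.
  by rewrite invr_neq0 // cauchy0_neq0.
have Z10 : Z1 (w t) != 0.
  apply: contra_neq Q0 => E; rewrite QQ // E QtransE ?nsq0 // mul0r //.
move: gt0; rewrite nsq_gt0 => /eqP; apply.
apply/eqP; rewrite subr_eq0 -(inj_eq (mulfI Z10)); apply/eqP.
by rewrite ZZ // QtransE //; ring.
Unshelve. all: by end_near. Qed.

End Equations.

Variables (mu1 mu2 mu : probability (borel_circle R) R) (Z1 Z2 : R[i] -> R[i]).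
Hypothesis mu_mean : cint mu (@cv R) != 0.
Hypothesis cZ1 : continuous_on_disk Z1.
Hypothesis cZ2 : continuous_on_disk Z2.
Hypothesis Z10 : Z1 0 = 0.
Hypothesis Z20 : Z2 0 = 0.
Hypothesis ZZ : forall z, nsq z < 1 -> Z1 z * Z2 z = z * Qtrans mu1 (Z1 z).
Hypothesis Q12 : forall z, nsq z < 1 -> Qtrans mu1 (Z1 z) = Qtrans mu2 (Z2 z).
Hypothesis QQ : forall z, nsq z < 1 -> Qtrans mu z = Qtrans mu1 (Z1 z).

Let cancel1 z : nsq z < 1 -> nsq (Z1 z) < 1 -> Z2 z = z * mtrans mu1 (Z1 z).
Proof. by move=> ? ?; apply: (@subordination_cancel mu1 mu). Qed.

Let cancel2 z : nsq z < 1 -> nsq (Z2 z) < 1 -> Z1 z = z * mtrans mu2 (Z2 z).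
Proof.
apply: (@subordination_cancel mu2 mu) => // w w1.
- by rewrite mulrC ZZ // Q12.
- by rewrite QQ // Q12.
Qed.

Let schwarz z : nsq z < 1 -> nsq (Z1 z) < 1 ->
  nsq (Z1 z) <= nsq z /\ nsq (Z2 z) <= nsq z.
Proof.
move=> z1 Zz1.
have h2 : nsq (Z2 z) <= nsq z.
  by rewrite cancel1 // nsqM ler_piMr ?nsq_ge0 // nsq_mtrans.
split => //; have Z21 := le_lt_trans h2 z1.
by rewrite cancel2 // nsqM ler_piMr ?nsq_ge0 // nsq_mtrans.
Qed.

(** On the radius of [z], the modulus of [Z1] starts at 0 and cannot take a
    value between [|z|] and 1. *)
Lemma subordination_lt1 z : nsq z < 1 -> nsq (Z1 z) < 1.
Proof.
move=> z1; rewrite ltNge; apply/negP => Zz1.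
pose f (t : R) := nsq (Z1 (t%:C * z)).
have cf : {within `[0, 1]%classic, continuous f}.
  apply: continuous_in_subspaceT => t; rewrite inE /= in_itv /= => t01.
  apply: ccvg_nsq; apply: cZ1; first exact: le_lt_trans (nsq_segment z t01) z1.
  by apply: ccvg_ray; exact: cvg_id.
have f0 : f 0 = 0 by rewrite /f mul0r Z10 nsq0.
have f1 : f 1 = nsq (Z1 z) by rewrite /f mul1r.
have z0 := nsq_ge0 z.
have [||c /[!in_itv]/= c01 fc] := @IVT R f 0 1 ((nsq z + 1) / 2) _ cf.
- exact: ler01.
- by rewrite f0 f1 ge_min le_max; apply/andP; split; apply/orP; [left|right]; lra.
have cz := nsq_segment z c01.
have cz1 := le_lt_trans cz z1.
have [|h _] := @schwarz (c%:C * z) cz1; first by rewrite -/(f c) fc; lra.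
by have := le_trans h cz; rewrite -/(f c) fc; lra.
Qed.

Lemma subordination z : nsq z < 1 ->
  [/\ nsq (Z1 z) <= nsq z, nsq (Z2 z) <= nsq z,
      Z1 z = z * mtrans mu2 (Z2 z) & Z2 z = z * mtrans mu1 (Z1 z)].
Proof.
move=> z1; have Zz1 := subordination_lt1 z1.
have [h1 h2] := schwarz z1 Zz1; split => //.
- by apply: cancel2 => //; exact: le_lt_trans h2 z1.
- exact: cancel1.
Qed.

(** [Z1] and [Z2] contract the pseudo-hyperbolic distance. If [Z1] increased it,
    then so would [Z2 = z (m1 o Z1)], strictly more than [Z1], and then
    [Z1 = z (m2 o Z2)] could not, where [mi] is the transform [mtrans] of [mui]. *)
Lemma subordination_pick2 z w : nsq z < 1 -> nsq w < 1 ->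
  pick2 ((1 - nsq z) * (1 - nsq w) / nsq (1 - z * cj w)) (Z1 z) (Z1 w).
Proof.
move=> z1 w1.
have [Zz Z2z e1z e2z] := subordination z1; have [Zw Z2w e1w e2w] := subordination w1.
have Zz1 := le_lt_trans Zz z1; have Zw1 := le_lt_trans Zw w1.
have Z2z1 := le_lt_trans Z2z z1; have Z2w1 := le_lt_trans Z2w w1.
set T := (1 - nsq z) * (1 - nsq w); set S := nsq (1 - z * cj w).
have S0 : 0 < S by exact: nsq_pick_gt0.
have T0 : 0 < T by rewrite mulr_gt0 ?subr_gt0.
pose A1 := (1 - nsq (Z1 z)) * (1 - nsq (Z1 w)).
pose S1 := nsq (1 - Z1 z * cj (Z1 w)).
have S10 : 0 < S1 by exact: nsq_pick_gt0.
have A10 : 0 < A1 by rewrite mulr_gt0 ?subr_gt0.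
pose A2 := (1 - nsq (Z2 z)) * (1 - nsq (Z2 w)).
pose S2 := nsq (1 - Z2 z * cj (Z2 w)).
have S20 : 0 < S2 by exact: nsq_pick_gt0.
have A20 : 0 < A2 by rewrite mulr_gt0 ?subr_gt0.
rewrite /pick2 -/S1 -/A1 leNgt -ltr_pdivrMr // ; apply/negP => h1.
have s10 : 0 < A1 / S1 by rewrite divr_gt0.
have h2 : A1 / S1 * S2 < A2.
  rewrite /S2 /A2 e2z e2w.
  apply: (nsq_pickM (strict := true)) => //; try exact: nsq_mtrans.
  - by rewrite /= -ltr_pdivlMr.
  - apply: mtrans_pick2 => //; first exact: ltW.
    by rewrite /pick2 divfK // gt_eqF.
have s20 : 0 < A2 / S2 by rewrite divr_gt0.
have [h3|h3] := ltrP (A2 / S2) (T / S).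
  suff : A2 / S2 * S1 < A1.
    rewrite -ltr_pdivlMr // => h4; move: h2; rewrite -ltr_pdivlMr // => h2.
    by have := lt_trans h4 h2; rewrite ltxx.
  rewrite /S1 /A1 e1z e1w.
  apply: (nsq_pickM (strict := true)) => //; try exact: nsq_mtrans.
  - by rewrite /= -ltr_pdivlMr.
  - apply: mtrans_pick2 => //; first exact: ltW.
    by rewrite /pick2 divfK // gt_eqF.
suff : T / S * S1 <= A1 by rewrite -ler_pdivlMr // leNgt h1.
rewrite /S1 /A1 e1z e1w.
have TS0 : 0 < T / S by rewrite divr_gt0.
apply: (nsq_pickM (strict := false)) => //; try exact: nsq_mtrans.
- by rewrite /= divfK // gt_eqF.
- apply: mtrans_pick2 => //; first exact: ltW.
  by rewrite /pick2 -ler_pdivlMr.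
Qed.

End Subordination.

(** * Measures with a gap around an atom *)

Section Arc.
Variable R : realType.
Variable alpha : R.
Hypothesis halpha : 0 < alpha < pi.
Implicit Types (xi : borel_circle R) (t : R) (z w : R[i]).

Lemma cos_lt_abs t : `|t| < alpha -> cos alpha < cos t.
Proof.
move=> ta; rewrite -(cos_norm t); have /andP[a0 api] := halpha.
rewrite ltr_cos // in_itv /=; apply/andP; split => //; last exact: ltW.
- by rewrite (le_trans (ltW ta)) // ltW.
- exact: ltW.
Qed.

Lemma open_arcP xi : open_arc alpha xi <-> cos alpha < Re (cv xi).
Proof.
split => [[t ta E]|].
  by rewrite /cv E /=; apply: cos_lt_abs; rewrite ltr_norml.
have [t te tE] := expi_acos (nsq_cv xi); rewrite -te /= => h.
have /andP[a0 api] := halpha.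
suff : `|t| < alpha by rewrite ltr_norml => ta; exists t.
rewrite ltNge; apply/negP => ta.
have tpi : `|t| <= pi.
  by rewrite tE acos_lepi //; have := nsq_cv xi; rewrite /nsq => ?; apply/andP; split; nra.
move: h; rewrite -(cos_norm t) ltNge => /negP; apply.
have [<-//|ne] := eqVneq alpha `|t|.
rewrite ltW // ltr_cos ?in_itv /= ?normr_ge0 ?(ltW a0) ?(ltW api) //.
by rewrite lt_neqAle ne.
Qed.

Lemma open_arcE : open_arc alpha = [set xi | cos alpha < Re (cv xi)].
Proof. by apply/seteqP; split => xi /open_arcP. Qed.

Lemma measurable_Re_cv : measurable_fun setT (fun xi => Re (cv xi)).
Proof. by have [] := @bmf_cv R. Qed.

Lemma measurable_open_arc : measurable (open_arc alpha).
Proof.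
rewrite open_arcE; have := measurable_Re_cv measurableT (measurable_itv `]cos alpha, +oo[).
rewrite setTI; congr measurable; apply/seteqP; split => xi /=; by rewrite in_itv /= andbT.
Qed.

Lemma cv_inj : injective (@cv R).
Proof. by move=> x y; exact: val_inj. Qed.

Lemma cv_circle1 : cv (circle1 R : borel_circle R) = 1.
Proof. by []. Qed.

Lemma measurable_circle_point (c : borel_circle R) : measurable [set c].
Proof.
have [m1 m2 _] := @bmf_cv R.
have -> : [set c] = [set xi | Re (cv xi) = Re (cv c)] `&` [set xi | Im (cv xi) = Im (cv c)].
  apply/seteqP; split => [xi ->//|xi [/= h1 h2]]; apply: cv_inj.
  exact: complex_eq.
apply: measurableI.
- have := m1 measurableT _ (measurable_set1 (Re (cv c))); rewrite setTI.
  by congr measurable.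
- have := m2 measurableT _ (measurable_set1 (Im (cv c))); rewrite setTI.
  by congr measurable.
Qed.

Lemma open_arc1 : open_arc alpha (circle1 R : borel_circle R).
Proof.
apply/open_arcP; rewrite cv_circle1 [Re 1](_ : _ = cos 0) ?cos0 //.
by rewrite -cos0 cos_lt_abs // normr0; case/andP: halpha.
Qed.

Definition gap_indic xi : R[i] := (\1_(~` open_arc alpha) xi : R)%:C.

Lemma bmf_gap_indic : bmf gap_indic.
Proof. by apply: bmf_indic; apply: measurableC; exact: measurable_open_arc. Qed.

Lemma gap_indicM xi : gap_indic xi * gap_indic xi = gap_indic xi.
Proof. by rewrite /gap_indic indicE; case: (_ \in _); rewrite ?mul1r ?mul0r. Qed.

Lemma conjc_gap_indic xi : cj (gap_indic xi) = gap_indic xi.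
Proof. exact: conjcR. Qed.

Lemma gap_indic_bound (h : borel_circle R -> R[i]) (M : R) : 0 <= M ->
  (forall xi, Re (cv xi) <= cos alpha -> nsq (h xi) <= M) ->
  forall xi, nsq (gap_indic xi * h xi) <= M.
Proof.
move=> M0 hM xi; rewrite /gap_indic indicE.
case: (boolP (xi \in ~` open_arc alpha)) => xC.
  rewrite mul1r; apply: hM; move: xC; rewrite inE => /open_arcP.
  by move/negP; rewrite -leNgt.
by rewrite mul0r nsq0.
Qed.

Definition atom1 (mu : probability (borel_circle R) R) : R :=
  fine (mu [set (circle1 R : borel_circle R)]).

Section Gap.
Variable mu : probability (borel_circle R) R.
Hypothesis hgap : mu (open_arc alpha `\ circle1 R) = 0%E.
Local Notation cint := (cint mu).

Local Notation p := (atom1 mu).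

(** The function may be unbounded near the null part of the arc, as Cauchy kernels
    at points of the arc are. *)
Lemma cint_gap (h : borel_circle R -> R[i]) :
  measurable_fun setT (fun xi => Re (h xi)) ->
  measurable_fun setT (fun xi => Im (h xi)) ->
  bmf (fun xi => gap_indic xi * h xi) ->
  cint h = p%:C * h (circle1 R) + cint (fun xi => gap_indic xi * h xi).
Proof.
move=> mh1 mh2 bh.
pose one xi : R[i] := (\1_[set (circle1 R : borel_circle R)] xi : R)%:C.
have bone : bmf one by apply: bmf_indic; exact: measurable_circle_point.
have b1 : bmf (fun xi => h (circle1 R) * one xi) by exact: (bmfM (bmf_cst _)).
have -> : p%:C = cint one.
  apply: complex_eq => /=; last by rewrite Rintegral_cst // mul0r.
  rewrite /Rintegral integral_indic //; last exact: measurable_circle_point.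
  by rewrite setIT.
rewrite mulrC -cintZ // -cintD //; symmetry.
apply: (@ae_eq_cint _ mu (open_arc alpha `\ circle1 R)) => //.
- apply: measurableD; first exact: measurable_open_arc.
  exact: measurable_circle_point.
- exact: bmfD.
move=> xi nxi; rewrite /one /gap_indic /= !indicE.
have [E|ne] := eqVneq xi (circle1 R).
  have -> : (xi \in [set circle1 R]) = true by exact: mem_set.
  have -> : (xi \in ~` open_arc alpha) = false.
    by apply: memNset => /=; apply; rewrite E; exact: open_arc1.
  by rewrite mul0r addr0 mulr1 E.
have -> : (xi \in [set circle1 R]) = false by apply: memNset => /= /eqP; apply/negP.
have -> : (xi \in ~` open_arc alpha) = true.
  by apply: mem_set => xa; apply: nxi; split => //=; apply/eqP.
by rewrite mulr0 add0r mul1r.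
Qed.

End Gap.
End Arc.

(** * The Q-transform on the arc *)

Section Boundary.
Variables (R : realType) (alpha : R).
Hypothesis halpha : 0 < alpha < pi.
Variable mu : probability (borel_circle R) R.
Hypothesis hgap : mu (open_arc alpha `\ circle1 R) = 0%E.
Implicit Types (xi : borel_circle R) (t : R) (z w : R[i]).
Local Notation cint := (cint mu).
Local Notation p := (atom1 mu).
Local Notation gap_indic := (gap_indic alpha).

(** [1 / w] keeps a distance from the complement of the arc, where the Cauchy
    kernel at [w] has to be integrated. *)
Definition away (d : R) w :=
  forall xi, Re (cv xi) <= cos alpha -> d <= nsq (1 - w * cv xi).

Definition gapA w := cint (fun xi => gap_indic xi * ckernel w xi).
Definition gapK z w :=
  cint (fun xi => (gap_indic xi * ckernel z xi) * cj (gap_indic xi * ckernel w xi)).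

Lemma measurable_ckernel w :
  measurable_fun setT (fun xi => Re (ckernel w xi)) /\
  measurable_fun setT (fun xi => Im (ckernel w xi)).
Proof.
have bh : bmf (fun xi => 1 - w * cv xi).
  apply: bmfD; first exact: bmf_cst.
  by apply: bmfN; apply: bmfM; [exact: bmf_cst|exact: bmf_cv].
by have [mh1 mh2 _] := bh; exact: measurable_cinv.
Qed.

Lemma nsq_gap_kernel d w xi : 0 < d -> away d w ->
  nsq (gap_indic xi * ckernel w xi) <= d^-1.
Proof.
move=> d0 aw; apply: gap_indic_bound => //; first by rewrite invr_ge0 ltW.
by move=> x hx; rewrite nsqV lef_pV2 ?posrE ?aw // (lt_le_trans d0) ?aw.
Qed.

Lemma bmf_gap_kernel d w : 0 < d -> away d w ->
  bmf (fun xi => gap_indic xi * ckernel w xi).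
Proof.
move=> d0 aw; have [m1 m2] := measurable_ckernel w.
have [c1 c2 _] := bmf_gap_indic halpha.
split; last by exists d^-1 => xi; exact: nsq_gap_kernel.
- by under eq_fun do rewrite cReM; apply: measurable_funB; exact: measurable_funM.
- by under eq_fun do rewrite cImM; apply: measurable_funD; exact: measurable_funM.
Qed.

Lemma away_near d z w : away (4 * d) z -> nsq (w - z) <= d -> away d w.
Proof.
move=> az wz xi hx; have h := az xi hx.
have : nsq (1 - z * cv xi) <= 2 * nsq (1 - w * cv xi) + 2 * nsq ((w - z) * cv xi).
  apply: le_trans (nsqD_le _ _); rewrite le_eqVlt; apply/orP; left; apply/eqP.
  by congr nsq; ring.
by rewrite [nsq (_ * cv xi)]nsqM nsq_cv mulr1; lra.
Qed.

Lemma away_disk z : nsq z < 1 -> exists2 d, 0 < d & away d z.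
Proof.
move=> z1; exists ((1 - nsq z) ^+ 2 / 4).
  by rewrite divr_gt0 // exprn_gt0 // subr_gt0.
by move=> xi _; exact: ckernel_den.
Qed.

(** [|1 - expi t * xi|] is the distance from [expi (- t)] to [xi], at least the
    difference of the real parts. *)
Lemma away_arc t : `|t| < alpha -> exists2 d, 0 < d & away d (expi t).
Proof.
move=> ta; exists ((cos t - cos alpha) ^+ 2).
  by rewrite exprn_gt0 // subr_gt0 cos_lt_abs.
move=> xi hx; have -> : nsq (1 - expi t * cv xi) = nsq (cj (expi t) - cv xi).
  rewrite -[RHS]mul1r -(nsq_expi t) -nsqM mulrBr mulJ nsq_expi //.
apply: le_trans (nsqR _); rewrite cReD cReN cReJ /=.
have := cos_lt_abs halpha ta => h.
by rewrite ler_sqr ?nnegrE; lra.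
Qed.

Lemma nsq_gap_kernelB d z w xi : 0 < d -> away d z -> away d w ->
  nsq (gap_indic xi * ckernel z xi - gap_indic xi * ckernel w xi) <= nsq (z - w) * (d^-1 * d^-1).
Proof.
move=> d0 az aw; rewrite -mulrBr; 
apply: (@gap_indic_bound _ _ halpha (fun xi => ckernel z xi - ckernel w xi)).
  by rewrite !mulr_ge0 ?nsq_ge0 ?invr_ge0 ?(ltW d0).
move=> x hx.
have pos v : away d v -> 0 < nsq (1 - v * cv x) by move=> av; exact: lt_le_trans d0 (av _ hx).
have v0 v : away d v -> 1 - v * cv x != 0 by move=> av; rewrite -nsq_gt0 pos.
have -> : ckernel z x - ckernel w x = (z - w) * cv x * (ckernel z x * ckernel w x).
  rewrite /ckernel; have := v0 _ az; have := v0 _ aw; move: (cv x) => c h1 h2.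
  by field; rewrite h1 h2.
rewrite !nsqM nsq_cv mulr1 ler_wpM2l ?nsq_ge0 // !nsqV.
by rewrite ler_pM ?invr_ge0 ?nsq_ge0 // lef_pV2 ?posrE ?pos ?az ?aw.
Qed.

Section Limits.
Variables (T : Type) (F : set_system T).
Context {FF : Filter F}.

Lemma ccvg_le (f : T -> R[i]) (g : T -> R) l : g @ F --> (0 : R) ->
  (\forall x \near F, nsq (f x - l) <= g x) -> ccvg F f l.
Proof.
move=> g0 fg; apply: ccvg_dist; apply: (squeeze_cvgr _ (cvg_cst 0) g0).
by apply: filterS fg => x fg; rewrite nsq_ge0.
Qed.

Lemma ccvg_nsqB (f : T -> R[i]) l : ccvg F f l ->
  (fun x => nsq (f x - l)) @ F --> (0 : R).
Proof.
move=> fl; rewrite -nsq0 -[0](subrr l); apply: ccvg_nsq.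
by apply: ccvgD => //; exact: ccvg_cst.
Qed.

Lemma near_away (f : T -> R[i]) d z : 0 < d -> away (4 * d) z -> ccvg F f z ->
  \forall x \near F, away d (f x).
Proof.
move=> d0 az fz; have h := ccvg_nsqB fz.
have h1 : \forall x \near F, nsq (f x - z) < d by exact: (cvgr_lt _ h).
by apply: filterS h1 => x h1; exact: away_near az (ltW h1).
Qed.

Lemma ccvg_gapA (f : T -> R[i]) z d : 0 < d -> away d z -> ccvg F f z ->
  ccvg F (fun x => gapA (f x)) (gapA z).
Proof.
move=> d0 az fz; pose e := d / 4.
have e0 : 0 < e by rewrite divr_gt0.
have az' : away (4 * e) z by rewrite /e mulrC divfK.
have azz : away e z by move=> xi hx; apply: le_trans (az xi hx); rewrite /e; lra.
have nf := near_away e0 az' fz.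
apply: (@ccvg_le _ (fun x => nsq (f x - z) * (e^-1 * e^-1))).
  rewrite -(mul0r (e^-1 * e^-1)); apply: cvgM; last exact: cvg_cst.
  exact: ccvg_nsqB.
apply: filterS nf => x afx.
have b1 := bmf_gap_kernel e0 afx; have b2 := bmf_gap_kernel e0 azz.
rewrite /gapA -cintN // -cintD //; last exact: bmfN.
apply: nsq_cint_le; first by apply: bmfD => //; exact: bmfN.
by move=> xi; exact: nsq_gap_kernelB.
Qed.

Lemma ccvg_gapK (f g : T -> R[i]) z w d : 0 < d -> away d z -> away d w ->
  ccvg F f z -> ccvg F g w ->
  ccvg F (fun x => gapK (f x) (g x)) (gapK z w).
Proof.
move=> d0 az aw fz gw; pose e := d / 4.
have e0 : 0 < e by rewrite divr_gt0.
have az' : away (4 * e) z by rewrite /e mulrC divfK.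
have aw' : away (4 * e) w by rewrite /e mulrC divfK.
have azz : away e z by move=> xi hx; apply: le_trans (az xi hx); rewrite /e; lra.
have aww : away e w by move=> xi hx; apply: le_trans (aw xi hx); rewrite /e; lra.
have nf := near_away e0 az' fz; have ng := near_away e0 aw' gw.
pose M := e^-1 * e^-1 * e^-1.
apply: (@ccvg_le _ (fun x => 2 * (nsq (f x - z) * M) + 2 * (nsq (g x - w) * M))).
  have -> : (0 : R) = 2 * (0 * M) + 2 * (0 * M) by rewrite mul0r mulr0 addr0.
  apply: cvgD; apply: cvgM; try exact: cvg_cst; apply: cvgM; try exact: cvg_cst;
    exact: ccvg_nsqB.
near=> x.
have afx : away e (f x) by near: x.
have agx : away e (g x) by near: x.
have b1 := bmf_gap_kernel e0 afx; have b2 := bmf_gap_kernel e0 azz.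
have b3 := bmfJ (bmf_gap_kernel e0 agx); have b4 := bmfJ (bmf_gap_kernel e0 aww).
have b13 := bmfM b1 b3; have b24 := bmfM b2 b4.
rewrite /gapK -cintN // -cintD //; last exact: bmfN.
apply: nsq_cint_le; first by apply: bmfD => //; exact: bmfN.
move=> xi; set u := _ * ckernel (f x) xi; set v := _ * ckernel (g x) xi.
set u' := _ * ckernel z xi; set v' := _ * ckernel w xi.
have -> : u * cj v - u' * cj v' = (u - u') * cj v + u' * cj (v - v').
  by rewrite !conjcE; ring.
apply: le_trans (nsqD_le _ _) _.
have M0 : 0 <= e^-1 by rewrite invr_ge0 ltW.
rewrite lerD // ler_pM2l // nsqM nsqJ /M.
  rewrite [leRHS]mulrA ler_pM ?nsq_ge0 //; first exact: nsq_gap_kernelB.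
  exact: nsq_gap_kernel.
rewrite [leRHS]mulrA [leRHS]mulrC ler_pM ?nsq_ge0 //; first exact: nsq_gap_kernel.
exact: nsq_gap_kernelB.
Unshelve. all: by end_near. Qed.

End Limits.

End Boundary.

Section BoundaryQ.
Variables (R : realType) (alpha : R).
Hypothesis halpha : 0 < alpha < pi.
Variable mu : probability (borel_circle R) R.
Hypothesis hgap : mu (open_arc alpha `\ circle1 R) = 0%E.
Hypothesis hatom : (0 < mu [set circle1 R])%E.
Implicit Types (xi : borel_circle R) (t : R) (z w : R[i]).
Local Notation cint := (cint mu).
Local Notation p := (atom1 mu).
Local Notation gap_indic := (gap_indic alpha).
Local Notation gapA := (gapA alpha mu).
Local Notation gapK := (gapK alpha mu).
Local Notation cauchy0 := (cauchy0 mu).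
Local Notation gram := (gram mu).

Lemma atom1_gt0 : 0 < p.
Proof.
rewrite /atom1 fine_gt0 //; apply/andP; split; first exact: hatom.
apply: le_lt_trans (probability_le1 _ _) _; rewrite ?ltry //.
exact: measurable_circle_point.
Qed.

(** [(1 - w) * cauchy0 mu w]: the factor cancels the pole at 1 that comes from the
    atom, and the result makes sense on the arc. The next two definitions extend
    to the arc, in the same way, the Pick kernel of [Qtrans mu] and [Qtrans mu]
    itself. *)
Definition cauchy0_cleared w := p%:C + (1 - w) * gapA w.
Definition Qkernel z w :=
  (p%:C + (1 - z) * cj (1 - w) * gapK z w) / (cauchy0_cleared z * cj (cauchy0_cleared w)).
Definition Qbar w := 1 - (1 - w) / cauchy0_cleared w.

Lemma disk_neq1 z : nsq z < 1 -> 1 - z != 0.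
Proof. by move=> z1; apply: contraTneq z1 => /subr0_eq <-; rewrite nsq1 ltxx. Qed.

Lemma cauchy0_gap z : nsq z < 1 -> cauchy0 z = p%:C / (1 - z) + gapA z.
Proof.
move=> z1; have [d d0 az] := away_disk alpha z1.
rewrite /cauchy0 (cint_gap halpha hgap).
- by rewrite /ckernel cv_circle1 mulr1.
- by have [] := measurable_ckernel z.
- by have [] := measurable_ckernel z.
- exact (bmf_gap_kernel halpha d0 az).
Qed.

Lemma gram_gap z w : nsq z < 1 -> nsq w < 1 ->
  gram z w = p%:C / ((1 - z) * cj (1 - w)) + gapK z w.
Proof.
move=> z1 w1; have bz := bmf_ckernel z1; have bw := bmfJ (bmf_ckernel w1).
have [m1 m2 M] := bmfM bz bw; have bzw : bmf _ := And3 m1 m2 M.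
rewrite /gram (cint_gap halpha hgap) //; last first.
  exact (bmfM (bmf_gap_indic halpha) bzw).
congr (_ + _).
  by rewrite /ckernel cv_circle1 !mulr1 invfM conjcV.
apply: eq_cint => xi; rewrite conjcM conjc_gap_indic.
rewrite -{1}(gap_indicM alpha xi); ring.
Qed.

Lemma cauchy0_cleared_disk z : nsq z < 1 -> cauchy0_cleared z = (1 - z) * cauchy0 z.
Proof.
move=> z1; rewrite cauchy0_gap // mulrDr /cauchy0_cleared; congr (_ + _).
by rewrite mulrC divfK // disk_neq1.
Qed.

Lemma Qbar_disk z : nsq z < 1 -> Qbar z = Qtrans mu z.
Proof.
move=> z1; have a0 := cauchy0_neq0 mu z1; have n1 := disk_neq1 z1.
rewrite /Qbar cauchy0_cleared_disk // QtransE // /mtrans mulrA.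
have -> : z * cauchy1 mu z = cauchy0 z - 1 by rewrite cauchy0E //; ring.
by field; rewrite a0 n1.
Qed.

Lemma Qkernel_disk z w : nsq z < 1 -> nsq w < 1 ->
  Qkernel z w = gram z w / (cauchy0 z * cj (cauchy0 w)).
Proof.
move=> z1 w1; rewrite gram_gap // /Qkernel !cauchy0_cleared_disk // conjcM.
have n1 := disk_neq1 z1.
have n2 : cj (1 - w) != 0 by rewrite -nsq_gt0 nsqJ nsq_gt0 disk_neq1.
have a1 := cauchy0_neq0 mu z1.
have a2 : cj (cauchy0 w) != 0 by rewrite -nsq_gt0 nsqJ nsq_gt0 cauchy0_neq0.
move: (cj (1 - w)) (cj (cauchy0 w)) n2 a2 => v a n2 a2.
by field; rewrite n1 n2 a1 a2.
Qed.

Lemma Qbar_kernel_disk z w : nsq z < 1 -> nsq w < 1 ->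
  1 - Qbar z * cj (Qbar w) = (1 - z * cj w) * Qkernel z w.
Proof. by move=> z1 w1; rewrite !Qbar_disk // Qkernel_disk // Qtrans_kernel. Qed.

Definition disk_or_arc w := nsq w < 1 \/ exists2 t, `|t| < alpha & w = expi t.

Lemma disk_or_arc_away w : disk_or_arc w -> exists2 d, 0 < d & away alpha d w.
Proof.
case=> [w1|[t ta ->]]; first exact: away_disk.
exact: away_arc.
Qed.

Lemma disk_or_arc_le1 w : disk_or_arc w -> nsq w <= 1.
Proof. by case=> [/ltW //|[t _ ->]]; rewrite nsq_expi. Qed.

Lemma ccvg_radial w : ccvg 1^'- (fun r : R => r%:C * w) w.
Proof.
rewrite -[X in ccvg _ _ X]mul1r; apply: ccvg_ray.
by apply: cvg_at_left_filter; exact: cvg_id.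
Qed.

Lemma near_radial_disk : \forall r \near (1 : R)^'-,
  forall w, nsq w <= 1 -> nsq (r%:C * w) < 1.
Proof.
near=> r => w w1; rewrite nsqM nsq_real.
have r0 : 0 < r by near: r; exact: nbhs_left_gt.
have r1 : r < 1 by near: r; exact: nbhs_left_lt.
apply: (@le_lt_trans _ _ (r ^+ 2)); last by rewrite expr_lt1 // ltW.
by rewrite ler_piMr // sqr_ge0.
Unshelve. all: by end_near. Qed.

Section NLimit.
Variables (T : Type) (F : set_system T).
Context {FF : Filter F}.

Lemma ccvg_cauchy0_cleared (f : T -> R[i]) w : disk_or_arc w -> ccvg F f w ->
  ccvg F (fun x => cauchy0_cleared (f x)) (cauchy0_cleared w).
Proof.
move=> /disk_or_arc_away[d d0 aw] fw; apply: ccvgD; first exact: ccvg_cst.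
apply: ccvgM; last exact (ccvg_gapA halpha mu d0 aw fw).
by apply: ccvgD; [exact: ccvg_cst|exact: ccvgN].
Qed.

End NLimit.

(** At 1 the value is the mass of the atom; elsewhere the bound
    [1 / 2 <= Re (cauchy0 mu w)] passes to the limit along radii. *)
Lemma cauchy0_cleared_neq0 w : disk_or_arc w -> cauchy0_cleared w != 0.
Proof.
move=> gw; have [->|w1] := eqVneq w 1.
  rewrite /cauchy0_cleared subrr mul0r addr0 -nsq_gt0 nsq_real exprn_gt0 //.
  exact: atom1_gt0.
have h1 : (fun r => nsq (cauchy0_cleared (r%:C * w))) @ (1 : R)^'- --> nsq (cauchy0_cleared w).
  by apply: ccvg_nsq; apply: ccvg_cauchy0_cleared => //; exact: ccvg_radial.
have h2 : (fun r : R => nsq (1 - r%:C * w) * (1 / 4)) @ (1 : R)^'- --> nsq (1 - w) * (1 / 4).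
  apply: cvgM; last exact: cvg_cst.
  apply: ccvg_nsq; apply: ccvgD; first exact: ccvg_cst.
  by apply: ccvgN; exact: ccvg_radial.
rewrite -nsq_gt0; apply: (@lt_le_trans _ _ (nsq (1 - w) * (1 / 4))).
  by rewrite mulr_gt0 // ?divr_gt0 // nsq_gt0 subr_eq0 eq_sym.
apply: (ler_cvg_to h2 h1).
apply: filterS near_radial_disk => r hr.
have rw1 := hr w (disk_or_arc_le1 gw).
rewrite cauchy0_cleared_disk // nsqM ler_wpM2l ?nsq_ge0 //.
apply: le_trans (nsqR _); have := Re_cauchy0 mu rw1 => h; nra.
Qed.

Section Limit.
Variables (T : Type) (F : set_system T).
Context {FF : Filter F}.

Lemma ccvg_Qbar (f : T -> R[i]) w : disk_or_arc w -> ccvg F f w ->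
  ccvg F (fun x => Qbar (f x)) (Qbar w).
Proof.
move=> gw fw; apply: ccvgD; first exact: ccvg_cst.
apply: ccvgN; apply: ccvgM.
  by apply: ccvgD; [exact: ccvg_cst|exact: ccvgN].
apply: ccvgV; first exact: cauchy0_cleared_neq0.
exact: ccvg_cauchy0_cleared.
Qed.

Lemma ccvg_Qkernel (f g : T -> R[i]) z w : disk_or_arc z -> disk_or_arc w ->
  ccvg F f z -> ccvg F g w ->
  ccvg F (fun x => Qkernel (f x) (g x)) (Qkernel z w).
Proof.
move=> gz gw fz hw.
have c1 (h : T -> R[i]) l : ccvg F h l -> ccvg F (fun x => 1 - h x) (1 - l).
  by move=> hl; apply: ccvgD; [exact: ccvg_cst|exact: ccvgN].
have [d d0 az] := disk_or_arc_away gz; have [e e0 aw] := disk_or_arc_away gw.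
pose m := Num.min d e.
have m0 : 0 < m by rewrite lt_min d0 e0.
have amz : away alpha m z.
  by move=> xi hx; apply: le_trans (az xi hx); rewrite ge_min lexx.
have amw : away alpha m w.
  by move=> xi hx; apply: le_trans (aw xi hx); rewrite ge_min lexx orbT.
apply: ccvgM.
  apply: ccvgD; first exact: ccvg_cst.
  apply: ccvgM; last exact (ccvg_gapK halpha mu m0 amz amw fz hw).
  by apply: ccvgM; [exact: c1|apply: ccvgJ; exact: c1].
have nz := cauchy0_cleared_neq0 gz; have nw := cauchy0_cleared_neq0 gw.
apply: ccvgV; first by rewrite mulf_neq0 // -nsq_gt0 nsqJ nsq_gt0.
by apply: ccvgM; [exact: ccvg_cauchy0_cleared|apply: ccvgJ; exact: ccvg_cauchy0_cleared].
Qed.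

End Limit.

Lemma Qbar_kernel z w : disk_or_arc z -> disk_or_arc w ->
  1 - Qbar z * cj (Qbar w) = (1 - z * cj w) * Qkernel z w.
Proof.
move=> gz gw.
have h1 : ccvg (1 : R)^'- (fun r : R => 1 - Qbar (r%:C * z) * cj (Qbar (r%:C * w)))
    (1 - Qbar z * cj (Qbar w)).
  apply: ccvgD; first exact: ccvg_cst.
  apply: ccvgN; apply: ccvgM; first by apply: ccvg_Qbar => //; exact: ccvg_radial.
  by apply: ccvgJ; apply: ccvg_Qbar => //; exact: ccvg_radial.
have h2 : ccvg (1 : R)^'- (fun r : R => (1 - r%:C * z * cj (r%:C * w)) *
      Qkernel (r%:C * z) (r%:C * w)) ((1 - z * cj w) * Qkernel z w).
  apply: ccvgM; last by apply: ccvg_Qkernel => //; exact: ccvg_radial.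
  apply: ccvgD; first exact: ccvg_cst.
  by apply: ccvgN; apply: ccvgM; [|apply: ccvgJ]; exact: ccvg_radial.
apply: (ccvg_near_unique _ h1 h2).
apply: filterS near_radial_disk => r hr.
by rewrite Qbar_kernel_disk // hr // disk_or_arc_le1.
Qed.

(** On the arc this is the angular derivative of [Qbar], that is, the speed at
    which its argument increases. *)
Definition Qspeed w : R := Re (Qkernel w w).

Lemma nsq_Qbar w : disk_or_arc w -> 1 - nsq (Qbar w) = (1 - nsq w) * Qspeed w.
Proof.
move=> gw; have := congr1 (@complex.Re R) (Qbar_kernel gw gw).
rewrite !mulJ => h; transitivity (Re (1 - (nsq (Qbar w))%:C)).
  by rewrite cReD cReN.
rewrite h cReM !cReD !cReN !cImD !cImN /=; ring.
Qed.

Lemma disk_or_arc_expi t : `|t| < alpha -> disk_or_arc (expi t).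
Proof. by move=> ta; right; exists t. Qed.

Lemma conjc_Qkernel z w : disk_or_arc z -> disk_or_arc w -> cj (Qkernel z w) = Qkernel w z.
Proof.
move=> /disk_or_arc_away[d d0 az] /disk_or_arc_away[e e0 aw].
have bz := bmf_gap_kernel halpha d0 az; have bw := bmf_gap_kernel halpha e0 aw.
have hK : cj (gapK z w) = gapK w z.
  rewrite /gapK -cintJ; last exact (bmfM bz (bmfJ bw)).
  apply: eq_cint => xi; set u := gap_indic xi * ckernel z xi.
  by set v := gap_indic xi * ckernel w xi; rewrite conjcM conjcK mulrC.
have cv_ (a b : R[i]) : cj (a / b) = cj a / cj b by rewrite conjcM conjcV.
rewrite /Qkernel cv_ [cj (cauchy0_cleared z * _)]conjcM conjcK [cj (cauchy0_cleared z) * _]mulrC.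
congr (_ / _); rewrite conjcD conjcR conjcM hK [cj (_ * cj (1 - w))]conjcM conjcK.
by congr (_ + _ * _); rewrite mulrC.
Qed.

Lemma Qkernel_real w : disk_or_arc w -> Qkernel w w = (Qspeed w)%:C.
Proof.
move=> gw; apply: complex_eq => //=.
have := congr1 (@complex.Im R) (conjc_Qkernel gw gw); rewrite cImJ; lra.
Qed.

Lemma Qbar1 : Qbar 1 = 1.
Proof. by rewrite /Qbar subrr mul0r subr0. Qed.

(** At the points of the arc other than 1, [Qbar] is read off from the
    boundary values of [psi], which lie on the line [Re = - 1 / 2]. *)
Lemma Qbar_psi_point z : nsq z = 1 -> disk_or_arc z -> 1 - z != 0 ->
  let y := Im (psi mu z) in
  Re (Qbar z) = 1 - (1 / 2) / (1 / 4 + y ^+ 2) /\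
  Im (Qbar z) = y / (1 / 4 + y ^+ 2).
Proof.
move=> z1 gt e1 y.
have [d d0 at_] := disk_or_arc_away gt.
have bk := bmf_gap_kernel halpha d0 at_.
pose a := p%:C / (1 - z) + gapA (z).
have psiE : 1 + psi mu (z) = a.
  pose h xi : R[i] := z * cv xi * ckernel (z) xi.
  have [m1 m2] := measurable_ckernel (z).
  have [c1 c2 M] : bmf (fun xi => z * cv xi).
    by apply: bmfM; [exact: bmf_cst|exact: bmf_cv].
  have bh : bmf (fun xi => gap_indic xi * h xi).
    have := bmfM (And3 c1 c2 M : bmf _) bk.
    by congr bmf; apply/funext => xi; rewrite /h; ring.
  have -> : psi mu (z) = cint h by [].
  rewrite (cint_gap halpha hgap) //; last 2 first.
  - by rewrite /h; under eq_fun do rewrite cReM;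
      apply: measurable_funB; exact: measurable_funM.
  - by rewrite /h; under eq_fun do rewrite cImM;
      apply: measurable_funD; exact: measurable_funM.
  have e2 : (1 : R[i]) = p%:C * 1 + cint (fun xi => gap_indic xi * 1).
    rewrite -(@cint_gap _ _ halpha mu hgap (fun=> 1)) ?cint_cst //.
    by apply: bmfM; [exact: bmf_gap_indic|exact: bmf_cst].
  rewrite {1}e2 addrACA -mulrDr -cintD //; last first.
    by apply: bmfM; [exact: bmf_gap_indic|exact: bmf_cst].
  congr (_ + _).
    by rewrite /h /ckernel cv_circle1 mulr1; congr (_ * _); field.
  apply: eq_cint => xi; rewrite -mulrDr /gap_indic indicE.
  case: (boolP (xi \in _)) => [|_]; last by rewrite !mul0r.
  rewrite inE => nxi; have hxi : Re (cv xi) <= cos alpha.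
    by rewrite leNgt; apply/negP => h'; apply: nxi; apply/(open_arcP halpha).
  congr (_ * _); rewrite /h /ckernel.
  have : 1 - z * cv xi != 0.
    by rewrite -nsq_gt0; exact: lt_le_trans d0 (at_ _ hxi).
  by move: (cv xi) => c hc; field.
have Na : cauchy0_cleared (z) = (1 - z) * a.
  by rewrite /cauchy0_cleared /a; field.
have a0 : a != 0.
  by have := cauchy0_cleared_neq0 gt; rewrite Na mulf_eq0 negb_or => /andP[].
have QE : Qbar (z) = 1 - a^-1 by rewrite /Qbar Na; field; rewrite e1 a0.
have n1 := nsq_Qbar gt; rewrite z1 subrr mul0r in n1.
have Ima : Im a = y by rewrite -psiE cImD add0r.
clearbody a.
have na0 : nsq a != 0 by rewrite nsq_eq0.
have Rea : Re a = 1 / 2.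
  move: n1; rewrite QE [nsq (1 - _)]/nsq !(cReD, cReN, cImD, cImN, cReV, cImV) /=.
  have nE : nsq a = Re a ^+ 2 + Im a ^+ 2 by [].
  move: (Re a) (Im a) nE => u v nE h.
  have h2 : (1 - ((1 - u / nsq a) ^+ 2 + (0 - - v / nsq a) ^+ 2)) * nsq a = 2 * u - (u ^+ 2 + v ^+ 2) / nsq a.
    by field.
  by move: h2; rewrite h mul0r -nE divff //; lra.
have nE : nsq a = 1 / 4 + y ^+ 2 by rewrite /nsq Rea Ima; field.
by rewrite QE !(cReD, cReN, cImD, cImN, cReV, cImV) nE Rea Ima /= add0r mulNr opprK.
Qed.

Lemma Qbar_psi t : `|t| < alpha -> t != 0 ->
  let y := Im (psi mu (expi t)) in
  Re (Qbar (expi t)) = 1 - (1 / 2) / (1 / 4 + y ^+ 2) /\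
  Im (Qbar (expi t)) = y / (1 / 4 + y ^+ 2).
Proof.
move=> ta t0; apply: Qbar_psi_point; [exact: nsq_expi|exact: disk_or_arc_expi|].
rewrite -nsq_gt0 lt_def nsq_ge0 andbT nsq_eq0 subr_eq0.
  apply: contra_neq t0 => /(congr1 (@complex.Re R)) /= h.
  have /andP[a0 api] := halpha.
  have : `|t| = 0.
    apply: (@cos_inj R).
    - by rewrite in_itv /= normr_ge0 ltW // (lt_trans ta).
    - by rewrite in_itv /= lexx pi_ge0.
    - by rewrite cos_norm cos0 -h.
  by move/normr0_eq0.
Qed.

End BoundaryQ.

#[local] Opaque cauchy0_cleared Qkernel Qbar Qspeed gapA gapK psi.

(** * Boundary values of subordination functions *)

Section Ultra.
Variables (R : realType) (T : Type) (U : set_system T).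
Hypothesis UU : UltraFilter U.

Lemma fmap_ultra (V : Type) (f : T -> V) : UltraFilter (f @ U).
Proof.
split=> [|G GP UG]; first exact: fmap_proper_filter.
apply/seteqP; split=> [A GA|]; last exact: UG.
have [//|nA] := in_ultra_setVsetC (f @^-1` A) UU.
have /filter_ex[v [Av /(_ Av) //]] : G (A `&` ~` A).
by apply: filterI => //; exact: UG.
Qed.

(** Boundary values of bounded functions are defined below by this convergence. *)
Lemma ultra_cvg (f : T -> R) (M : R) : (\forall x \near U, `|f x| <= M) ->
  exists l : R, f @ U --> l.
Proof.
move=> fM; have := @segment_compact R (- M) M; rewrite compact_ultra => h.
have [l [_ fl]] : `[- M, M]%classic `&` [set l | f @ U --> l] !=set0.
  apply: h; first exact: fmap_ultra.
  by apply: filterS fM => x; rewrite /= in_itv /= ler_norml.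
by exists l.
Qed.

Lemma ultra_ccvg (f : T -> R[i]) : (\forall x \near U, nsq (f x) <= 1) ->
  exists l, ccvg U f l.
Proof.
move=> f1.
have sq (x : R) : x ^+ 2 <= 1 -> `|x| <= 1.
  by move=> h; rewrite -ler_sqr ?nnegrE // real_normK ?num_real // expr1n.
have [x fx] : exists l : R, (fun x => Re (f x)) @ U --> l.
  apply: (@ultra_cvg _ 1); apply: filterS f1 => x f1; apply: sq.
  exact: le_trans (nsqR _) f1.
have [y fy] : exists l : R, (fun x => Im (f x)) @ U --> l.
  apply: (@ultra_cvg _ 1); apply: filterS f1 => t f1; apply: sq.
  exact: le_trans (nsqI _) f1.
by exists (x +i* y).
Qed.

End Ultra.

Section BoundaryValues.
Variables (R : realType) (alpha : R).
Hypothesis halpha : 0 < alpha < pi.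
Variables (mu1 mu2 mu : probability (borel_circle R) R) (Z1 Z2 : R[i] -> R[i]).
Hypothesis hgap : mu (open_arc alpha `\ circle1 R) = 0%E.
Hypothesis hatom : (0 < mu [set circle1 R])%E.
Hypothesis mu_mean : cint mu (@cv R) != 0.
Hypothesis mu1_mean : nsq (cint mu1 (@cv R)) < 1.
Hypothesis cZ1 : continuous_on_disk Z1.
Hypothesis cZ2 : continuous_on_disk Z2.
Hypothesis Z10 : Z1 0 = 0.
Hypothesis Z20 : Z2 0 = 0.
Hypothesis ZZ : forall z, nsq z < 1 -> Z1 z * Z2 z = z * Qtrans mu1 (Z1 z).
Hypothesis Q12 : forall z, nsq z < 1 -> Qtrans mu1 (Z1 z) = Qtrans mu2 (Z2 z).
Hypothesis QQ : forall z, nsq z < 1 -> Qtrans mu z = Qtrans mu1 (Z1 z).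
Implicit Types (z w : R[i]) (t s : R).
Local Notation Qbar := (Qbar alpha mu).
Local Notation D := (Qspeed alpha mu).

Let c : R := (1 - nsq (cint mu1 (@cv R))) ^+ 2 / 4.

Let c_gt0 : 0 < c.
Proof. by rewrite divr_gt0 // exprn_gt0 // subr_gt0. Qed.

Let subZ := subordination mu_mean cZ1 cZ2 Z10 Z20 ZZ Q12 QQ.
Let pickZ := subordination_pick2 mu_mean cZ1 cZ2 Z10 Z20 ZZ Q12 QQ.

Let Z1_lt1 z : nsq z < 1 -> nsq (Z1 z) < 1.
Proof. by move=> z1; have [h _ _ _] := subZ z1; exact: le_lt_trans h z1. Qed.

(** A lower bound for the angular derivative of [z |-> Z2 z / z = mtrans mu1 (Z1 z)],
    from the Pick inequality between [z] and 0. *)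
Lemma mtrans_comp_ge z : nsq z < 1 ->
  c * (1 - nsq z) <= 1 - nsq (mtrans mu1 (Z1 z)).
Proof.
move=> z1; have o1 : nsq (0 : R[i]) < 1 by rewrite nsq0.
set g := mtrans mu1 (Z1 z); set g0 := cint mu1 (@cv R).
have g1 : nsq g <= 1 by apply: nsq_mtrans; exact: Z1_lt1.
have := pickZ z1 o1.
have -> : nsq (1 - z * cj 0) = 1.
  by rewrite (_ : 1 - z * cj 0 = 1) ?nsq1 //; apply: complex_eq; rewrite !cReImE /=; ring.
rewrite nsq0 subr0 mulr1 divr1 Z10 => h.
have := mtrans_pick2 mu1 (Z1_lt1 z1) o1 _ h.
rewrite mtrans0 -/g -/g0 /pick2 subr_ge0 => /(_ (ltW z1)) h2.
have h3 : c <= nsq (1 - g * cj g0).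
  have n : nsq (g * cj g0) <= nsq g0 by rewrite nsqM nsqJ ler_piMl ?nsq_ge0.
  apply: le_trans (nsq_1sub_ge (le_lt_trans n mu1_mean)).
  rewrite /c ler_pM2r ?invr_gt0 // ler_sqr ?nnegrE ?subr_ge0.
  - by rewrite lerD2l lerN2.
  - exact: ltW.
  - exact: le_trans n (ltW mu1_mean).
have h4 : (1 - nsq g) * (1 - nsq g0) <= 1 - nsq g.
  by rewrite ler_piMr ?subr_ge0 // gerBl nsq_ge0.
apply: le_trans (le_trans h2 h4).
by rewrite mulrC ler_wpM2l // subr_ge0 ltW.
Qed.

(** In [Qtrans mu = Z1 * (mtrans mu1 \o Z1)] the angular derivatives of the two
    factors add up, and the second one is at least [c]. *)
Lemma subordination_boundary z : nsq z < 1 ->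
  1 - nsq (Z1 z) <= (1 - nsq z) * (D z - c * nsq (Z1 z)).
Proof.
move=> z1; have zg : disk_or_arc alpha z by left.
have h := nsq_Qbar halpha hgap hatom zg.
have hc := mtrans_comp_ge z1.
rewrite mulrBr -h Qbar_disk // QQ // QtransE ?Z1_lt1 // nsqM.
have := nsq_ge0 (Z1 z); move: hc.
set x := nsq (Z1 z); set g := nsq (mtrans _ _) => hc x0.
have : x * (c * (1 - nsq z)) <= x * (1 - g) by rewrite ler_wpM2l.
lra.
Qed.

Lemma subordination_chord z w : nsq z < 1 -> nsq w < 1 ->
  nsq (1 - Z1 z * cj (Z1 w)) <= nsq (1 - z * cj w) *
    ((D z - c * nsq (Z1 z)) * (D w - c * nsq (Z1 w))).
Proof.
move=> z1 w1; have := pickZ z1 w1; rewrite /pick2.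
have bz := subordination_boundary z1; have bw := subordination_boundary w1.
have S0 := nsq_pick_gt0 z1 w1; set S := nsq (1 - z * cj w) in S0 *.
have T0 : 0 < (1 - nsq z) * (1 - nsq w) by rewrite mulr_gt0 ?subr_gt0.
rewrite mulrAC ler_pdivrMr // => h.
rewrite -(ler_pM2l T0); apply: le_trans h _.
rewrite mulrC [leRHS](_ : _ = S * (((1 - nsq z) * (D z - c * nsq (Z1 z))) *
  ((1 - nsq w) * (D w - c * nsq (Z1 w))))); last by ring.
by rewrite ler_pM2l // ler_pM // subr_ge0 ltW // Z1_lt1.
Qed.

(** The Pick inequality for [Qtrans mu1] at [Z1 z] and [Z1 w], combined with the
    Schwarz lemma [|Z1 z| <= |z|]. On the boundary it shows that [Z1] determines
    the value of [Qbar]. *)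
Lemma subordination_factor z w : nsq z < 1 -> nsq w < 1 ->
  nsq (1 - Qbar z * cj (Qbar w)) <= nsq (1 - Z1 z * cj (Z1 w)) * (D z * D w).
Proof.
move=> z1 w1; have Zz := Z1_lt1 z1; have Zw := Z1_lt1 w1.
have [lz _ _ _] := subZ z1; have [lw _ _ _] := subZ w1.
have S0 := nsq_pick_gt0 Zz Zw.
have A0 : 0 < (1 - nsq (Z1 z)) * (1 - nsq (Z1 w)) by rewrite mulr_gt0 ?subr_gt0.
have s0 : 0 < (1 - nsq (Z1 z)) * (1 - nsq (Z1 w)) / nsq (1 - Z1 z * cj (Z1 w)).
  by rewrite divr_gt0.
have := Qtrans_pick2 mu1 Zz Zw s0; rewrite {1}/pick2 divfK ?gt_eqF // => /(_ (lexx _)).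
rewrite /pick2 -!QQ // -!(Qbar_disk halpha hgap) //.
have gz : disk_or_arc alpha z by left. have gw : disk_or_arc alpha w by left.
rewrite !(nsq_Qbar halpha hgap hatom) //.
set S := nsq (1 - Z1 z * cj (Z1 w)) in S0 *.
rewrite mulrAC ler_pdivrMr // => h.
have T0 : 0 < (1 - nsq z) * (1 - nsq w) by rewrite mulr_gt0 ?subr_gt0.
rewrite -(ler_pM2l T0).
rewrite [leRHS](_ : _ = (1 - nsq z) * D z * ((1 - nsq w) * D w) * S); last by ring.
apply: le_trans h; rewrite ler_wpM2r ?nsq_ge0 //.
by rewrite ler_pM ?subr_ge0 ?(ltW z1) ?(ltW w1) // lerD2l lerN2.
Qed.

Section Curve.
Variable U : set_system R.
Hypothesis UU : UltraFilter U.
Hypothesis U1 : (1 : R)^'- `<=` U.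

Let pt (t : R) (r : R) : R[i] := r%:C * expi t.

Let pt_disk t : \forall r \near U, nsq (pt t r) < 1.
Proof.
by apply: U1; apply: filterS (near_radial_disk R) => r; apply; rewrite nsq_expi.
Qed.

Let ccvg_pt t : ccvg U (pt t) (expi t).
Proof.
have [h1 h2] := ccvg_radial (expi t : R[i]).
by split; [apply: cvg_trans h1|apply: cvg_trans h2]; move=> A /U1.
Qed.

Definition bvalue t : R[i] := xget 0 [set l | ccvg U (fun r => Z1 (pt t r)) l].

Lemma ccvg_bvalue t : ccvg U (fun r => Z1 (pt t r)) (bvalue t).
Proof.
have : exists l, ccvg U (fun r => Z1 (pt t r)) l.
  apply: ultra_ccvg; apply: filterS (pt_disk t) => r r1.
  exact: ltW (Z1_lt1 r1).
by move=> /(xgetPex 0).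
Qed.

Let cvg_D t : `|t| < alpha -> (fun r => D (pt t r)) @ U --> D (expi t).
Proof.
move=> ta; have gt := disk_or_arc_expi ta.
by have [h _] := ccvg_Qkernel halpha hgap hatom gt gt (ccvg_pt t) (ccvg_pt t).
Qed.

Lemma nsq_bvalue t : `|t| < alpha -> nsq (bvalue t) = 1.
Proof.
move=> ta; have h : (fun r => nsq (Z1 (pt t r))) @ U --> nsq (bvalue t).
  by apply: ccvg_nsq; exact: ccvg_bvalue.
apply/eqP; rewrite eq_le; apply/andP; split.
  by apply: (cvgr_to_le h); apply: filterS (pt_disk t) => r r1; exact: ltW (Z1_lt1 r1).
have h2 : (fun r => 1 - (1 - nsq (pt t r)) * (D (pt t r) - c * nsq (Z1 (pt t r)))) @ U -->
   1 - (1 - nsq (expi t)) * (D (expi t) - c * nsq (bvalue t)).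
  apply: cvgB; first exact: cvg_cst.
  apply: cvgM.
    by apply: cvgB; [exact: cvg_cst|exact: ccvg_nsq (ccvg_pt t)].
  apply: cvgB; first exact: cvg_D.
  by apply: cvgM; [exact: cvg_cst|exact: h].
move: h2; rewrite nsq_expi subrr mul0r subr0 => h2.
apply: (ler_cvg_to h2 h); apply: filterS (pt_disk t) => r r1.
by have := subordination_boundary r1; lra.
Qed.

Lemma bvalue_chord t s : `|t| < alpha -> `|s| < alpha ->
  nsq (1 - bvalue t * cj (bvalue s)) <=
  nsq (1 - expi t * cj (expi s)) * ((D (expi t) - c) * (D (expi s) - c)).
Proof.
move=> ta sa.
have sub1 (f g : R -> R[i]) l m : ccvg U f l -> ccvg U g m ->
    (fun r => nsq (1 - f r * cj (g r))) @ U --> nsq (1 - l * cj m).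
  move=> fl gm; apply: ccvg_nsq; apply: ccvgD; first exact: ccvg_cst.
  by apply: ccvgN; apply: ccvgM => //; exact: ccvgJ.
have h1 := sub1 _ _ _ _ (ccvg_bvalue t) (ccvg_bvalue s).
have hD x : `|x| < alpha -> (fun r => D (pt x r) - c * nsq (Z1 (pt x r))) @ U -->
    D (expi x) - c.
  move=> xa; have -> : D (expi x) - c = D (expi x) - c * nsq (bvalue x).
    by rewrite nsq_bvalue // mulr1.
  apply: cvgB; first exact: cvg_D.
  by apply: cvgM; [exact: cvg_cst|exact: ccvg_nsq (ccvg_bvalue x)].
have h2 : (fun r => nsq (1 - pt t r * cj (pt s r)) *
    ((D (pt t r) - c * nsq (Z1 (pt t r))) * (D (pt s r) - c * nsq (Z1 (pt s r))))) @ U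
  --> nsq (1 - (expi t : R[i]) * cj (expi s)) * ((D (expi t) - c) * (D (expi s) - c)).
  apply: cvgM; first exact: sub1 (ccvg_pt t) (ccvg_pt s).
  by apply: cvgM; exact: hD.
apply: (ler_cvg_to h1 h2); near=> r; apply: subordination_chord; near: r; exact: pt_disk.
Unshelve. all: by end_near. Qed.

Lemma bvalue_factor t s : `|t| < alpha -> `|s| < alpha ->
  bvalue t = bvalue s -> Qbar (expi t) * cj (Qbar (expi s)) = 1.
Proof.
move=> ta sa ts; apply/esym/eqP; rewrite -subr_eq0 -nsq_eq0 eq_le nsq_ge0 andbT.
have sub1 (f g : R -> R[i]) l m : ccvg U f l -> ccvg U g m ->
    (fun r => nsq (1 - f r * cj (g r))) @ U --> nsq (1 - l * cj m).
  move=> fl gm; apply: ccvg_nsq; apply: ccvgD; first exact: ccvg_cst.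
  by apply: ccvgN; apply: ccvgM => //; exact: ccvgJ.
have gt := disk_or_arc_expi ta; have gs := disk_or_arc_expi sa.
have h1 : (fun r => nsq (1 - Qbar (pt t r) * cj (Qbar (pt s r)))) @ U -->
    nsq (1 - Qbar (expi t) * cj (Qbar (expi s))).
  by apply: sub1; apply: ccvg_Qbar => //; exact: ccvg_pt.
have h2 : (fun r => nsq (1 - Z1 (pt t r) * cj (Z1 (pt s r))) * (D (pt t r) * D (pt s r))) @ U
   --> nsq (1 - bvalue t * cj (bvalue s)) * (D (expi t) * D (expi s)).
  apply: cvgM; first exact: sub1 (ccvg_bvalue t) (ccvg_bvalue s).
  by apply: cvgM; exact: cvg_D.
move: h2; rewrite ts mulJ (nsq_bvalue sa) subrr nsq0 mul0r => h2.
apply: (ler_cvg_to h1 h2); near=> r; apply: subordination_factor; near: r; exact: pt_disk.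
Unshelve. all: by end_near. Qed.

Lemma Qspeed_ge t : `|t| < alpha -> c <= D (expi t).
Proof.
move=> ta.
have h : (fun r => c * nsq (Z1 (pt t r))) @ U --> c * 1.
  apply: cvgM; first exact: cvg_cst.
  by rewrite -(nsq_bvalue ta); apply: ccvg_nsq; exact: ccvg_bvalue.
rewrite -[c]mulr1; apply: (ler_cvg_to h (cvg_D ta)).
apply: filterS (pt_disk t) => r r1; rewrite -subr_ge0.
have r0 : 0 < 1 - nsq (pt t r) by rewrite subr_gt0.
rewrite -(pmulr_rge0 _ r0); apply: le_trans (subordination_boundary r1).
by rewrite subr_ge0 ltW // Z1_lt1.
Qed.

End Curve.

(** What is used of the boundary values [u] of a subordination function: they run
    along the circle, slower than [Qbar] by at least [e], and determine the value
    of [Qbar]. *)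
Definition arc_curve (e : R) (u : R -> R[i]) := [/\ 0 < e,
  forall t, `|t| < alpha -> nsq (u t) = 1,
  forall t s, `|t| < alpha -> `|s| < alpha ->
    nsq (1 - u t * cj (u s)) <=
    nsq (1 - (expi t : R[i]) * cj (expi s : R[i])) *
      ((D (expi t) - e) * (D (expi s) - e)),
  forall t s, `|t| < alpha -> `|s| < alpha -> u t = u s ->
    Qbar (expi t) * cj (Qbar (expi s)) = 1
  & forall t, `|t| < alpha -> e <= D (expi t)].

Lemma boundary_curve (U : set_system R) : UltraFilter U -> (1 : R)^'- `<=` U ->
  exists e, exists2 u, arc_curve e u &
    forall t, ccvg U (fun r : R => Z1 (r%:C * expi t)) (u t).
Proof.
move=> UU U1; exists c; exists (bvalue U); last exact: ccvg_bvalue.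
split.
- exact: c_gt0.
- exact: nsq_bvalue.
- exact: bvalue_chord.
- exact: bvalue_factor.
- exact: Qspeed_ge.
Qed.

End BoundaryValues.

(** * Continuous arguments *)

Section Increasing.
Variable R : realType.
Implicit Types (f : R -> R).

(** A function that increases through each point of an interval increases on
    the interval, because its maximum can only be at the right end. *)
Lemma locally_increasing f (a b : R) : a < b -> continuous f ->
  (forall t0, a <= t0 <= b -> \forall t \near t0,
     a <= t <= b -> t != t0 -> 0 < (t - t0) * (f t - f t0)) ->
  f a < f b.
Proof.
move=> ab cf inc.
have [c] := @EVT_max R f a b (ltW ab) (continuous_subspaceT cf).
rewrite in_itv /= => /andP[ac cb] cmax.
have right_step t0 : a <= t0 -> t0 < b -> exists t, [/\ t0 < t, t <= b & f t0 < f t].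
  move=> at0 t0b; have /inc/nbhs_ballP[e /= e0 he] : a <= t0 <= b.
    by rewrite at0 ltW.
  pose t := t0 + Num.min (e / 2) (b - t0).
  have m0 : 0 < Num.min (e / 2) (b - t0) by rewrite lt_min divr_gt0 //= subr_gt0.
  have me : Num.min (e / 2) (b - t0) <= e / 2 by rewrite ge_min lexx.
  have mb : Num.min (e / 2) (b - t0) <= b - t0 by rewrite ge_min lexx orbT.
  have tt0 : t0 < t by rewrite /t ltrDl.
  have tb : t <= b by rewrite /t; lra.
  exists t; split => //.
  have : 0 < (t - t0) * (f t - f t0).
    apply: he.
    - have -> : ball t0 e t = (`|t0 - t| < e) by [].
      by rewrite ltr0_norm ?subr_lt0 // /t; lra.
    - by rewrite tb andbT; lra.
    - by rewrite gt_eqF.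
  by rewrite pmulr_rgt0 subr_gt0.
have cE : c = b.
  apply/eqP; rewrite eq_le cb /= leNgt; apply/negP => cltb.
  have [t [ct tb ft]] := right_step c ac cltb.
  have : f t <= f c by apply: cmax; rewrite in_itv /= tb andbT; lra.
  by rewrite leNgt ft.
have [t [at_ tb ft]] := right_step a (lexx a) ab.
by apply: lt_le_trans ft _; rewrite -cE; apply: cmax; rewrite in_itv /= tb andbT ltW.
Qed.

End Increasing.

Section Lift.
Variable R : realType.
Implicit Types (u : R -> R[i]) (s t x : R).

(** Cousin's lemma, for properties of subintervals. *)
Lemma cousin (P : R -> R -> Prop) (a b : R) : a <= b ->
  (forall s m t, s <= m -> m <= t -> P s m -> P m t -> P s t) ->
  (forall x, a <= x <= b -> exists2 e, 0 < e &
     forall s t, a <= s -> s <= x -> x <= t -> t <= b -> x - e < s -> t < x + e -> P s t) ->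
  P a b.
Proof.
move=> ab glue loc.
pose S := [set c | a <= c <= b /\ P a c].
have Sa : S a.
  have [|e e0 he] := loc a; first by rewrite lexx.
  split; first by rewrite lexx.
  by apply: he => //; lra.
have Sb : ubound S b by move=> c [/andP[]].
have hS : has_sup S by split; [exists a|exists b].
pose x := sup S.
have ax : a <= x by apply: ub_le_sup => //; exists b.
have xb : x <= b by apply: ge_sup => //; exists a.
have [e e0 he] : exists2 e, 0 < e &
     forall s t, a <= s -> s <= x -> x <= t -> t <= b -> x - e < s -> t < x + e -> P s t.
  by apply: loc; rewrite ax.
have [c [/andP[ac cb] Pac] xec] : exists2 c, S c & x - e < c by exact: sup_adherent.
have cx : c <= x by apply: ub_le_sup; [exists b|split => //; rewrite ac].
pose t := Num.min b (x + e / 2).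
have tb : t <= b by rewrite ge_min lexx.
have te : t <= x + e / 2 by rewrite ge_min lexx orbT.
have xt : x <= t by rewrite le_min xb /=; lra.
have Pat : P a t.
  by apply: (glue a c t) => //; [exact: le_trans xt|apply: he => //; lra].
have St : S t by split=> //; rewrite tb andbT; lra.
have tx : t <= x by apply: ub_le_sup => //; exists b.
have tE : t = b.
  have : b <= x + e / 2.
    rewrite leNgt; apply/negP => h; have : t = x + e / 2 by rewrite /t min_r // ltW.
    by move=> tE; move: tx; rewrite tE; lra.
  by move=> h; rewrite /t min_l.
by rewrite -tE.
Qed.

(** Near each point the argument differs from a constant by an arcsine. Lifts are
    taken continuous on the whole line, so that a lift [phi] up to [m] and a lift
    [psi] from [m] on glue to [phi (min x m) + psi (max x m) - psi m]. *)
Lemma circle_lift u (a b : R) : a <= b ->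
  (forall t, a <= t <= b -> nsq (u t) = 1) ->
  (forall t, a <= t <= b -> ccvg (nbhs t) u (u t)) ->
  exists2 phi : R -> R, continuous phi & forall t, a <= t <= b -> expi (phi t) = u t.
Proof.
move=> ab u1 cu.
pose P s t := exists2 phi : R -> R, continuous phi &
  forall x, s <= x <= t -> expi (phi x) = u x.
suff : P a b by [].
pose P' s t := a <= s -> t <= b -> P s t.
suff : P' a b by apply.
apply: cousin => // [s m t sm mt h1 h2 as_ tb|x /andP[ax xb]].
  have [phi cphi hphi] := h1 as_ (le_trans mt tb).
  have [psi cpsi hpsi] := h2 (le_trans as_ sm) tb.
  exists (fun x => phi (Num.min x m) + psi (Num.max x m) - psi m).
    move=> x; apply: cvgB; last exact: cvg_cst.
    apply: cvgD.
      apply: (@continuous_comp _ _ _ (fun y => Num.min y m) phi); last exact: cphi.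
      by apply: continuous_min; [exact: cvg_id|exact: cvg_cst].
    apply: (@continuous_comp _ _ _ (fun y => Num.max y m) psi); last exact: cpsi.
    by apply: continuous_max; [exact: cvg_id|exact: cvg_cst].
  move=> x /andP[sx xt]; rewrite expiB expiD.
  have um : nsq (u m) = 1 by apply: u1; rewrite (le_trans as_ sm) (le_trans mt tb).
  have [xm|mx] := lerP x m.
    rewrite hphi ?sx // !hpsi ?lexx ?mt //.
    by rewrite -mulrA mulJ um mulr1.
  rewrite hphi ?sm ?lexx // !hpsi ?lexx ?mt ?(ltW mx) //.
  by rewrite mulrAC mulJ um mul1r.
have xab : a <= x <= b by rewrite ax.
have [th thx _] := expi_acos (u1 x xab).
pose v t := u t * cj (u x).
have cv_ : ccvg (nbhs x) v (v x).
  by apply: ccvgM; [exact: cu|exact: ccvg_cst].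
have vx : v x = 1 by rewrite /v mulJ u1.
have [e e0 he] : exists2 e, 0 < e & forall t, x - e < t < x + e -> 0 < Re (v t).
  have : \forall t \near x, 0 < Re (v t).
    by apply: (cvgr_gt _ cv_.1); rewrite vx.
  move=> /nbhs_ballP[e /= e0 he]; exists e => // t /andP[t1 t2]; apply: he.
  have -> : ball x e t = (`|x - t| < e) by [].
  by rewrite ltr_norml; apply/andP; split; lra.
exists e => // s t as' sx xt tb xs tx as_ tb'.
pose cl y := Num.max s (Num.min y t).
have clE y : s <= cl y <= t.
  by rewrite /cl le_max lexx /= ge_max (le_trans sx xt) ge_min lexx orbT.
have clx y : a <= cl y <= b.
  by have /andP[h1 h2] := clE y; rewrite (le_trans as_ h1) (le_trans h2 tb).
have rv y : 0 < Re (v (cl y)).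
  by have /andP[h1 h2] := clE y; apply: he; apply/andP; split; lra.
have nv y : nsq (v (cl y)) = 1 by rewrite nsqM nsqJ !u1 // mulr1.
have iv y : -1 < Im (v (cl y)) < 1.
  by have := nv y; have := rv y; rewrite /nsq => h1 h2; apply/andP; split; nra.
exists (fun y => th + asin (Im (v (cl y)))).
  move=> y; apply: cvgD; first exact: cvg_cst.
  apply: (@continuous_comp _ _ _ (fun y => Im (v (cl y))) (@asin R)); last first.
    exact: continuous_asin.
  have ccl : {for y, continuous cl}.
    apply: continuous_max; first exact: cvg_cst.
    by apply: continuous_min; [exact: cvg_id|exact: cvg_cst].
  apply: (@continuous_comp _ _ _ cl (fun y => Im (v y))) => //.
  have h : ccvg (nbhs (cl y)) v (v (cl y)).
    by apply: ccvgM; [exact: cu|exact: ccvg_cst].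
  exact: h.2.
move=> y /andP[sy yt].
have clyE : cl y = y by rewrite /cl min_l // max_r.
have := rv y; have := nv y; have := iv y; rewrite clyE => /andP[i1 i2] n1 r1.
have i12 : -1 <= Im (v y) <= 1 by rewrite !ltW.
rewrite expiD thx.
have -> : expi (asin (Im (v y))) = v y.
  apply: complex_eq => /=; last by apply: asinK; rewrite in_itv.
  rewrite cos_asin // -[RHS](ger0_norm (ltW r1)) -sqrtr_sqr; congr Num.sqrt.
  by rewrite -n1 /nsq; ring.
have uy : nsq (u x) = 1 by exact: u1.
by rewrite /v mulrCA mulJ uy mulr1.
Qed.

End Lift.

(** * Angular speeds on the arc *)

Section Winding.
Variables (R : realType) (alpha : R).
Hypothesis halpha : 0 < alpha < pi.
Variable mu : probability (borel_circle R) R.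
Hypothesis hgap : mu (open_arc alpha `\ circle1 R) = 0%E.
Hypothesis hatom : (0 < mu [set circle1 R])%E.
Implicit Types (t s : R) (u : R -> R[i]).
Local Notation Qbar := (Qbar alpha mu).
Local Notation D := (Qspeed alpha mu).
Local Notation E := (Qkernel alpha mu).
Local Notation arc_curve := (arc_curve alpha mu).

Lemma near_arc t : `|t| < alpha -> \forall s \near t, `|s| < alpha.
Proof.
move=> ta; have h : (fun s : R => `|s|) @ t --> `|t| by exact: (@cvg_norm _ _ _ _ _ id).
exact: (cvgr_lt _ h).
Qed.

Lemma ccvg_expi t : ccvg (nbhs t) (@expi R : R -> R[i]) (expi t).
Proof. by split; [exact: continuous_cos|exact: continuous_sin]. Qed.

Lemma ccvg_Qkernel_arc t : `|t| < alpha ->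
  ccvg (nbhs t) (fun s => E (expi s) (expi t)) (E (expi t) (expi t)).
Proof.
move=> ta; have gt := disk_or_arc_expi ta.
apply: (ccvg_Qkernel halpha hgap hatom gt gt); first exact: ccvg_expi.
exact: ccvg_cst.
Qed.

Lemma cvg_Qspeed_arc t : `|t| < alpha -> (fun s => D (expi s)) @ t --> D (expi t).
Proof.
move=> ta; have gt := disk_or_arc_expi ta.
by have [h _] := ccvg_Qkernel halpha hgap hatom gt gt (ccvg_expi t) (ccvg_expi t).
Qed.

Lemma ccvg_Qbar_arc t : `|t| < alpha ->
  ccvg (nbhs t) (fun s => Qbar (expi s)) (Qbar (expi t)).
Proof.
move=> ta; have gt := disk_or_arc_expi ta.
by apply: (ccvg_Qbar halpha hgap hatom gt); exact: ccvg_expi.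
Qed.

Lemma nsq_Qbar_arc t : `|t| < alpha -> nsq (Qbar (expi t)) = 1.
Proof.
move=> ta; have := nsq_Qbar halpha hgap hatom (disk_or_arc_expi ta).
by rewrite nsq_expi subrr mul0r => /eqP; rewrite subr_eq0 => /eqP.
Qed.

Lemma arc_curve_continuous e u t : arc_curve e u -> `|t| < alpha ->
  ccvg (nbhs t) u (u t).
Proof.
move=> [e0 u1 ch _ _] ta.
pose g s := nsq (1 - (expi s : R[i]) * cj (expi t : R[i])) *
    ((D (expi s) - e) * (D (expi t) - e)).
apply: (@ccvg_le _ _ _ _ _ g).
  have -> : (0 : R) = nsq (1 - (expi t : R[i]) * cj (expi t : R[i])) *
      ((D (expi t) - e) * (D (expi t) - e)).
    by rewrite mulJ nsq_expi subrr nsq0 mul0r.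
  apply: cvgM.
    apply: ccvg_nsq; apply: ccvgD; first exact: ccvg_cst.
    by apply: ccvgN; apply: ccvgM; [exact: ccvg_expi|exact: ccvg_cst].
  apply: cvgM; last exact: cvg_cst.
  by apply: cvgB; [exact: cvg_Qspeed_arc|exact: cvg_cst].
apply: filterS (near_arc ta) => s sa.
by rewrite -nsq_pick !u1 // subrr mul0r subr0; exact: ch.
Qed.

Hypothesis Dpos : forall t, `|t| < alpha -> 0 < D (expi t).

Section Compare.
Variables (a b : R).
Hypothesis a_arc : - alpha < a.
Hypothesis b_arc : b < alpha.

Let arcab t : a <= t <= b -> `|t| < alpha.
Proof.
move=> /andP[at_ tb]; rewrite ltr_norml (lt_le_trans a_arc at_) /=.
exact: le_lt_trans tb b_arc.
Qed.

Variable q : R -> R.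
Hypothesis cq : continuous q.
Hypothesis hq : forall t, a <= t <= b -> expi (q t) = Qbar (expi t).

Let near_small (f : R -> R) t0 : continuous f ->
  \forall t \near t0, `|f t - f t0| < pi.
Proof.
move=> cf; have h : (fun t => `|f t - f t0|) @ t0 --> (0 : R).
  rewrite -(@normr0 _ R) -{1}(subrr (f t0)); apply: cvg_norm.
  by apply: cvgB; [exact: cf|exact: cvg_cst].
by apply: (cvgr_lt _ h); exact: pi_gt0.
Qed.

Let near_diff_small t0 : \forall t \near t0, `|t - t0| < (pi : R).
Proof. by apply: (near_small (f := id)) => x; exact: cvg_id. Qed.

(** By the imaginary part of the kernel identity, the sine of the increment of [q]
    is [2 * sin ((t - t0) / 2)] times a factor that tends to the speed. *)
Lemma Qarg_locally_increasing t0 : a <= t0 <= b -> \forall t \near t0,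
  a <= t <= b -> t != t0 -> 0 < (t - t0) * (q t - q t0).
Proof.
move=> t0ab; have t0a := arcab t0ab.
pose k t := cos ((t - t0) / 2) * Re (E (expi t) (expi t0)) -
   sin ((t - t0) / 2) * Im (E (expi t) (expi t0)).
have ch : (fun t => (t - t0) / 2) @ t0 --> (0 : R).
  rewrite -(mul0r 2^-1) -{1}(subrr t0); apply: cvgM; last exact: cvg_cst.
  by apply: cvgB; [exact: cvg_id|exact: cvg_cst].
have [ER EI] := ccvg_Qkernel_arc t0a.
have ck : k @ t0 --> D (expi t0).
  have -> : D (expi t0) = cos 0 * Re (E (expi t0) (expi t0)) -
     sin 0 * Im (E (expi t0) (expi t0)).
    by rewrite cos0 sin0 mul1r mul0r subr0.
  apply: cvgB; apply: cvgM => //.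
    by apply: (@continuous_cvg _ _ _ _ _ _ (@cos R)) => //; exact: continuous_cos.
  by apply: (@continuous_cvg _ _ _ _ _ _ (@sin R)) => //; exact: continuous_sin.
have near_k : \forall t \near t0, 0 < k t.
  by apply: (cvgr_gt _ ck); exact: Dpos.
near=> t => tab tt0; have ta := arcab tab.
have kt : 0 < k t by near: t.
have qs : `|q t - q t0| < pi by near: t; exact: near_small.
have ts : `|t - t0| < pi by near: t; exact: near_diff_small.
have sE : sin (q t - q t0) = 2 * sin ((t - t0) / 2) * k t.
  have := congr1 (@complex.Im R)
    (Qbar_kernel halpha hgap hatom (disk_or_arc_expi ta) (disk_or_arc_expi t0a)).
  rewrite -!hq // -!expiB /k; move: (E _ _) => w.
  rewrite cImM !(cImD, cImN, cReD, cReN) /= !sub0r.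
  rewrite [cos (t - t0)]cos_half [sin (t - t0)]sin_half => h.
  by apply: oppr_inj; rewrite h; ring.
clear kt; have kt : 0 < k t by near: t.
move: tt0; rewrite neq_lt => /orP[tt0|tt0].
- have x0 : 0 < t0 - t by rewrite subr_gt0.
  have h1 : 0 < sin ((t0 - t) / 2).
    by apply: sin_half_gt0 => //; move: ts; rewrite ltr_norml => /andP[]; rewrite ltrNl opprB.
  rewrite -opprB mulNr oppr_gt0 pmulr_rlt0 // subr_lt0 ltNge; apply/negP => qq.
  have : 0 <= sin (q t - q t0).
    apply: sin_ge0_pi; rewrite subr_ge0 qq /=.
    by move: qs; rewrite ltr_norml => /andP[_ /ltW].
  rewrite sE leNgt; apply/negP; rewrite negbK nmulr_rlt0 //.
  by rewrite -opprB mulNr sinN mulrN oppr_lt0 mulr_gt0.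
- have x0 : 0 < t - t0 by rewrite subr_gt0.
  have h1 : 0 < sin ((t - t0) / 2).
    by apply: sin_half_gt0 => //; move: ts; rewrite ltr_norml => /andP[].
  rewrite pmulr_rgt0 // subr_gt0 ltNge; apply/negP => qq.
  have : 0 <= sin (q t0 - q t).
    apply: sin_ge0_pi; rewrite subr_ge0 qq /=.
    by move: qs; rewrite distrC ltr_norml => /andP[_ /ltW].
  rewrite -opprB sinN oppr_ge0 sE leNgt; apply/negP; rewrite negbK.
  by rewrite !mulr_gt0.
Unshelve. all: by end_near. Qed.

Variables (e : R) (u : R -> R[i]) (phi : R -> R).
Hypothesis uE : arc_curve e u.
Hypothesis cphi : continuous phi.
Hypothesis hphi : forall t, a <= t <= b -> expi (phi t) = u t.

(** The angular speed of [Qbar] exceeds that of [u] by at least [e]; sines of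
    half-angles, i.e. half-chords, are compared in place of derivatives. *)
Lemma Qarg_faster t0 : a <= t0 <= b -> \forall t \near t0,
  a <= t <= b -> t != t0 -> `|phi t - phi t0| < `|q t - q t0|.
Proof.
move=> t0ab; have t0a := arcab t0ab; have [e0 u1 chord _ De] := uE.
have near_lt : \forall t \near t0, (D (expi t) - e) * (D (expi t0) - e) <
    nsq (E (expi t) (expi t0)).
  have h : (fun t => nsq (E (expi t) (expi t0)) -
      (D (expi t) - e) * (D (expi t0) - e)) @ t0 -->
      nsq (E (expi t0) (expi t0)) - (D (expi t0) - e) * (D (expi t0) - e).
    apply: cvgB; first by apply: ccvg_nsq; exact: ccvg_Qkernel_arc.
    apply: cvgM; last exact: cvg_cst.
    by apply: cvgB; [exact: cvg_Qspeed_arc|exact: cvg_cst].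
  have l0 : 0 < nsq (E (expi t0) (expi t0)) - (D (expi t0) - e) * (D (expi t0) - e).
    rewrite (Qkernel_real halpha mu (disk_or_arc_expi t0a)) nsq_real.
    have := De t0 t0a; move: (D _) => d de; nra.
  by apply: filterS (cvgr_gt _ h _ l0) => t; rewrite subr_gt0.
near=> t => tab tt0; have ta := arcab tab.
have lt1 : (D (expi t) - e) * (D (expi t0) - e) < nsq (E (expi t) (expi t0)).
  by near: t.
have qs : `|q t - q t0| < pi by near: t; exact: near_small.
have ps : `|phi t - phi t0| < pi by near: t; exact: near_small.
have ts : `|t - t0| < pi by near: t; exact: near_diff_small.
have half x : `|x| < pi -> `|x / 2| <= (pi : R) / 2.
  by move=> xpi; rewrite normrM [`|2^-1|]ger0_norm // ler_pM2r // ltW.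
have s0 : 0 < sin ((t - t0) / 2) ^+ 2.
  rewrite exprn_even_gt0 //=; move: tt0 ts; rewrite neq_lt ltr_norml => /orP[tt0|tt0] /andP[t1 t2].
  - have h : 0 < sin ((t0 - t) / 2).
      by apply: sin_half_gt0; rewrite ?subr_gt0 // -opprB ltrNl.
    by rewrite -opprB mulNr sinN oppr_eq0 gt_eqF.
  - have h : 0 < sin ((t - t0) / 2) by apply: sin_half_gt0; rewrite ?subr_gt0.
    by rewrite gt_eqF.
have c1 := chord _ _ ta t0a; rewrite -!hphi // !nsq_expiB in c1.
have c2 := congr1 (@nsq R) (Qbar_kernel halpha hgap hatom (disk_or_arc_expi ta) (disk_or_arc_expi t0a)).
rewrite nsqM -!hq // !nsq_expiB in c2.
have : `|(phi t - phi t0) / 2| < `|(q t - q t0) / 2|.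
  apply: sin_sqr_lt; [exact: half|exact: half|].
  have h4 : (0 : R) < 4 by [].
  rewrite -(ltr_pM2l h4) c2; apply: le_lt_trans c1 _.
  by rewrite ltr_pM2l // mulr_gt0.
by rewrite !normrM ltr_pM2r // normr_gt0.
Unshelve. all: by end_near. Qed.

Lemma Qarg_minus_increasing : a < b -> q a - phi a < q b - phi b.
Proof.
move=> ab; apply: (@locally_increasing _ (fun t => q t - phi t)) => //.
  by move=> t; apply: cvgB; [exact: cq|exact: cphi].
move=> t0 t0ab; near=> t => tab tt0.
have h1 : 0 < (t - t0) * (q t - q t0).
  by move: tab tt0; near: t; exact: Qarg_locally_increasing.
have h2 : `|phi t - phi t0| < `|q t - q t0|.
  by move: tab tt0; near: t; exact: Qarg_faster.
have -> : q t - phi t - (q t0 - phi t0) = (q t - q t0) - (phi t - phi t0) by ring.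
move: tt0 h2; rewrite neq_lt ltr_norml => /orP[tt0|tt0] /andP[].
- have d0 : t - t0 < 0 by rewrite subr_lt0.
  move: h1; rewrite nmulr_rgt0 // => h1; rewrite nmulr_rgt0 // ltr0_norm //.
  by rewrite opprK => h2 h3; lra.
- have d0 : 0 < t - t0 by rewrite subr_gt0.
  move: h1; rewrite pmulr_rgt0 // => h1; rewrite pmulr_rgt0 // gtr0_norm //.
  by move=> h2 h3; lra.
Unshelve. all: by end_near. Qed.

End Compare.
End Winding.

(** * Counting turns *)

Section Contradiction.
Variables (R : realType) (alpha : R).
Hypothesis halpha : 0 < alpha < pi.
Variable mu : probability (borel_circle R) R.
Hypothesis hgap : mu (open_arc alpha `\ circle1 R) = 0%E.
Hypothesis hatom : (0 < mu [set circle1 R])%E.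
Hypothesis hlim_l : Im (psi mu (expi t)) @[t --> alpha^'-] --> -oo.
Hypothesis hlim_r : Im (psi mu (expi t)) @[t --> (- alpha)^'+] --> +oo.
Implicit Types (t s : R) (u : R -> R[i]).
Local Notation Qbar := (Qbar alpha mu).
Local Notation D := (Qspeed alpha mu).
Local Notation arc_curve := (arc_curve alpha mu).

Let cosh_gap : 0 < 1 - cos (alpha / 2).
Proof.
have /andP[a0 api] := halpha.
have h : 0 < alpha / 2 by rewrite divr_gt0.
rewrite subr_gt0 -[X in _ < X]cos0 ltr_cos ?in_itv /= ?lexx ?pi_ge0 //.
by apply/andP; split; lra.
Qed.

Let M := (1 - cos (alpha / 2))^-1 + 1.

Lemma Qbar_near_end t : `|t| < alpha -> t != 0 ->
  M < `|Im (psi mu (expi t))| -> cos (alpha / 2) < Re (Qbar (expi t)).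
Proof.
move=> ta t0; have [-> _] := Qbar_psi halpha hgap hatom ta t0.
set y := Im _; have := cosh_gap; rewrite /M; set k := 1 - cos _ => k0 My.
have kE : cos (alpha / 2) = 1 - k by rewrite /k; ring.
rewrite kE ltrD2l ltrN2.
have iv0 : 0 < k^-1 by rewrite invr_gt0.
have y2 : k^-1 < y ^+ 2 by rewrite -real_normK ?num_real //; move: `|y| My => v; nra.
have den : 0 < 1 / 4 + y ^+ 2 by rewrite ltr_wpDr ?sqr_ge0 // divr_gt0.
rewrite ltr_pdivrMr //.
have : 1 < k * y ^+ 2 by rewrite -(divff (lt0r_neq0 k0)) ltr_pM2l.
by rewrite mulrDr; lra.
Qed.

Lemma Qbar_neq1 t : `|t| < alpha -> t != 0 -> Re (Qbar (expi t)) < 1.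
Proof.
move=> ta t0; have [-> _] := Qbar_psi halpha hgap hatom ta t0.
by rewrite gtrBl !divr_gt0 // ltr_wpDr ?sqr_ge0 // divr_gt0.
Qed.

Lemma exists_right_end : exists b, [/\ alpha / 2 <= b, b < alpha,
  Im (psi mu (expi b)) < 0 & M < `|Im (psi mu (expi b))|].
Proof.
have /andP[a0 api] := halpha.
have M0 : 0 < M by rewrite addr_gt0 // invr_gt0.
have : \forall t \near alpha^'-, [/\ alpha / 2 <= t, t < alpha &
    Im (psi mu (expi t)) < - M].
  near=> t; split; near: t.
  - by apply: nbhs_left_ge; lra.
  - exact: nbhs_left_lt.
  - by move/cvgrNyPlt : hlim_l; apply; exact: num_real.
move=> /filter_ex[b [b1 b2 b3]]; exists b; split => //; first by lra.
by rewrite ltr0_norm; lra.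
Unshelve. all: by end_near. Qed.

Lemma exists_left_end : exists a, [/\ a <= - (alpha / 2), - alpha < a,
  0 < Im (psi mu (expi a)) & M < `|Im (psi mu (expi a))|].
Proof.
have /andP[a0 api] := halpha.
have M0 : 0 < M by rewrite addr_gt0 // invr_gt0.
have : \forall t \near (- alpha)^'+, [/\ t <= - (alpha / 2), - alpha < t &
    M < Im (psi mu (expi t))].
  near=> t; split; near: t.
  - by apply: nbhs_right_le; lra.
  - exact: nbhs_right_gt.
  - by move/cvgryPgt : hlim_r; apply; exact: num_real.
move=> /filter_ex[b [b1 b2 b3]]; exists b; split => //; first by lra.
by rewrite gtr0_norm; lra.
Unshelve. all: by end_near. Qed.

(** Otherwise [f] would take the value [2 pi]. *)
Lemma argument_lt_2pi (f : R -> R) (b : R) : 0 < b -> continuous f -> f 0 = 0 ->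
  (forall t, 0 < t <= b -> cos (f t) < 1) -> 0 < f b -> f b < pi *+ 2.
Proof.
move=> b0 cf f0 f1 fb; rewrite ltNge; apply/negP => h.
have [||c /[!in_itv]/= /andP[c0 cb] fc] :=
  @IVT R f 0 b (pi *+ 2) _ (continuous_subspaceT cf); first exact: ltW.
- rewrite f0 ge_min le_max h orbT andbT.
  by rewrite mulrn_wge0 // pi_ge0.
have c0' : 0 < c.
  rewrite lt_neqAle c0 andbT; apply/eqP => cE; move: fc; rewrite -cE f0 => /esym/eqP.
  by rewrite mulrn_eq0 /= gt_eqF // pi_gt0.
by have := f1 c; rewrite c0' cb fc cos2pi ltxx => /(_ isT).
Qed.

Section TwoCurves.
Variables (e1 e2 : R) (u1 u2 : R -> R[i]).
Hypothesis h1 : arc_curve e1 u1.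
Hypothesis h2 : arc_curve e2 u2.
Hypothesis u12 : forall t, `|t| < alpha -> u1 t * u2 t = expi t * Qbar (expi t).

Let Dpos t : `|t| < alpha -> 0 < D (expi t).
Proof. by case: h1 => e0 _ _ _ De ta; exact: lt_le_trans e0 (De t ta). Qed.

(** A boundary curve that turns by more than [2 pi] returns to its initial point at
    some time, when it has turned by exactly [2 pi]. Then [Qbar] is back as well and
    has also turned by [2 pi], although it is faster. *)
Lemma no_full_turn e u (a b : R) (q phi : R -> R) :
  arc_curve e u -> - alpha < a -> a < b -> b < alpha ->
  continuous q -> continuous phi ->
  (forall t, a <= t <= b -> expi (q t) = Qbar (expi t)) ->
  (forall t, a <= t <= b -> expi (phi t) = u t) ->
  q b - q a < pi *+ 4 -> phi b - phi a <= pi *+ 2.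
Proof.
move=> hu aa ab ba cq cphi hq hphi qab; rewrite leNgt; apply/negP => hphi2.
have p0 := pi_gt0 R.
have [|c /[!in_itv]/= /andP[ac cb] fc] :=
  @IVT R phi a b (phi a + pi *+ 2) (ltW ab) (continuous_subspaceT cphi).
  rewrite ge_min le_max; move: hphi2; rewrite mulr2n => hphi2.
  by apply/andP; split; apply/orP; [left|right]; lra.
have ac' : a < c.
  rewrite lt_neqAle ac andbT; apply/eqP => cE; move: fc; rewrite -cE mulr2n; lra.
have aarc : `|a| < alpha by rewrite ltr_norml aa (lt_trans ab ba).
have carc : `|c| < alpha.
  by rewrite ltr_norml (lt_trans aa ac') (le_lt_trans cb ba).
have ua : a <= a <= b by rewrite lexx ltW.
have uc : a <= c <= b by rewrite ac cb.
have uE : u c = u a by rewrite -!hphi // fc expiD expi2pi mulr1.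
have [_ _ _ fac _] := hu.
have := fac _ _ carc aarc uE; rewrite -!hq // -expiB => /(congr1 (@complex.Re R)) /= cos1.
have hq' t : a <= t <= c -> expi (q t) = Qbar (expi t).
  by move=> /andP[t1 t2]; apply: hq; rewrite t1 (le_trans t2).
have hphi' t : a <= t <= c -> expi (phi t) = u t.
  by move=> /andP[t1 t2]; apply: hphi; rewrite t1 (le_trans t2).
have inc := Qarg_minus_increasing halpha hgap hatom Dpos aa (le_lt_trans cb ba)
  cq hq' hu cphi hphi' ac'.
have qinc s t : a <= s -> s < t -> t <= b -> q s < q t.
  move=> as_ st tb; apply: (locally_increasing st cq) => t0 /andP[t1 t2].
  have t0ab : a <= t0 <= b by rewrite (le_trans as_ t1) (le_trans t2 tb).
  have := Qarg_locally_increasing halpha hgap hatom Dpos aa ba cq hq t0ab.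
  apply: filterS => x hx /andP[x1 x2] x0; apply: hx => //.
  by rewrite (le_trans as_ x1) (le_trans x2 tb).
have q0 : 0 < q c - q a by rewrite subr_gt0 qinc.
have q4 : q c - q a < pi *+ 4.
  apply: le_lt_trans qab; rewrite lerD2r.
  by have [->//|cb'] := eqVneq c b; rewrite ltW // qinc // lt_neqAle cb' cb.
have := cos_eq1_between cos1 q0 q4; move: fc inc; rewrite !mulr2n; lra.
Qed.

(** On either side of 1, [Qbar] turns by more than [2 pi - alpha / 2]. The
    arguments of [u1] and [u2] add up to [t + q t], hence increase together by
    more than [4 pi] between [a] and [b], and one of them by more than [2 pi]. *)
Lemma two_curves_false : False.
Proof.
have /andP[a0 api] := halpha; have p0 := pi_gt0 R.
have [b [b1 b2 b3 b4]] := exists_right_end.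
have [a [a1 a2 a3 a4]] := exists_left_end.
have ab : a < b by lra.
have arc t : a <= t <= b -> `|t| < alpha.
  by move=> /andP[t1 t2]; rewrite ltr_norml (lt_le_trans a2 t1) (le_lt_trans t2 b2).
have [q0 cq0 hq0] : exists2 q : R -> R, continuous q &
    forall t, a <= t <= b -> expi (q t) = Qbar (expi t).
  apply: circle_lift => [|t tab|t tab]; first exact: ltW.
  - exact: nsq_Qbar_arc (arc t tab).
  - exact: ccvg_Qbar_arc (arc t tab).
have [phi cphi hphi] : exists2 phi : R -> R, continuous phi &
    forall t, a <= t <= b -> expi (phi t) = u1 t.
  apply: circle_lift => [|t tab|t tab]; first exact: ltW.
  - by case: h1 => _ n1 _ _ _; exact: n1 (arc t tab).
  - exact: arc_curve_continuous h1 (arc t tab).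
have ab0 : a <= 0 <= b by apply/andP; split; lra.
pose q t := q0 t - q0 0.
have cq : continuous q by move=> t; apply: cvgB; [exact: cq0|exact: cvg_cst].
have hq t : a <= t <= b -> expi (q t) = Qbar (expi t).
  by move=> tab; rewrite /q expiB !hq0 // expi0 Qbar1 conjc1 mulr1.
have q00 : q 0 = 0 by rewrite /q subrr.
have qinc s t : a <= s -> s < t -> t <= b -> q s < q t.
  move=> as_ st tb; apply: (locally_increasing st cq) => t0 /andP[t1 t2].
  have t0ab : a <= t0 <= b by rewrite (le_trans as_ t1) (le_trans t2 tb).
  have := Qarg_locally_increasing halpha hgap hatom Dpos a2 b2 cq hq t0ab.
  apply: filterS => x hx /andP[x1 x2] x0; apply: hx => //.
  by rewrite (le_trans as_ x1) (le_trans x2 tb).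
have half : 0 < alpha / 2 < pi by apply/andP; split; lra.
have bab : a <= b <= b by rewrite lexx ltW.
have aab : a <= a <= b by rewrite lexx ltW.
have b0 : 0 < b by lra.
have a0' : a < 0 by lra.
have qb0 : 0 < q b by rewrite -q00; apply: qinc => //; lra.
have qb2 : q b < pi *+ 2.
  apply: (argument_lt_2pi b0 cq q00) => // t /andP[t0 tb].
  have tab : a <= t <= b by apply/andP; split; lra.
  rewrite -[cos (q t)]/(Re (expi (q t) : R[i])) hq //.
  by apply: Qbar_neq1; [exact: arc|rewrite gt_eqF].
have qb : pi *+ 2 - alpha / 2 < q b.
  apply: angle_near_2pi => //; first by rewrite qb0.
  - rewrite -[sin (q b)]/(Im (expi (q b) : R[i])) hq //.
    have bn : b != 0 by rewrite gt_eqF.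
    have [_ ->] := Qbar_psi halpha hgap hatom (arc b bab) bn.
    rewrite pmulr_llt0 // invr_gt0 ltr_wpDr ?sqr_ge0 // divr_gt0 //.
  - rewrite -[cos (q b)]/(Re (expi (q b) : R[i])) hq //.
    by apply: Qbar_near_end => //; [exact: arc|rewrite gt_eqF].
pose f t := - q (- t).
have cf : continuous f.
  move=> t; apply: cvgN; apply: (@continuous_comp _ _ _ (fun t => - t) q); last exact: cq.
  exact: cvgN.
have f0 : f 0 = 0 by rewrite /f oppr0 q00 oppr0.
have fa0 : 0 < f (- a).
  by rewrite /f opprK oppr_gt0 -q00; apply: qinc => //; lra.
have cosf t : cos (f t) = cos (q (- t)) by rewrite /f cosN.
have fa2 : f (- a) < pi *+ 2.
  apply: (argument_lt_2pi _ cf f0) => //; first by rewrite oppr_gt0.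
  move=> t /andP[t0 ta]; have tab : a <= - t <= b by apply/andP; split; lra.
  rewrite cosf; rewrite -[cos (q (- t))]/(Re (expi (q (- t)) : R[i])) hq //.
  by apply: Qbar_neq1; [exact: arc|rewrite oppr_eq0 gt_eqF].
have fa : pi *+ 2 - alpha / 2 < f (- a).
  have an : a != 0 by rewrite lt_eqF.
  apply: angle_near_2pi => //; first by rewrite fa0.
  - rewrite /f opprK sinN oppr_lt0.
    rewrite -[sin (q a)]/(Im (expi (q a) : R[i])) hq //.
    have [_ ->] := Qbar_psi halpha hgap hatom (arc a aab) an.
    rewrite divr_gt0 // ltr_wpDr ?sqr_ge0 // divr_gt0 //.
  - rewrite cosf opprK; rewrite -[cos (q a)]/(Re (expi (q a) : R[i])) hq //.
    by apply: Qbar_near_end => //; exact: arc.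
move: fa fa2; rewrite /f opprK => fa fa2.
have q4 : q b - q a < pi *+ 4.
  by move: qb2 fa2; rewrite !mulrS !mulr0n; lra.
pose phi2 t := t + q t - phi t.
have cphi2 : continuous phi2.
  move=> t; apply: cvgB; last exact: cphi.
  by apply: cvgD; [exact: cvg_id|exact: cq].
have hphi2 t : a <= t <= b -> expi (phi2 t) = u2 t.
  move=> tab; rewrite /phi2 expiB expiD hq // hphi // -u12 ?arc //.
  have [_ n1 _ _ _] := h1; rewrite mulrAC mulJ n1 ?arc //.
  by rewrite mul1r.
have t1 := no_full_turn h1 a2 ab b2 cq cphi hq hphi q4.
have t2 := no_full_turn h2 a2 ab b2 cq cphi2 hq hphi2 q4.
by move: t1 t2 qb fa; rewrite /phi2 !(mulr2n pi) => *; lra.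
Qed.

End TwoCurves.
End Contradiction.

(** * Barycentres on the circle *)

Section Dirac.
Variable R : realType.
Implicit Types (mu : probability (borel_circle R) R) (z w : R[i]).

Lemma circle_point z : nsq z = 1 -> exists c : borel_circle R, cv c = z.
Proof.
move=> z1; have zP : [set z : Cplx R | `|z| = 1] z by apply/eq1_nsq.
by exists (exist _ (z : Cplx R) (mem_set zP)).
Qed.

Lemma nsq_mean mu : nsq (cint mu (@cv R)) <= 1.
Proof. by apply: nsq_cint_le; [exact: bmf_cv|move=> xi; rewrite nsq_cv]. Qed.

(** A barycentre on the circle is an extreme point of the disk. *)
Lemma unimodular_mean_dirac mu : nsq (cint mu (@cv R)) = 1 ->
  exists c : borel_circle R, is_dirac_at c mu.
Proof.
set m := cint mu _ => m1; have [c cm] := circle_point m1; exists c.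
pose g (xi : borel_circle R) : R := nsq (cv xi - m).
have bg : bmf (fun xi => (cv xi - m) * cj (cv xi - m)).
  have b : bmf (fun xi => cv xi - m) by apply: bmfD; [exact: bmf_cv|exact: bmf_cst].
  exact (bmfM b (bmfJ b)).
have gE xi : g xi = Re ((cv xi - m) * cj (cv xi - m)) by rewrite mulJ.
have mg : measurable_fun setT g.
  by case: bg => h _ _; rewrite (_ : g = fun xi => Re ((cv xi - m) * cj (cv xi - m))) //; exact/funext.
have [ig _] := bmf_integrable mu bg.
have Ig : (\int[mu]_xi (g xi)%:E = 0)%E.
  have : Re (cint mu (fun xi => (cv xi - m) * cj (cv xi - m))) = 0.
    have -> : cint mu (fun xi => (cv xi - m) * cj (cv xi - m)) =
        cint mu (fun xi => 2 + ((- cj m) * cv xi + (- m) * cj (cv xi))).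
      apply: eq_cint => xi; rewrite !conjcE.
      transitivity (cv xi * cj (cv xi) + m * cj m + ((- cj m) * cv xi + (- m) * cj (cv xi))).
        by ring.
      by rewrite !mulJ nsq_cv m1; congr (_ + _).
    have b1 (a : R[i]) h : bmf h -> bmf (fun xi => a * h xi).
      by move=> bh; exact (bmfM (bmf_cst a) bh).
    have bcv := @bmf_cv R; have bcj := bmfJ bcv.
    have b1cv := b1 (- cj m) _ bcv; have b1cj := b1 (- m) _ bcj.
    rewrite (cintD mu (bmf_cst 2) (bmfD b1cv b1cj)) (cintD mu b1cv b1cj).
    rewrite cint_cst (cintZ mu (- cj m) bcv) (cintZ mu (- m) bcj) cintJ // -/m.
    have -> : 2 + (- cj m * m + - m * cj m) = 2 - (m * cj m + m * cj m) :> R[i] by ring.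
    by rewrite mulJ m1 -[(1%:C)]/(1 : R[i]) -[1 + 1]/(2 : R[i]) subrr.
  rewrite /cint /cintegral /= /Rintegral.
  have -> : (\int[mu]_xi (Re ((cv xi - m) * cj (cv xi - m)))%:E = \int[mu]_xi (g xi)%:E)%E.
    by apply: eq_integral => xi _; rewrite gE.
  have fin : (\int[mu]_xi (g xi)%:E)%E \is a fin_num.
    apply: integrable_fin_num => //.
    by apply: eq_integrable ig => // xi _ /=; rewrite gE.
  by move=> h; rewrite -(fineK fin) h.
have g0 : ae_eq mu setT (EFin \o g) (cst 0%E).
  apply/ae_eq_integral_abs => //; first exact/measurable_EFinP.
  rewrite -[RHS]Ig; apply: eq_integral => xi _ /=.
  by rewrite ger0_norm ?nsq_ge0.
have mc := measurable_circle_point c.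
have nc : mu (~` [set c]) = 0%E.
  have [N [mN N0 sN]] := g0.
  apply: (subset_measure0 _ mN _ N0); first exact: measurableC.
  move=> xi xc; apply: sN => /= /(_ I) [] /eqP; rewrite nsq_eq0 subr_eq0 -cm => /eqP h.
  by apply: xc; exact: cv_inj.
move=> A mA; rewrite diracE; case: (boolP (c \in A)) => cA.
  have nA : mu (~` A) = 0%E.
    apply: (subset_measure0 _ _ _ nc); [exact: measurableC|exact: measurableC|].
    by move=> xi nA /= E; apply: nA; rewrite E; rewrite inE in cA.
  by have := probability_setC mu (measurableC mA); rewrite nA setCK sube0.
apply: (subset_measure0 _ _ _ nc) => //; first exact: measurableC.
by move=> xi xA /= E; move: cA; rewrite -E => /negP; apply; rewrite inE.
Qed.

Lemma mean_dirac (c : borel_circle R) : cint \d_c (@cv R) = cv c.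
Proof.
have [m1 m2 _] := @bmf_cv R.
apply: complex_eq => /=; rewrite /Rintegral integral_dirac //.
- by rewrite diracT mul1e.
- exact/measurable_EFinP.
- by rewrite diracT mul1e.
- exact/measurable_EFinP.
Qed.

(** The Pick inequality between [w] and 0 degenerates: the maximum principle. *)
Lemma mtrans_unimodular_mean mu w : nsq (cint mu (@cv R)) = 1 -> nsq w < 1 ->
  mtrans mu w = cint mu (@cv R).
Proof.
set m := cint mu _ => m1 w1; have o1 : nsq (0 : R[i]) < 1 by rewrite nsq0.
have S1 : nsq (1 - w * cj 0) = 1.
  by rewrite (_ : 1 - w * cj 0 = 1) ?nsq1 //; apply: complex_eq; rewrite !cReImE /=; ring.
have s0 : 0 < 1 - nsq w by rewrite subr_gt0.
have := mtrans_pick2 mu w1 o1 (ltW s0).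
rewrite {1}/pick2 S1 nsq0 subr0 !mulr1 lexx => /(_ isT).
rewrite /pick2 mtrans0 -/m m1 subrr mulr0 pmulr_rle0 // => h.
have : nsq (1 - mtrans mu w * cj m) == 0 by rewrite eq_le h nsq_ge0.
rewrite nsq_eq0 subr_eq0 => /eqP e.
have : m * 1 = m * (mtrans mu w * cj m) by rewrite -e.
by rewrite mulr1 mulrCA mulJ m1 mulr1 => ->.
Qed.

End Dirac.

(** * Rotations *)

Section Sstar.
Variable R : realType.

Lemma Sstar_id : Sstar (fun z : Cplx R => z).
Proof.
have did (z : Cplx R) : is_diff z (fun w : Cplx R => w) id by exact: is_diff_id.
split => [z _|z zd|//|].
- by apply/derivable1_diffP; exact: ex_diff.
- exact: ltW.
- rewrite derive1E'; last exact: ex_diff.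
  by rewrite diff_val; apply/eqP; exact: oner_neq0.
Qed.

Lemma Sstar_rotate (Z : Cplx R -> Cplx R) (k a : R[i]) : nsq k = 1 -> nsq a = 1 ->
  Sstar Z -> Sstar (fun z : Cplx R => k * Z (a * z)).
Proof.
move=> k1 a1 [dZ Z1 Z0 dZ0].
have ad (z : Cplx R) : disk z -> disk (a * z : Cplx R).
  by move=> /disk_nsq h; apply/disk_nsq; rewrite nsqM a1 mul1r.
pose sc (b : R[i]) : Cplx R -> Cplx R := *:%R b.
have dsc b (z : Cplx R) : is_diff z (sc b) (sc b) by exact: is_diff_scaler.
have dZa (z : Cplx R) : disk z -> differentiable (Z \o sc a) z.
  move=> z1; apply: differentiable_comp; first exact: ex_diff.
  by apply/derivable1_diffP; apply: dZ; exact: ad.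
have fE : (fun z : Cplx R => k * Z (a * z)) = sc k \o (Z \o sc a) by [].
have df (z : Cplx R) : disk z -> differentiable (sc k \o (Z \o sc a)) z.
  by move=> z1; apply: differentiable_comp; [exact: dZa|exact: ex_diff].
have d0 : disk (0 : Cplx R) by apply/disk_nsq; rewrite nsq0.
split.
- by move=> z z1; apply/derivable1_diffP; rewrite fE; exact: df.
- move=> z z1; apply/le1_nsq; rewrite nsqM k1 mul1r; apply/le1_nsq; apply: Z1.
  exact: ad.
- by rewrite mulr0 Z0 mulr0.
- have k0 : k != 0 by rewrite -nsq_gt0 k1.
  have a0 : a != 0 by rewrite -nsq_gt0 a1.
  have dZ00 : differentiable Z (0 : Cplx R) by apply/derivable1_diffP; exact: dZ.
  have sa0 : sc a 0 = 0 by exact: scaler0.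
  have dZ0' : differentiable Z (sc a 0) by rewrite sa0.
  have eZ := derive1E' dZ00.
  have eF := derive1E' (df 0 d0).
  have da : differentiable (sc a) (0 : Cplx R) by exact: ex_diff.
  have dk : differentiable (sc k) ((Z \o sc a) 0) by exact: ex_diff.
  have e1 := congr1 (@^~ (1 : Cplx R)) (diff_comp (dZa 0 d0) dk).
  have e2 := congr1 (@^~ (1 : Cplx R)) (diff_comp da dZ0').
  have ek (x y : Cplx R) : 'd (sc k) x y = sc k y by rewrite diff_val.
  have ea (x y : Cplx R) : 'd (sc a) x y = sc a y by rewrite diff_val.
  have eZa : 'd Z (sc a 0) (sc a 1) = sc a ('d Z (sc a 0) 1) by exact: linearZ.
  have {}e2 : 'd (Z \o sc a) 0 (1 : Cplx R) = 'd Z (sc a 0) (sc a 1).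
    by rewrite -(ea 0 1); exact: e2.
  have {}e1 : 'd (sc k \o (Z \o sc a)) 0 (1 : Cplx R) = sc k ('d (Z \o sc a) 0 (1 : Cplx R)).
    by rewrite -(ek ((Z \o sc a) 0)); exact: e1.
  rewrite sa0 in e2 eZa.
  have {}eF : derive1 (sc k \o (Z \o sc a)) 0 = sc k (sc a (derive1 Z 0)).
    by rewrite eF e1 e2 eZa eZ.
  rewrite fE; move: eF dZ0.
  move: (derive1 _ _) (derive1 _ _) => F' Z' -> Z'0 /eqP.
  rewrite /sc scaler_eq0 (negbTE k0) /= scaler_eq0.
  by rewrite (negbTE a0) /= => /eqP.
Qed.

End Sstar.

(** * Indecomposability *)

Section Convolution.
Variable R : realType.
Implicit Types (mu : probability (borel_circle R) R) (z w : R[i]).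

Lemma Mstar_mean mu : Mstar mu -> cint mu (@cv R) != 0.
Proof. by move=> h; apply/eqP. Qed.

(** [Z1] is the rotation by the barycentre [m], so [Qtrans mu z = Qtrans mu1 (m z)]
    and the inverse rotation recovers [mu1]; its second subordination function is
    [Z2], rotated on both sides. *)
Lemma fmconv_unimodular_mean mu1 mu2 mu : nsq (cint mu2 (@cv R)) = 1 ->
  Mstar mu1 -> Mstar mu -> is_fmconv mu1 mu2 mu ->
  exists c : borel_circle R, is_fmconv mu \d_c mu1.
Proof.
set m := cint mu2 _ => m1 hmu1 hmu [_ [Z1 [Z2 [[dZ1 _ Z10 _] SZ2 ZZ Q12 QQ]]]].
have [dZ2 _ Z20 _] := SZ2.
have mJ1 : nsq (cj m) = 1 by rewrite nsqJ.
have [c cE] := circle_point mJ1; exists c; split=> //.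
have sub w : nsq w < 1 -> [/\ nsq (Z2 w) <= nsq w, Z1 w = w * m &
    Z2 w = w * mtrans mu1 (w * m)].
  move=> w1; have [h1 h2 h3 h4] := subordination (Mstar_mean hmu)
    (derivable_continuous_on_disk dZ1) (derivable_continuous_on_disk dZ2) Z10 Z20
    (fun z hz => ZZ z ((disk_nsq z).2 hz)) (fun z hz => Q12 z ((disk_nsq z).2 hz))
    (fun z hz => QQ z ((disk_nsq z).2 hz)) w1.
  have h5 : Z1 w = w * m.
    by rewrite h3 (mtrans_unimodular_mean m1) //; exact: le_lt_trans h2 w1.
  by split => //; rewrite h4 h5.
have mmJ : m * cj m = 1 by rewrite mulJ m1.
exists (fun z => cj m * z), (fun z => m * m * Z2 (cj m * z)).
have mm1 : nsq (m * m) = 1 by rewrite nsqM m1 mulr1.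
have rot z : nsq z < 1 -> [/\ nsq (cj m * z) < 1,
    Qtrans mu (cj m * z) = z * mtrans mu1 z,
    m * m * Z2 (cj m * z) = m * (z * mtrans mu1 z) &
    Qtrans \d_c (m * m * Z2 (cj m * z)) = z * mtrans mu1 z].
  move=> z1; have w1 : nsq (cj m * z) < 1 by rewrite nsqM mJ1 mul1r.
  have [h1 h2 h3] := sub _ w1.
  have wm : cj m * z * m = z by rewrite mulrAC [cj m * m]mulrC mmJ mul1r.
  rewrite wm in h2 h3.
  have Q1 : Qtrans mu (cj m * z) = z * mtrans mu1 z.
    by rewrite QQ ?h2 ?QtransE //; exact/disk_nsq.
  have E : m * m * Z2 (cj m * z) = m * (z * mtrans mu1 z).
    rewrite h3; transitivity (m * (m * cj m) * (z * mtrans mu1 z)); first by ring.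
    by rewrite mmJ mulr1.
  split => //.
  have E1 : nsq (m * m * Z2 (cj m * z)) < 1.
    by rewrite nsqM mm1 mul1r; exact: le_lt_trans h1 w1.
  rewrite QtransE // mtrans_unimodular_mean // mean_dirac cE //.
  by rewrite E mulrAC mmJ mul1r.
split.
- have := Sstar_rotate mJ1 (nsq1 R) (Sstar_id R).
  by congr Sstar; apply/funext => z; rewrite mul1r.
- exact: Sstar_rotate.
- move=> z /disk_nsq z1; have [_ -> -> _] := rot z z1.
  transitivity ((m * cj m) * (z * (z * mtrans mu1 z))); first by ring.
  by rewrite mmJ mul1r.
- by move=> z /disk_nsq z1; have [_ -> _ ->] := rot z z1.
- by move=> z /disk_nsq z1; have [_ -> _ _] := rot z z1; rewrite QtransE.
Qed.

End Convolution.

Theorem theorem8p3 (R : realType) (alpha : R)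
  (halpha : 0 < alpha < pi)
  (mu : probability (borel_circle R) R)
  (hmu : Mstar mu)
  (hmu1 : (0 < mu [set circle1 R])%E)
  (hmuarc : mu (open_arc alpha `\ circle1 R) = 0%E)
  (hmuC : (0 < mu (~` open_arc alpha))%E)
  (hlim_l : complex.Im (psi mu (expi t)) @[t --> alpha^'-] --> -oo)
  (hlim_r : complex.Im (psi mu (expi t)) @[t --> (- alpha)^'+] --> +oo) :
  indecomposable mu.
Proof.
split.
  move=> [c hc]; have m1 := measurable_circle_point (circle1 R : borel_circle R).
  have mC := measurableC (measurable_open_arc halpha).
  move: hmu1 hmuC; rewrite !hc // !diracE.
  case: (boolP (c \in [set circle1 R])) => [|_]; last by rewrite ltxx.
  rewrite inE => /= -> _; rewrite memNset ?ltxx //=.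
  by apply; exact: open_arc1.
move=> mu1 [hM1 [mu2 [hM2 hconv]]].
have [m1|m1] := eqVneq (nsq (cint mu1 (@cv R))) 1.
  by have [c hc] := unimodular_mean_dirac m1; exists c; left.
have [m2|m2] := eqVneq (nsq (cint mu2 (@cv R))) 1.
  have [c hc] := fmconv_unimodular_mean m2 hM1 hmu hconv.
  by exists c; right.
exfalso.
have {}m1 : nsq (cint mu1 (@cv R)) < 1 by rewrite lt_neqAle m1 nsq_mean.
have {}m2 : nsq (cint mu2 (@cv R)) < 1 by rewrite lt_neqAle m2 nsq_mean.
have [_ [Z1 [Z2 [[dZ1 _ Z10 _] [dZ2 _ Z20 _] ZZ Q12 QQ]]]] := hconv.
have [U [UU U1]] := ultraFilterLemma (at_left_proper_filter (1 : R)).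
have m0 := Mstar_mean hmu.
have c1 := derivable_continuous_on_disk dZ1.
have c2 := derivable_continuous_on_disk dZ2.
have {}ZZ z : nsq z < 1 -> Z1 z * Z2 z = z * Qtrans mu1 (Z1 z).
  by move=> /disk_nsq; exact: ZZ.
have {}Q12 z : nsq z < 1 -> Qtrans mu1 (Z1 z) = Qtrans mu2 (Z2 z).
  by move=> /disk_nsq; exact: Q12.
have {}QQ z : nsq z < 1 -> Qtrans mu z = Qtrans mu1 (Z1 z).
  by move=> /disk_nsq; exact: QQ.
have ZZ' z : nsq z < 1 -> Z2 z * Z1 z = z * Qtrans mu2 (Z2 z).
  by move=> z1; rewrite mulrC ZZ // Q12.
have Q12' z : nsq z < 1 -> Qtrans mu2 (Z2 z) = Qtrans mu1 (Z1 z).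
  by move=> z1; rewrite Q12.
have QQ' z : nsq z < 1 -> Qtrans mu z = Qtrans mu2 (Z2 z).
  by move=> z1; rewrite QQ // Q12.
have [e1 [u1 hu1 lu1]] := boundary_curve halpha hmuarc hmu1 m0 m1 c1 c2 Z10 Z20
  ZZ Q12 QQ UU U1.
have [e2 [u2 hu2 lu2]] := boundary_curve halpha hmuarc hmu1 m0 m2 c2 c1 Z20 Z10
  ZZ' Q12' QQ' UU U1.
apply: (two_curves_false halpha hmuarc hmu1 hlim_l hlim_r hu1 hu2) => t ta.
have rad : ccvg U (fun r : R => r%:C * expi t) (expi t).
  have [h1 h2] := ccvg_radial (expi t : R[i]).
  by split; [apply: cvg_trans h1|apply: cvg_trans h2]; move=> A /U1.
have l1 : ccvg U (fun r : R => Z1 (r%:C * expi t) * Z2 (r%:C * expi t)) (u1 t * u2 t).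
  exact: ccvgM.
have l2 : ccvg U (fun r : R => r%:C * expi t * Qbar alpha mu (r%:C * expi t))
    (expi t * Qbar alpha mu (expi t)).
  by apply: ccvgM => //; apply: ccvg_Qbar => //; exact: disk_or_arc_expi.
apply: (ccvg_near_unique _ l1 l2).
have : \forall r \near U, nsq (r%:C * (expi t : R[i])) < 1.
  by apply: U1; apply: filterS (near_radial_disk R) => r; apply; rewrite nsq_expi.
apply: filterS => r r1; rewrite ZZ // Qbar_disk // QQ //.
Qed.
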